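(* Suppose that $\pi(Z,L)$ is a uniform regular weighting function (URWF) over the support of $q(a)$. Then the efficient influence function (EIF) for $$\psi_{\pi,q}^o:=\int_{\mathcal A}\int_{\mathcal L}\mu_\pi^o(a,l)\,\mathrm dP_L(l)\,q(a)\,\mathrm dP_A(a)$$ in the nonparametric model is $$\delta^o(A,L)\,(Z_\pi-\rho_\pi^o(L))\,\frac{Y-\mu_\pi^o(A,L)}{\kappa_\pi^o(A,L)}\,q(A)-(Z_\pi-\rho_\pi^o(L))\int\frac{\eta^o(a,L)-\mu_\pi^o(a,L)}{\kappa_\pi^o(a,L)}\,q(a)\,\mathrm dP_A(a)$$ $$+\;q(A)\int\mu_\pi^o(A,l)\,\mathrm dP_L(l)+\int\mu_\pi^o(a,L)\,q(a)\,\mathrm dP_A(a)-2\psi_{\pi,q}^o .$$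
   Context: Setting. Observed data $O=[L,Z,A,Y]$, where $Y\in\mathcal Y\subseteq\mathbb R$ is an outcome, $A$ a continuous treatment whose support $\mathcal A\subseteq\mathbb R$ is closed (interior $\mathring{\mathcal A}$), $Z\in\mathcal Z\subseteq\mathbb R^{d_Z}$ an instrument, $L\in\mathcal L\subseteq\mathbb R^{d_L}$ observed confounders. $P_A,P_L$ denote marginal distributions, $p_A,p_{A\mid L}$ densities. Throughout, $p_{A\mid L}(a\mid L)>0$ for all $a\in\mathring{\mathcal A}$ almost surely. $q:\mathcal A\to\mathbb R$ is a fixed known function (so that $q(a)p_A(a)$ plays the role of a treatment density), and $\pi(Z,L)$ is a fixed weighting function. The nonparametric model is the unrestricted model for the law of $O$; influence functions are with respect to pathwise differentiable parametric submodels $p_\theta(O)$ through the true law. Notation. $Z_\pi:=\pi(Z,L)$; $\rho_\pi^o(L):=\mathbb E[Z_\pi\mid L]$; $\kappa_\pi^o(A,L):=\mathbb E[Z_\pi\mid A,L]-\mathbb E[Z_\pi\mid L]$; $\eta^o(A,L):=\mathbb E[Y\mid A,L]$; $\delta^o(A,L):=p_A(A)/p_{A\mid L}(A\mid L)$; $$\mu_\pi^o(a,l):=\frac{\mathbb E[YZ_\pi\mid A=a,L=l]-\mathbb E[Y\mid A=a,L=l]\,\mathbb E[Z_\pi\mid L=l]}{\mathbb E[Z_\pi\mid A=a,L=l]-\mathbb E[Z_\pi\mid L=l]}.$$ URWF. A measurable $\pi:\mathcal Z\times\mathcal L\to\mathbb R$ is a URWF for $\mathcal N\subseteq\mathring{\mathcal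 A}$ if it is uniformly bounded and there is a constant $\epsilon_\pi(\mathcal N)>0$ such that for all $a\in\mathcal N$, $|\kappa_\pi^o(a,L)|\ge\epsilon_\pi(\mathcal N)$ almost surely.
   Formalization: Assumes E|Y|<∞ and E[(1+δ²)q(A)²(1+Y²)]<∞ (otherwise the formula may have infinite variance); submodels have common support, likelihood ratio differentiable in L²(P), π uniformly regular along the path and E_t[|Y| given A,L] dominated. *)

(* Defs.v *)
From HB Require Import structures.
From mathcomp Require Import all_boot all_order all_algebra.
From mathcomp Require Import all_classical all_reals all_analysis.

Set Implicit Arguments.
Unset Strict Implicit.
Unset Printing Implicit Defensive.
Import Order.TTheory GRing.Theory Num.Theory.
Import numFieldNormedType.Exports.
Local Open Scope classical_set_scope.
Local Open Scope ring_scope.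

Section ConditionalExpectation.
Context d d' (T : measurableType d) (U : measurableType d') (R : realType).
Implicit Types (P : probability T R) (V : {mfun T >-> U}) (X : T -> R).

(* [g] is a version of the regression function [u |-> E[X | V = u]]. *)
Definition is_cond_exp P V X (g : U -> R) : Prop :=
  [/\ P.-integrable [set: T] (EFin \o X),
      measurable_fun [set: U] g,
      P.-integrable [set: T] (EFin \o (g \o V)) &
      forall B, measurable B ->
        \int[P]_(o in V @^-1` B) X o = \int[P]_(o in V @^-1` B) g (V o)].

(* A chosen version; the zero function when [X] is not integrable. *)
Definition cond_exp P V X : U -> R :=
  xget (cst 0) [set g | is_cond_exp P V X g].

End ConditionalExpectation.

Section InfluenceFunctions.
Context d (T : measurableType d) (R : realType).
Implicit Types (P : probability T R) (Pt : R -> probability T R) (phi s : T -> R).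

(* One-dimensional submodel [t |-> Pt t] through [P] at [t = 0], with common
   support; [g t] is the likelihood ratio dPt/dP.  It is differentiable at
   [t = 0] in L^2(P), which implies differentiability in quadratic mean, and its
   derivative [s] is the score at [t = 0].  Values of [Pt t] for [t] away from
   0 are irrelevant. *)
Definition is_submodel P Pt (g : R -> T -> R) s : Prop :=
  [/\ forall B, measurable B -> Pt 0 B = P B,
      \forall t \near (0 : R),
        [/\ measurable_fun [set: T] (g t),
            {ae P, forall o, 0 < g t o} &
            forall B, measurable B ->
              Pt t B = (\int[P]_(o in B) (g t o)%:E)%E],
      measurable_fun [set: T] s,
      P.-integrable [set: T] (fun o => (s o ^+ 2)%:E) &
      (fun t : R => (\int[P]_o (((g t o - 1) / t - s o) ^+ 2)%:E)%E)
        @ (0 : R)^' --> (0%:E : \bar R)].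

(* Below, [reg] is the class of submodels along which the parameter is
   required to be differentiable; the model itself is unrestricted. *)
Definition is_score P (reg : (R -> probability T R) -> Prop) s : Prop :=
  exists Pt g, is_submodel P Pt g s /\ reg Pt.

(* L^2(P)-closure of the linear span of the scores. *)
Definition in_tangent_space P (reg : (R -> probability T R) -> Prop) phi : Prop :=
  forall e : R, 0 < e ->
    exists n (c : 'I_n -> R) (s : 'I_n -> T -> R),
      (forall i, is_score P reg (s i)) /\
      (\int[P]_o ((phi o - \sum_(i < n) c i * s i o) ^+ 2)%:E < e%:E)%E.

Definition is_influence_function P (reg : (R -> probability T R) -> Prop)
    (psi : probability T R -> R) phi : Prop :=
  [/\ measurable_fun [set: T] phi,
      P.-integrable [set: T] (fun o => (phi o ^+ 2)%:E),
      \int[P]_o phi o = 0 &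
      forall Pt g s, is_submodel P Pt g s -> reg Pt ->
        is_derive (0 : R) (1 : R) (fun t : R => psi (Pt t) : R)
          (\int[P]_o (phi o * s o))].

Definition is_efficient_influence_function P
    (reg : (R -> probability T R) -> Prop) (psi : probability T R -> R) phi :=
  is_influence_function P reg psi phi /\ in_tangent_space P reg phi.

End InfluenceFunctions.

Definition law_support (R : realType) (m : set R -> \bar R) : set R :=
  [set a | forall U : set R, open U -> U a -> (0 < m U)%E].

(* Observations [(L, Z, A, Y)]. *)
Notation obs R dL dZ := (dL.-tuple R * dZ.-tuple R * R * R)%type.

Section Coordinates.
Context (R : realType) (dL dZ : nat).
Let O := obs R dL dZ.

Definition cL (o : O) : dL.-tuple R := o.1.1.1.
Definition cZ (o : O) : dZ.-tuple R := o.1.1.2.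
Definition cA (o : O) : R := o.1.2.
Definition cY (o : O) : R := o.2.
Definition cAL (o : O) : R * dL.-tuple R := (cA o, cL o).

Lemma measurable_cL : measurable_fun [set: O] cL.
Proof.
by apply: (measurableT_comp measurable_fst);
   apply: (measurableT_comp measurable_fst); exact: measurable_fst.
Qed.
HB.instance Definition _ := isMeasurableFun.Build _ _ _ _ cL measurable_cL.

Lemma measurable_cA : measurable_fun [set: O] cA.
Proof. by apply: (measurableT_comp measurable_snd); exact: measurable_fst. Qed.
HB.instance Definition _ := isMeasurableFun.Build _ _ _ _ cA measurable_cA.

Lemma measurable_cAL : measurable_fun [set: O] cAL.
Proof. by apply/measurable_fun_pair; [exact: measurable_cA|exact: measurable_cL]. Qed.
HB.instance Definition _ := isMeasurableFun.Build _ _ _ _ cAL measurable_cAL.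

End Coordinates.

Section Functional.
Context (R : realType) (dL dZ : nat).
Let O := obs R dL dZ.
Implicit Types (P : probability O R) (w : dZ.-tuple R * dL.-tuple R -> R).
Implicit Types (q : R -> R) (pA : R -> R) (pAL : R * dL.-tuple R -> R).

Definition law_A P := distribution P (@cA R dL dZ).
Definition law_L P := distribution P (@cL R dL dZ).

Definition supp_A P : set R := law_support (law_A P).

(* The weighting function pi is written [w]: [pi] is already a real constant. *)
Definition Zpi w (o : O) : R := w (cZ o, cL o).

Definition rho P w : dL.-tuple R -> R := cond_exp P (@cL R dL dZ) (Zpi w).

Definition kappa P w (al : R * dL.-tuple R) : R :=
  cond_exp P (@cAL R dL dZ) (Zpi w) al - rho P w al.2.

Definition eta P : R * dL.-tuple R -> R :=
  cond_exp P (@cAL R dL dZ) (@cY R dL dZ).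

Definition mu P w (al : R * dL.-tuple R) : R :=
  (cond_exp P (@cAL R dL dZ) (fun o => cY o * Zpi w o) al
     - eta P al * rho P w al.2) / kappa P w al.

(* [S] is the support of the treatment, kept fixed as the law [P] varies. *)
Definition psi (S : set R) q w P : R :=
  \int[law_A P]_(a in S) ((\int[law_L P]_l mu P w (a, l)) * q a).

Definition is_density_A P pA : Prop :=
  [/\ measurable_fun [set: R] pA, forall a, 0 <= pA a &
      forall B : set R, measurable B ->
        law_A P B = (\int[@lebesgue_measure R]_(a in B) (pA a)%:E)%E].

Definition is_cond_density_AL P pAL : Prop :=
  [/\ measurable_fun [set: R * dL.-tuple R] pAL, forall al, 0 <= pAL al &
      forall (B : set R) (C : set (dL.-tuple R)), measurable B -> measurable C ->
        P (@cA R dL dZ @^-1` B `&` @cL R dL dZ @^-1` C) =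
        (\int[law_L P]_(l in C)
           \int[@lebesgue_measure R]_(a in B) (pAL (a, l))%:E)%E].

Definition positivity P pAL : Prop :=
  forall a, (supp_A P)° a -> {ae law_L P, forall l, 0 < pAL (a, l)}.

Definition delta pA pAL (al : R * dL.-tuple R) : R := pA al.1 / pAL al.

(* |kappa(a, L)| >= e almost surely, for each a in N.  Since this is a statement
   about every single a, it is required of some version of kappa instead of
   the version chosen by [cond_exp]. *)
Definition kappa_bounded_below P w (N : set R) (e : R) : Prop :=
  exists m r, [/\ is_cond_exp P (@cAL R dL dZ) (Zpi w) m,
    is_cond_exp P (@cL R dL dZ) (Zpi w) r &
    forall a, N a -> {ae law_L P, forall l, e <= `|m (a, l) - r l|}].

Definition urwf P w (N : set R) : Prop :=
  [/\ N `<=` (supp_A P)°,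
      measurable_fun [set: dZ.-tuple R * dL.-tuple R] w,
      exists M : R, forall zl, `|w zl| <= M &
      exists2 e : R, 0 < e & kappa_bounded_below P w N e].

Definition supp_q P q : set R := [set a | supp_A P a /\ q a != 0].

(* With [f = cY], finiteness makes the four terms of [eif] square-integrable and
   the double integral [psi] absolutely convergent. *)
Definition weighted_moment P pA pAL q (f : O -> R) : \bar R :=
  (\int[P]_o ((1 + delta pA pAL (cAL o) ^+ 2) * q (cA o) ^+ 2
                * (1 + f o ^+ 2))%:E)%E.

(* Local conditions at [t = 0] under which psi(Pt t) is well defined and can be
   differentiated: [w] stays uniformly regular under [Pt t], with a constant that
   does not depend on [t], and E_t[|Y| | A, L] is dominated.  Both hold
   along [t |-> (1 + t s) P] for bounded mean-zero [s], so the scores are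
   dense among the mean-zero elements of L^2(P). *)
Definition regular_submodel P pA pAL q w (Pt : R -> probability O R) : Prop :=
  [/\ exists2 e : R, 0 < e &
        \forall t \near (0 : R), kappa_bounded_below (Pt t) w (supp_q P q) e,
      \forall t \near (0 : R),
        (Pt t).-integrable [set: O] (EFin \o @cY R dL dZ) &
      exists h : R * dL.-tuple R -> R,
        [/\ measurable_fun [set: R * dL.-tuple R] h,
            (weighted_moment P pA pAL q (h \o @cAL R dL dZ) < +oo)%E &
            \forall t \near (0 : R), {ae Pt t, forall o,
              cond_exp (Pt t) (@cAL R dL dZ) (fun o' => `|cY o'|) (cAL o)
                <= h (cAL o)}]].

Definition eif P pA pAL q w (o : O) : R :=
  let S := supp_A P in
  delta pA pAL (cAL o) * (Zpi w o - rho P w (cL o))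
    * ((cY o - mu P w (cAL o)) / kappa P w (cAL o)) * q (cA o)
  - (Zpi w o - rho P w (cL o))
    * (\int[law_A P]_(a in S)
         ((eta P (a, cL o) - mu P w (a, cL o)) / kappa P w (a, cL o) * q a))
  + q (cA o) * (\int[law_L P]_l mu P w (cA o, l))
  + \int[law_A P]_(a in S) (mu P w (a, cL o) * q a)
  - 2 * psi S q w P.

End Functional.

(* Main.v *)
(** If a law P' has density [g] with respect to P, the moment equation
E'[phi(A,L) (Y - mu') (Z - rho')] = 0, written for P' and for P, gives the exact identity
   E[phi kappa (mu' - mu)] = E[(g - 1) phi (Y - mu') (Z - rho')] + E[phi (Y - mu') (rho - rho')],
and similarly E[f (rho' - rho)] = E[(g - 1) f (Z - rho')] for functions f of L.  Along a
submodel, taking phi = q sqrt(1 + delta^2) sign(mu' - mu) / kappa shows that mu' tends to mu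
in L^1, hence in L^2 by domination; taking phi = q delta / kappa then yields the derivative of
the integral of q delta mu', which produces the two residual terms of the influence function.
Since [psi] is an integral of q mu against P x P, seen through (A, L) = (A o, L o'), the product
density g(o) g(o') yields the two remaining terms.  Finally, a bounded mean-zero [s] is the
score of t |-> (1 + t s) P, and such [s] are dense in the mean-zero part of L^2(P), which
contains the gradient. *)
From HB Require Import structures.
From mathcomp Require Import all_boot all_order all_algebra.
From mathcomp Require Import all_classical all_reals all_analysis.
From mathcomp Require Import measurable_realfun.
From mathcomp Require Import ring lra.
Require Import Defs.
Set Implicit Arguments.
Unset Strict Implicit.
Unset Printing Implicit Defensive.
Import Order.TTheory GRing.Theory Num.Theory.
Import numFieldNormedType.Exports.
Local Open Scope classical_set_scope.
Local Open Scope ring_scope.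

(** No pointwise smoothness of [mu (Pt t) w] in [t] is available: it is a quotient of arbitrary
    versions of conditional expectations. Only moment equations tested against functions of (A, L)
    or of L are usable, and test functions for mu must vanish where [q = 0], as [kappa] is
    controlled only above [supp_q].

    The sign in the first test function varies with t and need not converge, so the first pass rests
    on domination: |mu'| is at most 2 M / e' times h', uniformly in t. The factor sqrt(1 + delta^2)
    makes one convergence serve two measures: the joint law, with weight q delta, and the product
    law, where q^2 carries the weight delta <= 1 + delta^2.

    In the second pass the delicate term carries rho - rho'. Replacing mu' by mu there costs a
    product of two vanishing differences, which is o(t) because rho' - rho is O(t) in L^2. What
    remains is tested only against functions of L, so q delta (Y - mu) / kappa may be replaced by
    its conditional mean given L, which delta turns into the integral of (eta - mu) / kappa against
    q dP_A. The moment equation for rho then yields the second residual term. *)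

(** * Integrable and square-integrable functions on a probability space *)

Section SquareIntegrable.
Context d (T : measurableType d) (R : realType).
Implicit Types (mu : probability T R) (f g u v b : T -> R) (r C : R).

Definition L1 mu f := mu.-integrable [set: T] (EFin \o f).
(** Measurability is a separate conjunct because a measurable square does not make [f]
    measurable. *)
Definition L2 mu f := measurable_fun [set: T] f /\ L1 mu (fun x => f x ^+ 2).

Lemma L1_measurable mu f : L1 mu f -> measurable_fun [set: T] f.
Proof. by move=> /integrableP[/measurable_EFinP]. Qed.

Lemma L1P mu f : measurable_fun [set: T] f ->
  (\int[mu]_x `|f x|%:E < +oo)%E -> L1 mu f.
Proof. by move=> mf fi; apply/integrableP; split => //; apply/measurable_EFinP. Qed.

Lemma L1_ltoo mu f : L1 mu f -> (\int[mu]_x `|f x|%:E < +oo)%E.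
Proof. by case/integrableP. Qed.

Lemma L1_le_ae mu f g : measurable_fun [set: T] f -> L1 mu g ->
  {ae mu, forall x, `|f x| <= `|g x|} -> L1 mu f.
Proof.
move=> mf gi fg; apply: L1P => //; apply: le_lt_trans (L1_ltoo gi).
apply: ae_ge0_le_integral => //.
- by apply/measurable_EFinP; apply: measurableT_comp.
- by apply/measurable_EFinP; apply: measurableT_comp => //; exact: L1_measurable gi.
- by apply: filterS fg => x fgx _; rewrite lee_fin.
Qed.

Lemma L1_le mu f g : measurable_fun [set: T] f -> L1 mu g ->
  (forall x, `|f x| <= `|g x|) -> L1 mu f.
Proof. by move=> mf gi fg; apply: L1_le_ae mf gi _; exact: aeW. Qed.

Lemma L1D mu f g : L1 mu f -> L1 mu g -> L1 mu (fun x => f x + g x).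
Proof. exact: integrableD. Qed.

Lemma L1N mu f : L1 mu f -> L1 mu (fun x => - f x).
Proof. exact: integrableN. Qed.

Lemma L1B mu f g : L1 mu f -> L1 mu g -> L1 mu (fun x => f x - g x).
Proof. by move=> fi gi; exact: L1D fi (L1N gi). Qed.

Lemma L1Z mu r f : L1 mu f -> L1 mu (fun x => r * f x).
Proof. exact: integrableZl. Qed.

Lemma L1_norm mu f : L1 mu f -> L1 mu (fun x => `|f x|).
Proof. exact: integrable_norm. Qed.

Lemma L1_cst mu r : L1 mu (fun=> r).
Proof. exact: finite_measure_integrable_cst. Qed.

Lemma L1M_bounded mu C b f : measurable_fun [set: T] b ->
  {ae mu, forall x, `|b x| <= C} -> L1 mu f -> L1 mu (fun x => b x * f x).
Proof.
move=> mb bC fi; apply: (@L1_le_ae _ _ (fun x => C * f x)).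
- by apply: measurable_funM => //; exact: L1_measurable fi.
- exact: L1Z.
- by apply: filterS bC => x bC; rewrite !normrM ler_wpM2r// (le_trans bC)// ler_norm.
Qed.

Lemma L2M mu f g : L2 mu f -> L2 mu g -> L1 mu (fun x => f x * g x).
Proof.
move=> [mf fi] [mg gi].
apply: L1_le (L1D fi gi) _; first exact: measurable_funM.
move=> x; rewrite normrM (ger0_norm (addr_ge0 (sqr_ge0 _) (sqr_ge0 _))).
rewrite -(real_normK (num_real (f x))) -(real_normK (num_real (g x))).
have := sqr_ge0 (`|f x| - `|g x|); have := mulr_ge0 (normr_ge0 (f x)) (normr_ge0 (g x)).
nra.
Qed.

Lemma L2_measurable mu f : L2 mu f -> measurable_fun [set: T] f.
Proof. by case. Qed.

Lemma L2_sqr mu f : L2 mu f -> L1 mu (fun x => f x ^+ 2).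
Proof. by case. Qed.

Lemma L2_le_ae mu C f g : measurable_fun [set: T] f -> L2 mu g ->
  {ae mu, forall x, `|f x| <= C * `|g x|} -> L2 mu f.
Proof.
move=> mf [mg gi] fg; split => //.
apply: L1_le_ae (L1Z (C ^+ 2) gi) _; first exact: measurable_funX.
apply: filterS fg => x fg.
rewrite -exprMn !normrX lerXn2r ?nnegrE// normrM (le_trans fg)//.
by rewrite ler_wpM2r// ler_norm.
Qed.

Lemma L2D mu f g : L2 mu f -> L2 mu g -> L2 mu (fun x => f x + g x).
Proof.
move=> f2 g2; split; first by apply: measurable_funD; [case: f2|case: g2].
have := L1D (L1D (L2_sqr f2) (L2_sqr g2)) (L1Z 2 (L2M f2 g2)).
by congr L1; apply/funext => x; ring.
Qed.

Lemma L2Z mu r f : L2 mu f -> L2 mu (fun x => r * f x).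
Proof.
move=> f2; have mf2 := L2_measurable f2; apply: (L2_le_ae (C := `|r|)) f2 _.
  by apply: measurable_funM => //; exact: mf2.
by apply: aeW => x; rewrite normrM.
Qed.

Lemma L2N mu f : L2 mu f -> L2 mu (fun x => - f x).
Proof. by move/(L2Z (-1)); congr L2; apply/funext => x; rewrite mulN1r. Qed.

Lemma L2B mu f g : L2 mu f -> L2 mu g -> L2 mu (fun x => f x - g x).
Proof. by move=> f2 g2; exact: L2D f2 (L2N g2). Qed.

Lemma L2_cst mu r : L2 mu (fun=> r).
Proof. by split; [exact: measurable_cst|exact: L1_cst]. Qed.

Lemma L2M_bounded mu C b f : measurable_fun [set: T] b ->
  {ae mu, forall x, `|b x| <= C} -> L2 mu f -> L2 mu (fun x => b x * f x).
Proof.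
move=> mb bC f2; have mf2 := L2_measurable f2; apply: (L2_le_ae (C := C)) f2 _.
  by apply: measurable_funM => //; exact: mf2.
by apply: filterS bC => x bC; rewrite normrM ler_wpM2r.
Qed.

Lemma L2_bounded mu C b : measurable_fun [set: T] b ->
  {ae mu, forall x, `|b x| <= C} -> L2 mu b.
Proof.
move=> mb bC; have := L2M_bounded mb bC (L2_cst mu 1).
by congr L2; apply/funext => x; rewrite mulr1.
Qed.

Lemma L2_L1 mu f : L2 mu f -> L1 mu f.
Proof.
by move/L2M => /(_ _ (L2_cst mu 1)); congr L1; apply/funext => x; rewrite mulr1.
Qed.

Lemma L2_norm mu f : L2 mu f -> L2 mu (fun x => `|f x|).
Proof.
move=> f2; have mf2 := L2_measurable f2; apply: (L2_le_ae (C := 1)) f2 _.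
  by apply: measurableT_comp => //; exact: mf2.
by apply: aeW => x; rewrite normr_id mul1r.
Qed.

Lemma integralE_L1 mu f : L1 mu f -> (\int[mu]_x (f x)%:E)%E = (\int[mu]_x f x)%:E.
Proof. by move=> fi; rewrite /Rintegral fineK//; exact: integrable_fin_num. Qed.

Lemma Rintegral_ext mu f g : f =1 g -> \int[mu]_x f x = \int[mu]_x g x.
Proof. by move=> /funext ->. Qed.

Lemma Rintegral_prob_cst mu r : \int[mu]_x r = r.
Proof.
rewrite Rintegral_cst// -[RHS]mulr1; congr (_ * _).
exact: (congr1 fine (probability_setT mu)).
Qed.

Lemma Rintegral_sqr_subr0 mu f : \int[mu]_x (f x - 0) ^+ 2 = \int[mu]_x f x ^+ 2.
Proof. by apply: Rintegral_ext => x; rewrite subr0. Qed.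

Lemma eq_Rintegral_ae mu f g : measurable_fun [set: T] f -> measurable_fun [set: T] g ->
  {ae mu, forall x, f x = g x} -> \int[mu]_x f x = \int[mu]_x g x.
Proof.
move=> mf mg fg; rewrite /Rintegral; congr fine; apply: ae_eq_integral => //.
- exact/measurable_EFinP.
- exact/measurable_EFinP.
- by apply: filterS fg => x -> _.
Qed.

Lemma le_Rintegral_ae mu f g : L1 mu f -> L1 mu g ->
  {ae mu, forall x, f x <= g x} -> \int[mu]_x f x <= \int[mu]_x g x.
Proof.
move=> fi gi fg.
have mf := L1_measurable fi; have mg := L1_measurable gi.
(* [g] is almost everywhere equal to the maximum of [f] and [g], which dominates [f] at every
   point. *)
rewrite [leRHS](_ : _ = \int[mu]_x Num.max (f x) (g x)).
  apply: le_Rintegral => //.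
  - apply: L1_le (L1D (L1_norm fi) (L1_norm gi)) _.
      exact: measurable_maxr.
    move=> x; rewrite [leRHS]ger0_norm ?addr_ge0//.
    by rewrite /Num.max; case: ifP => _; rewrite ?lerDr ?lerDl; exact: normr_ge0.
  - by move=> x _; rewrite le_max lexx.
apply: eq_Rintegral_ae => //; first exact: measurable_maxr.
by apply: filterS fg => x /max_idPr.
Qed.

Lemma Rintegral_add mu f g : L1 mu f -> L1 mu g ->
  \int[mu]_x (f x + g x) = \int[mu]_x f x + \int[mu]_x g x.
Proof. exact: RintegralD. Qed.

Lemma Rintegral_eq0_ae mu f : L1 mu f -> (forall x, 0 <= f x) ->
  \int[mu]_x f x = 0 -> {ae mu, forall x, f x = 0}.
Proof.
move=> fi f0 if0; have mf : measurable_fun [set: T] (EFin \o f) by exact: measurable_int fi.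
have : (\int[mu]_x `|(EFin \o f) x| = 0)%E.
  under eq_integral do rewrite gee0_abs ?lee_fin//.
  by rewrite (integralE_L1 fi) if0.
move=> /(ae_eq_integral_abs _ measurableT mf).
by apply: filterS => x /(_ I) [].
Qed.

Lemma Rintegral_cauchy_schwarz mu u v : L2 mu u -> L2 mu v ->
  (\int[mu]_x (u x * v x)) ^+ 2 <= \int[mu]_x u x ^+ 2 * \int[mu]_x v x ^+ 2.
Proof.
move=> u2 v2; set a := \int[mu]_x u x ^+ 2; set b := \int[mu]_x (u x * v x).
set c := \int[mu]_x v x ^+ 2.
have uv := L2M u2 v2.
have quad t : 0 <= a - 2 * t * b + t ^+ 2 * c.
  have -> : a - 2 * t * b + t ^+ 2 * c = \int[mu]_x (u x - t * v x) ^+ 2.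
    transitivity (\int[mu]_x ((u x ^+ 2 + (- (2 * t)) * (u x * v x)) + t ^+ 2 * v x ^+ 2)).
      rewrite !Rintegral_add ?RintegralZl// ?mulNr//;
        by [exact: L2_sqr|exact: L1Z|apply: L1Z; exact: L2_sqr
           |apply: L1D; [exact: L2_sqr|exact: L1Z]].
    by apply: eq_Rintegral => x _; ring.
  by apply: Rintegral_ge0 => x _; exact: sqr_ge0.
have c0 : 0 <= c by apply: Rintegral_ge0 => x _; exact: sqr_ge0.
have [c_eq0|c_neq0] := eqVneq c 0.
  rewrite c_eq0 mulr0; have [->|b0] := eqVneq b 0; first by rewrite expr0n.
  (* With [c = 0] the quadratic is affine in [t]; this [t] is chosen so that its value is -1, a
     contradiction. *)
  have := quad ((a + 1) / (2 * b)); rewrite c_eq0.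
  have -> : 2 * ((a + 1) / (2 * b)) * b = a + 1 by field.
  lra.
have c_gt0 : 0 < c by rewrite lt_def c_neq0.
have := quad (b / c).
have -> : a - 2 * (b / c) * b + (b / c) ^+ 2 * c = a - b ^+ 2 / c by field.
by rewrite subr_ge0 ler_pdivrMr.
Qed.

End SquareIntegrable.

(** * Convergence in L^2 along a filter *)

Section L2Convergence.
Context d (T : measurableType d) (R : realType) (mu : probability T R).
Context (I : Type) (F : set_system I) {FF : ProperFilter F}.
Implicit Types (u v : I -> T -> R) (f g H : T -> R) (a b : I -> R).

Lemma cvg0_le a b : (\forall i \near F, `|a i| <= b i) -> b @ F --> (0 : R) ->
  a @ F --> (0 : R).
Proof.
move=> ab b0; apply: (squeeze_cvgr (f := fun i => - b i) (h := b)) => //.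
- by apply: filterS ab => i; rewrite ler_norml.
- by rewrite -oppr0; exact: cvgN.
Qed.

Lemma cvg_near_eq a b (l : R) : (\forall i \near F, b i = a i) -> b @ F --> l ->
  a @ F --> l.
Proof. by move=> ab; apply: cvg_trans; exact: near_eq_cvg. Qed.

(** Membership of [u i] in L^2 is asked only eventually, since a submodel is constrained only for
    [t] near 0. *)
Definition L2cvg u f :=
  [/\ \forall i \near F, L2 mu (u i), L2 mu f &
      (fun i => \int[mu]_x (u i x - f x) ^+ 2) @ F --> (0 : R)].

Lemma L2cvg_cst f : L2 mu f -> L2cvg (fun=> f) f.
Proof.
move=> f2; split => //; first by near=> i.
rewrite [X in X @ F --> _](_ : _ = fun=> 0); first exact: cvg_cst.
apply/funext => i; rewrite (@Rintegral_ext _ _ _ _ _ (fun=> 0)) ?Rintegral_cst ?mul0r//.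
by move=> x; rewrite subrr expr0n.
Unshelve. all: by end_near. Qed.

Lemma sqr_integralD_le f g : L2 mu f -> L2 mu g ->
  \int[mu]_x (f x + g x) ^+ 2 <= 2 * \int[mu]_x f x ^+ 2 + 2 * \int[mu]_x g x ^+ 2.
Proof.
move=> f2 g2; have fi := L2_sqr f2; have gi := L2_sqr g2.
rewrite -!RintegralZl// -Rintegral_add; [|exact: L1Z..].
apply: le_Rintegral => //; first exact: L2_sqr (L2D f2 g2).
  by apply: L1D; exact: L1Z.
by move=> x _; have := sqr_ge0 (f x - g x); nra.
Qed.

Lemma L2cvgD u v f g : L2cvg u f -> L2cvg v g ->
  L2cvg (fun i x => u i x + v i x) (fun x => f x + g x).
Proof.
move=> [u2 f2 uf] [v2 g2 vg]; split.
- by near=> i; apply: L2D; near: i.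
- exact: L2D.
- apply: (cvg0_le (b := fun i => 2 * \int[mu]_x (u i x - f x) ^+ 2
                              + 2 * \int[mu]_x (v i x - g x) ^+ 2)); last first.
    rewrite (_ : 0 = 2 * 0 + 2 * 0 :> R); last by rewrite mulr0 addr0.
    by apply: cvgD; [(apply: cvgMl_tmp; exact: uf)|(apply: cvgMl_tmp; exact: vg)].
  near=> i; rewrite ger0_norm; last by apply: Rintegral_ge0 => x _; exact: sqr_ge0.
  rewrite (@Rintegral_ext _ _ _ _ _ (fun x => ((u i x - f x) + (v i x - g x)) ^+ 2)).
    by apply: sqr_integralD_le; apply: L2B => //; near: i.
  by move=> x; congr (_ ^+ 2); ring.
Unshelve. all: by end_near. Qed.

Lemma L2cvg0_bounded C (w u : I -> T -> R) :
  (\forall i \near F, measurable_fun [set: T] (w i) /\ {ae mu, forall x, `|w i x| <= C}) ->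
  L2cvg u (fun=> 0) -> L2cvg (fun i x => w i x * u i x) (fun=> 0).
Proof.
move=> wC [u2 _ u0]; split.
- near=> i; have [mw wiC] : measurable_fun [set: T] (w i) /\ {ae mu, forall x, `|w i x| <= C}.
    by near: i.
  by apply: L2M_bounded mw wiC _; near: i.
- exact: L2_cst.
- apply: (cvg0_le (b := fun i => C ^+ 2 * \int[mu]_x (u i x - 0) ^+ 2)); last first.
    by rewrite -[X in _ --> X](mulr0 (C ^+ 2)); (apply: cvgMl_tmp; exact: u0).
  near=> i; rewrite ger0_norm; last by apply: Rintegral_ge0 => x _; exact: sqr_ge0.
  have [mw wiC] : measurable_fun [set: T] (w i) /\ {ae mu, forall x, `|w i x| <= C}.
    by near: i.
  have ui2 : L2 mu (u i) by near: i.
  have ui0 := L2B ui2 (L2_cst mu 0); have wu2 := L2M_bounded mw wiC ui2.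
  rewrite -RintegralZl//; last exact: L2_sqr.
  apply: le_Rintegral_ae.
  - exact: L2_sqr (L2B wu2 (L2_cst mu 0)).
  - exact: L1Z (L2_sqr ui0).
  - apply: filterS wiC => x wxC; rewrite !subr0 exprMn ler_wpM2r ?sqr_ge0//.
    by rewrite -(real_normK (num_real (w i x))) lerXn2r ?nnegrE// (le_trans _ wxC).
Unshelve. all: by end_near. Qed.

Lemma cvg_sqr0 a : (fun i => a i ^+ 2) @ F --> (0 : R) -> a @ F --> (0 : R).
Proof.
move=> /cvgr0Pnorm_le a0; apply/cvgr0Pnorm_le => e e0.
have /a0 : 0 < e ^+ 2 by exact: exprn_gt0.
by apply: filterS => i; rewrite normrX ler_pXn2r ?nnegrE// ltW.
Qed.

(** [u v - f g] is the sum of [(u - f) (v - g)], [(u - f) g] and [f (v - g)], and Cauchy-Schwarz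
    sends each integral to 0. *)
Lemma L2cvg_dot u v f g : L2cvg u f -> L2cvg v g ->
  (fun i => \int[mu]_x (u i x * v i x)) @ F --> \int[mu]_x (f x * g x).
Proof.
move=> [u2 f2 uf] [v2 g2 vg]; apply/subr_cvg0.
have cs0 (p q : I -> T -> R) : (\forall i \near F, L2 mu (p i)) ->
    (\forall i \near F, L2 mu (q i)) ->
    (fun i => \int[mu]_x p i x ^+ 2 * \int[mu]_x q i x ^+ 2) @ F --> (0 : R) ->
    (fun i => \int[mu]_x (p i x * q i x)) @ F --> (0 : R).
  move=> p2 q2 pq0; apply: cvg_sqr0; apply: cvg0_le pq0; near=> i.
  rewrite ger0_norm ?sqr_ge0//; apply: Rintegral_cauchy_schwarz; by near: i.
have uf2 : \forall i \near F, L2 mu (fun x => u i x - f x).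
  by apply: filterS u2 => i ui; exact: L2B.
have vg2 : \forall i \near F, L2 mu (fun x => v i x - g x).
  by apply: filterS v2 => i vi; exact: L2B.
have c1 : (fun i => \int[mu]_x ((u i x - f x) * (v i x - g x))) @ F --> (0 : R).
  by apply: cs0 => //; have uvg := cvgM uf vg; rewrite mulr0 in uvg; exact: uvg.
have c2 : (fun i => \int[mu]_x ((u i x - f x) * g x)) @ F --> (0 : R).
  apply: (cs0 (fun i x => u i x - f x) (fun=> g)) => //; first by near=> i.
  by rewrite -[X in _ --> X](mul0r (\int[mu]_x g x ^+ 2)); apply: cvgMr_tmp; exact: uf.
have c3 : (fun i => \int[mu]_x (f x * (v i x - g x))) @ F --> (0 : R).
  apply: (cs0 (fun=> f) (fun i x => v i x - g x)) => //; first by near=> i.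
  by rewrite -[X in _ --> X](mulr0 (\int[mu]_x f x ^+ 2)); apply: cvgMl_tmp; exact: vg.
have := cvgD (cvgD c1 c2) c3; rewrite !addr0 => c123; apply: cvg_near_eq (c123 _ _); near=> i => /=.
have ui : L2 mu (fun x => u i x - f x) by near: i.
have vi : L2 mu (fun x => v i x - g x) by near: i.
have ui' : L2 mu (u i) by near: i.
have vi' : L2 mu (v i) by near: i.
symmetry; rewrite -RintegralB//; [|exact: L2M..].
rewrite !fctE -!Rintegral_add; [|by [exact: L2M|apply: L1D; exact: L2M]..].
by apply: eq_Rintegral => x _; ring.
Unshelve. all: by end_near. Qed.

(** Here [v] is dominated without converging. This is the form needed when the test function
    contains the sign of mu' - mu, which may oscillate with the parameter. *)
Lemma L2cvg0_dot_dominated u v H : L2 mu H -> L2cvg u (fun=> 0) ->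
  (\forall i \near F, measurable_fun [set: T] (v i) /\
     {ae mu, forall x, `|v i x| <= H x}) ->
  (fun i => \int[mu]_x (u i x * v i x)) @ F --> (0 : R).
Proof.
move=> H2 [u2 _ u0] vH; apply: cvg_sqr0.
apply: (cvg0_le (b := fun i => \int[mu]_x (u i x - 0) ^+ 2 * \int[mu]_x H x ^+ 2)); last first.
  by rewrite -[X in _ --> X](mul0r (\int[mu]_x H x ^+ 2)); apply: cvgMr_tmp; exact: u0.
near=> i; rewrite ger0_norm ?sqr_ge0//.
have [mv viH] : measurable_fun [set: T] (v i) /\ {ae mu, forall x, `|v i x| <= H x}.
  by near: i.
have ui2 : L2 mu (u i) by near: i.
have vi2 : L2 mu (v i).
  apply: (L2_le_ae (C := 1) mv H2).
  by apply: filterS viH => x; rewrite mul1r => /le_trans; apply; exact: ler_norm.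
apply: le_trans (Rintegral_cauchy_schwarz ui2 vi2) _.
apply: ler_pM; [by apply: Rintegral_ge0 => x _; exact: sqr_ge0..| |].
  by under [leRHS]eq_Rintegral do rewrite subr0.
apply: le_Rintegral_ae; [exact: (L2_sqr vi2)|exact: (L2_sqr H2)|].
apply: filterS viH => x vx; rewrite -(real_normK (num_real (v i x))).
by rewrite lerXn2r ?nnegrE// (le_trans _ vx).
Unshelve. all: by end_near. Qed.

Lemma L1_tail H : L1 mu H -> (forall x, 0 <= H x) ->
  (fun n : nat => \int[mu]_x (H x * \1_[set y | n%:R < H y] x)) @ \oo --> (0 : R).
Proof.
move=> Hi H0; have mH := L1_measurable Hi.
have mHn (n : nat) : measurable_fun [set: T] (fun x => H x * \1_[set y | n%:R < H y] x).
  apply: measurable_funM => //; apply: measurable_indic.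
  by rewrite -[X in measurable X]setTI; apply: measurable_fun_ltr => //; exact: measurable_cst.
have bnd (n : nat) x : `|H x * \1_[set y | n%:R < H y] x| <= H x.
  by rewrite normrM (ger0_norm (H0 x)) ler_piMr// ger0_norm// indicE; case: (_ \in _).
have [|||||_ _] := @dominated_convergence _ _ _ mu setT measurableT
  (fun n x => (H x * \1_[set y | n%:R < H y] x)%:E) (cst 0%E) (EFin \o H).
- by move=> n; exact/measurable_EFinP.
- exact: measurable_cst.
- apply: aeW => x _; apply: cvg_near_cst; near=> n.
  rewrite indicE memNset ?mulr0// => /=; apply/negP; rewrite -leNgt.
  by near: n; exact: nbhs_infty_ger.
- exact: Hi.
- by apply: aeW => x n _; rewrite lee_fin.
by rewrite integral0 => /fine_cvgP[_].
Unshelve. all: by end_near. Qed.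

(** Domination upgrades L^1 convergence to L^2 along an arbitrary filter. Where [H ^ 2] exceeds [N],
    the square of [u] is absorbed by the tail of [H ^ 2]; elsewhere [u] is bounded, so its square is
    at most a constant times [|u|]. *)
Lemma L2cvg0_dominated u H : L2 mu H ->
  (\forall i \near F, measurable_fun [set: T] (u i) /\
     {ae mu, forall x, `|u i x| <= H x}) ->
  (fun i => \int[mu]_x `|u i x|) @ F --> (0 : R) -> L2cvg u (fun=> 0).
Proof.
move=> H2 uH u0.
have u2 : \forall i \near F, L2 mu (u i).
  apply: filterS uH => i [mu_ uiH]; apply: (L2_le_ae (C := 1) mu_ H2).
  by apply: filterS uiH => x uiH; rewrite mul1r (le_trans uiH)// ler_norm.
split => //; first exact: L2_cst.
apply/cvgr0Pnorm_le => e e0.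
have Hi := L2_sqr H2.
have /cvgr0Pnorm_le/(_ (e / 2)) := L1_tail Hi (fun x => sqr_ge0 (H x)).
rewrite divr_gt0// => /(_ isT) [N _ /(_ N (leqnn N)) tailN].
(* [N] is fixed by the tail beforehand. Where [H ^ 2 <= N], also [u ^ 2 <= N], hence [|u| <= N + 1];
   the successor keeps the divisor positive. *)
have /cvgr0Pnorm_le/(_ (e / 2 / N.+1%:R)) := u0.
rewrite !divr_gt0// => /(_ isT) uN.
near=> i; rewrite ger0_norm; last by apply: Rintegral_ge0 => x _; exact: sqr_ge0.
have [mui uiH] : measurable_fun [set: T] (u i) /\ {ae mu, forall x, `|u i x| <= H x}.
  by near: i.
have ui2 : L2 mu (u i) by near: i.
have uiN : `|\int[mu]_x `|u i x| | <= e / 2 / N.+1%:R by near: i.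
have mind : measurable_fun [set: T] (\1_[set y | N%:R < H y ^+ 2] : T -> R).
  apply: measurable_indic; rewrite -[X in measurable X]setTI.
  apply: measurable_fun_ltr => //.
  exact: L1_measurable Hi.
have tail1 : L1 mu (fun x => H x ^+ 2 * \1_[set y | N%:R < H y ^+ 2] x).
  have := L1M_bounded (C := 1) mind _ Hi.
  rewrite (_ : (fun x => _) = (fun x => H x ^+ 2 * \1_[set y | N%:R < H y ^+ 2] x)).
    by apply; apply: aeW => x; rewrite ger0_norm// indicE; case: (_ \in _).
  by apply/funext => x; rewrite mulrC.
apply: (@le_trans _ _ (\int[mu]_x
  (N.+1%:R * `|u i x| + H x ^+ 2 * \1_[set y | N%:R < H y ^+ 2] x))).
  apply: le_Rintegral_ae.
  - exact: L2_sqr (L2B ui2 (L2_cst mu 0)).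
  - by apply: L1D => //; apply: L1Z; apply: L1_norm; exact: L2_L1.
  - apply: filterS uiH => x uiHx; rewrite subr0 -(real_normK (num_real (u i x))).
    have nu := normr_ge0 (u i x).
    rewrite indicE; have [HN|HN] := ltP N%:R (H x ^+ 2).
      rewrite mem_set//= mulr1.
      rewrite -[leLHS]add0r lerD ?mulr_ge0//.
      by rewrite lerXn2r ?nnegrE// (le_trans nu).
    rewrite memNset/=; last by apply/negP; rewrite -leNgt.
    rewrite mulr0 addr0 expr2 ler_wpM2r//.
    have : `|u i x| ^+ 2 <= N%:R by rewrite (le_trans _ HN)// lerXn2r ?nnegrE// (le_trans nu).
    have : (1 : R) <= N.+1%:R by rewrite ler1n.
    have : (N%:R : R) <= N.+1%:R by rewrite ler_nat.
    by nra.
rewrite Rintegral_add//; last by apply: L1Z; apply: L1_norm; exact: L2_L1.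
rewrite RintegralZl//; last by apply: L1_norm; exact: L2_L1.
rewrite (splitr e) lerD//; last exact: le_trans (ler_norm _) tailN.
by rewrite mulrC -ler_pdivlMr// (le_trans (ler_norm _)).
Unshelve. all: by end_near. Qed.

(** Since [f] may be unbounded, the L^2 norm of [w i] does not control that of the product.
    Cauchy-Schwarz gives convergence of the product in L^1, and [C |f|] dominates it. *)
Lemma L2cvg0M_vanishing C (w : I -> T -> R) f : L2 mu f ->
  (\forall i \near F, {ae mu, forall x, `|w i x| <= C}) ->
  L2cvg w (fun=> 0) -> L2cvg (fun i x => w i x * f x) (fun=> 0).
Proof.
move=> f2 wC [w2 _ w0]; have mf := L2_measurable f2.
apply: (L2cvg0_dominated (H := fun x => C * `|f x|)).
- by apply: L2Z; exact: L2_norm.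
- near=> i; have wi2 : L2 mu (w i) by near: i.
  split; first by apply: measurable_funM => //; case: wi2.
  have : {ae mu, forall x, `|w i x| <= C} by near: i.
  by apply: filterS => x wiC; rewrite normrM ler_wpM2r.
have wn : L2cvg (fun i x => `|w i x|) (fun=> 0).
  split; first by apply: filterS w2 => i; exact: L2_norm.
    exact: L2_cst.
  apply: cvg_near_eq w0; near=> i.
  by apply: eq_Rintegral => x _; rewrite !subr0 real_normK ?num_real.
have dot := L2cvg_dot wn (L2cvg_cst (L2_norm f2)); move: dot.
rewrite (@Rintegral_ext _ _ _ _ _ (fun=> 0)) ?Rintegral_cst ?mul0r//; last first.
  by move=> x; rewrite mul0r.
move=> dot; apply: cvg_near_eq dot; near=> i.
by apply: eq_Rintegral => x _; rewrite normrM.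
Unshelve. all: by end_near. Qed.

Lemma L2cvg_sub0 u f : L2 mu f -> L2cvg (fun i x => u i x - f x) (fun=> 0) -> L2cvg u f.
Proof.
move=> f2 /L2cvgD/(_ (L2cvg_cst f2)).
have -> : (fun i x => u i x - f x + f x) = u.
  by apply/funext => i; apply/funext => x; rewrite subrK.
by congr L2cvg; apply/funext => x; rewrite add0r.
Qed.

End L2Convergence.

(** * Measures given by a density, and change of measure *)

Section DensityMeasure.
Context d (T : measurableType d) (R : realType) (mu : {measure set T -> \bar R}).
Variables (f : T -> R) (f0 : forall x, 0 <= f x) (fi : mu.-integrable [set: T] (EFin \o f)).

(** The proofs of nonnegativity and integrability are arguments so that the finite measure structure
    can be attached to the term itself. *)
Definition density_measure of (forall x, 0 <= f x) & mu.-integrable [set: T] (EFin \o f) :=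
  fun B : set T => (\int[mu]_(x in B) (f x)%:E)%E.

Local Notation nu := (density_measure f0 fi).

Let nu0 : nu set0 = 0%E. Proof. exact: integral_set0. Qed.

Let nu_ge0 B : (0 <= nu B)%E.
Proof. by apply: integral_ge0 => x _; rewrite lee_fin. Qed.

Let nu_sigma : semi_sigma_additive nu.
Proof.
apply: semi_sigma_additive_nng_induced; first exact: measurable_int fi.
by move=> x; rewrite lee_fin.
Qed.

HB.instance Definition _ := isMeasure.Build _ _ _ nu nu0 nu_ge0 nu_sigma.

Let nu_fin : fin_num_fun nu.
Proof. by move=> B mB; apply: integrable_fin_num => //; exact: integrableS fi. Qed.

HB.instance Definition _ := Measure_isFinite.Build _ _ _ nu nu_fin.

End DensityMeasure.

Section ChangeOfMeasure.
Context d (T : measurableType d) (R : realType).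

(** The formula for [nu] on sets makes it absolutely continuous with respect to [mu] and identifies
    [f] almost everywhere with the Radon-Nikodym derivative, for which change of variables holds. *)
Lemma ge0_integral_density (mu : {sigma_finite_measure set T -> \bar R})
    (nu : {finite_measure set T -> \bar R}) (f : T -> R) (phi : T -> \bar R) :
  measurable_fun [set: T] f -> (forall x, 0 <= f x) ->
  (forall B, measurable B -> nu B = (\int[mu]_(x in B) (f x)%:E)%E) ->
  measurable_fun [set: T] phi -> (forall x, (0 <= phi x)%E) ->
  (\int[nu]_x phi x = \int[mu]_x (phi x * (f x)%:E))%E.
Proof.
move=> mf f0 nuf mphi phi0.
have numu : nu `<< mu.
  apply/null_content_dominatesP => B mB muB0; rewrite nuf//.
  apply: null_set_integral => //; apply: measurable_funTS; exact/measurable_EFinP.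
rewrite -(Radon_Nikodym_SigmaFinite.change_of_variables numu)//.
have RNi := Radon_Nikodym_SigmaFinite.f_integrable numu.
apply: ae_eq_integral => //.
- by apply: emeasurable_funM => //; exact: measurable_int RNi.
- by apply: emeasurable_funM => //; exact/measurable_EFinP.
- apply: ae_eqe_mul2l; apply: integral_ae_eq => //; first exact/measurable_EFinP.
  by move=> B _ mB; rewrite -Radon_Nikodym_SigmaFinite.f_integral// nuf.
Qed.

Context (P P' : probability T R) (g : T -> R).
Hypothesis mg : measurable_fun [set: T] g.
Hypothesis g_gt0 : {ae P, forall x, 0 < g x}.
Hypothesis Pg : forall B, measurable B -> P' B = (\int[P]_(x in B) (g x)%:E)%E.

Lemma ge0_integral_tilt (phi : T -> \bar R) :
  measurable_fun [set: T] phi -> (forall x, (0 <= phi x)%E) ->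
  (\int[P']_x phi x = \int[P]_x (phi x * (g x)%:E))%E.
Proof.
move=> mphi phi0.
(* The likelihood ratio is positive only almost everywhere; its positive part is a density that is
   nonnegative at every point. *)
have gmax : {ae P, forall x, Num.max (g x) 0 = g x}.
  by apply: filterS g_gt0 => x gx; apply/max_idPl; exact: ltW.
have mgmax : measurable_fun [set: T] (fun x => Num.max (g x) 0).
  by apply: measurable_maxr.
rewrite (@ge0_integral_density P P' (fun x => Num.max (g x) 0))//.
- apply: ae_eq_integral => //.
  + by apply: emeasurable_funM => //; exact/measurable_EFinP.
  + by apply: emeasurable_funM => //; exact/measurable_EFinP.
  + by apply: filterS gmax => x gx _; rewrite gx.
- by move=> x; rewrite le_max lexx orbT.
- move=> B mB; rewrite [LHS](Pg mB); apply: ae_eq_integral => //.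
  + by apply/measurable_EFinP; exact: measurable_funTS.
  + by apply/measurable_EFinP; exact: measurable_funTS.
  + by apply: filterS gmax => x gx _; rewrite gx.
Qed.

(** Positivity of [g] makes the two laws mutually absolutely continuous. Almost sure bounds on
    conditional expectations under P' can then be used inside integrals under P. *)
Lemma null_tilt (B : set T) : measurable B -> P' B = 0%E <-> P B = 0%E.
Proof.
move=> mB; have mgB : measurable_fun B (EFin \o g).
  by apply/measurable_EFinP; exact: measurable_funTS.
rewrite Pg//; split => B0; last exact: null_set_integral.
have : (\int[P]_(x in B) `|(EFin \o g) x| = 0)%E.
  rewrite -[RHS]B0; apply: ae_eq_integral => //; first exact: measurableT_comp.
  by apply: filterS g_gt0 => x gx _ /=; rewrite ger0_norm// ltW.
move=> /(ae_eq_integral_abs _ mB mgB) gB0; apply/negligibleP => //.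
have : {ae P, forall x, ~ B x}.
  apply: filterS2 g_gt0 gB0 => x gx /= gBx /gBx[] gx0.
  by rewrite gx0 ltxx in gx.
by apply: negligibleS => x Bx nBx; exact: nBx Bx.
Qed.

Lemma ae_tilt (Q : T -> Prop) : {ae P', forall x, Q x} <-> {ae P, forall x, Q x}.
Proof. by split=> -[N [mN N0 NQ]]; exists N; split => //; apply/null_tilt. Qed.

Lemma L1_tilt (f : T -> R) : measurable_fun [set: T] f ->
  L1 P' f <-> L1 P (fun x => g x * f x).
Proof.
move=> mf; have E : (\int[P']_x `|f x|%:E = \int[P]_x `|g x * f x|%:E)%E.
  rewrite ge0_integral_tilt//; last by apply/measurable_EFinP; exact: measurableT_comp.
  apply: ae_eq_integral => //.
  - apply: emeasurable_funM; last exact/measurable_EFinP.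
    by apply/measurable_EFinP; exact: measurableT_comp.
  - by apply/measurable_EFinP; apply: measurableT_comp => //; exact: measurable_funM.
  - by apply: filterS g_gt0 => x gx _; rewrite -EFinM mulrC normrM (gtr0_norm gx).
split=> [/L1_ltoo|/L1_ltoo] fi.
  by apply: L1P; [exact: measurable_funM|rewrite -E].
by apply: L1P => //; rewrite E.
Qed.

Lemma Rintegral_tilt (f : T -> R) : L1 P' f ->
  \int[P']_x f x = \int[P]_x (g x * f x).
Proof.
move=> fi; have mf := L1_measurable fi.
have gfi := (L1_tilt mf).1 fi.
have ge0 (h : T -> R) : measurable_fun [set: T] h -> (forall x, 0 <= h x) ->
    \int[P']_x h x = \int[P]_x (g x * h x).
  move=> mh h0; rewrite /Rintegral ge0_integral_tilt//; last exact/measurable_EFinP.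
  by congr fine; apply: eq_integral => x _; rewrite -EFinM mulrC.
have mn : measurable_fun [set: T] (fun x => `|f x|) by exact: measurableT_comp.
have gni := (L1_tilt mn).1 (L1_norm fi).
(* A signed function is a difference of the nonnegative functions [|f| + f] and [|f|]; the same
   decomposition reduces later signed statements to Tonelli-type ones. *)
transitivity (\int[P']_x (`|f x| + f x) - \int[P']_x `|f x|).
  by rewrite Rintegral_add//; [ring|exact: L1_norm].
rewrite !ge0//; last 2 first.
- exact: measurable_funD.
- by move=> x; rewrite -lerBlDr sub0r ler_normr lexx orbT.
rewrite (@Rintegral_ext _ _ _ _ _ (fun x => g x * `|f x| + g x * f x)); last first.
  by move=> x; rewrite mulrDr.
by rewrite Rintegral_add//; ring.
Qed.

End ChangeOfMeasure.

Section PushedDensity.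
Context d d' (T : measurableType d) (U : measurableType d') (R : realType).
Variables (mu : {measure set T -> \bar R}) (V : {mfun T >-> U}) (f : T -> R).
Variables (f0 : forall x, 0 <= f x) (fi : mu.-integrable [set: T] (EFin \o f)).

Definition pushed_density := pushforward (density_measure f0 fi) V.

Let pushed0 : pushed_density set0 = 0%E. Proof. exact: measure0. Qed.

Let pushed_ge0 B : (0 <= pushed_density B)%E. Proof. exact: measure_ge0. Qed.

Let pushed_sigma : semi_sigma_additive pushed_density.
Proof. exact: measure_semi_sigma_additive. Qed.

HB.instance Definition _ := isMeasure.Build _ _ _ pushed_density
  pushed0 pushed_ge0 pushed_sigma.

Let pushed_fin : fin_num_fun pushed_density.
Proof.
move=> B mB; apply: (fin_num_measure (density_measure f0 fi)).
by rewrite -[X in measurable X]setTI; exact: measurable_funPT.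
Qed.

HB.instance Definition _ := Measure_isFinite.Build _ _ _ pushed_density pushed_fin.

End PushedDensity.

(** * Existence, testing and order properties of conditional expectations *)

Section ConditionalExpectationTheory.
Context d d' (T : measurableType d) (U : measurableType d') (R : realType).
Implicit Types (P : probability T R) (V : {mfun T >-> U}) (X f : T -> R) (phi g k : U -> R).

Lemma measurable_comp_mfun V g : measurable_fun [set: U] g ->
  measurable_fun [set: T] (fun x => g (V x)).
Proof. by move=> mg; apply: measurableT_comp. Qed.

(* Two densities with equal integrals over the sigma-algebra of [V] induce the same
   measure on [U], by pushing forward along [V]. *)
Lemma ge0_integral_eq_on_sigma P V (f1 f2 : T -> R) (phi : U -> \bar R) :
  (forall x, 0 <= f1 x) -> (forall x, 0 <= f2 x) -> L1 P f1 -> L1 P f2 ->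
  (forall B, measurable B ->
    \int[P]_(x in V @^-1` B) f1 x = \int[P]_(x in V @^-1` B) f2 x) ->
  measurable_fun [set: U] phi -> (forall y, (0 <= phi y)%E) ->
  (\int[P]_x (phi (V x) * (f1 x)%:E) = \int[P]_x (phi (V x) * (f2 x)%:E))%E.
Proof.
move=> f10 f20 f1i f2i f12 mphi phi0.
have E (f : T -> R) (f0 : forall x, 0 <= f x) (fi : L1 P f) :
    (\int[P]_x (phi (V x) * (f x)%:E) =
     \int[pushforward (density_measure f0 fi) V]_y phi y)%E.
  rewrite ge0_integral_pushforward//.
  rewrite preimage_setT (@ge0_integral_density _ _ _ P (density_measure f0 fi) f)//.
  - exact: L1_measurable fi.
  - exact: measurableT_comp.
  - by move=> x; exact: phi0.
rewrite (E _ f10 f1i) (E _ f20 f2i); apply: eq_measure_integral => B mB _ /=.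
have mVB : measurable (V @^-1` B) by rewrite -[X in measurable X]setTI; exact: measurable_funPT.
rewrite /pushforward /density_measure.
have fin (f : T -> R) : L1 P f ->
    (\int[P]_(x in V @^-1` B) (f x)%:E)%E = (\int[P]_(x in V @^-1` B) f x)%:E.
  by move=> fi; rewrite /Rintegral fineK//; apply: integrable_fin_num => //; exact: integrableS fi.
by rewrite (fin _ f1i) (fin _ f2i) f12.
Qed.

(** For nonnegative X a version is the Radon-Nikodym derivative of the image under [V] of the
    measure with density X, relative to the law of [V]. The signed case subtracts versions for
    [|X| + X] and [|X|]. *)
Lemma exists_cond_exp P V X : L1 P X -> exists g, is_cond_exp P V X g.
Proof.
have ge0_case f : (forall x, 0 <= f x) -> L1 P f -> exists g, is_cond_exp P V f g.
  move=> f0 fi.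
  pose nu : {finite_measure set U -> \bar R} := pushed_density V f0 fi.
  have numu : nu `<< distribution P V.
    apply/null_content_dominatesP => B mB PB0; rewrite /= /nu /pushed_density /pushforward.
    apply: null_set_integral => //.
    - by rewrite -[X in measurable X]setTI; exact: measurable_funPT.
    - by apply: measurable_funTS; exact: measurable_int fi.
  have [G [G0 Gfin Gi nuG]] := radon_nikodym_sigma_finite numu.
  have mG : measurable_fun [set: U] G by exact: measurable_int Gi.
  have GE : EFin \o (fine \o G) = G by apply/funext => y /=; rewrite fineK.
  have GVi : P.-integrable [set: T] (G \o V).
    apply/integrableP; split; first exact: measurableT_comp.
    have /integrableP[_] := Gi.
    rewrite ge0_integral_distribution//; exact: measurableT_comp.
  exists (fine \o G); split => //.
  - by apply/measurable_EFinP; rewrite GE.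
  - by have -> : EFin \o ((fine \o G) \o V) = G \o V by rewrite -GE.
  - move=> B mB; have := nuG B mB; rewrite /= /nu /pushed_density /pushforward
       /density_measure /Rintegral => ->.
    congr fine; rewrite /distribution ge0_integral_pushforward//.
    + by apply: eq_integral => x _ /=; rewrite fineK.
    + exact: measurable_funTS.
move=> Xi; have [g1 [_ mg1 g1i g1E]] := ge0_case _ (fun x => normr_ge0 (X x)) (L1_norm Xi).
have aX0 x : 0 <= `|X x| + X x by rewrite -lerBlDr sub0r ler_normr lexx orbT.
have [g2 [_ mg2 g2i g2E]] := ge0_case _ aX0 (L1D (L1_norm Xi) Xi).
exists (fun y => g2 y - g1 y); split => //; first exact: measurable_funB.
  exact: (L1B (f := g2 \o V) (g := g1 \o V)).
move=> B mB; have mVB : measurable (V @^-1` B).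
  by rewrite -[X in measurable X]setTI; exact: measurable_funPT.
have s (f : T -> R) : L1 P f -> P.-integrable (V @^-1` B) (EFin \o f) by exact: integrableS.
rewrite RintegralB//; [|exact: (s (g2 \o V))|exact: (s (g1 \o V))].
rewrite -g2E// -g1E// RintegralD//; [ring|exact: s (L1_norm Xi)|exact: s].
Qed.

Lemma cond_expP P V X : L1 P X -> is_cond_exp P V X (cond_exp P V X).
Proof.
move=> /(exists_cond_exp V)[g Xg]; rewrite /cond_exp.
by case: xgetP => [y _ //|/(_ g)].
Qed.

Lemma ge0_cond_exp_test P V X g phi : is_cond_exp P V X g ->
  measurable_fun [set: U] phi -> (forall y, 0 <= phi y) ->
  L1 P (fun x => phi (V x) * X x) -> L1 P (fun x => phi (V x) * g (V x)) ->
  \int[P]_x (phi (V x) * X x) = \int[P]_x (phi (V x) * g (V x)).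
Proof.
move=> [Xi mg gVi Xg] mphi phi0 pX pg.
(* Adding the same integrable [a] to X and to [g (V x)] makes both densities nonnegative without
   changing their difference on the sigma-algebra of [V]. Its product with [phi] stays integrable
   and cancels at the end. *)
pose a x : R := `|X x| + `|g (V x)|.
have ai : L1 P a by apply: L1D; [exact: L1_norm|exact: (L1_norm (f := g \o V))].
have f10 x : 0 <= a x + X x.
  have := ler_norm (- X x); rewrite normrN /a; have := normr_ge0 (g (V x)); lra.
have f20 x : 0 <= a x + g (V x).
  have := ler_norm (- g (V x)); rewrite normrN /a; have := normr_ge0 (X x); lra.
have E := ge0_integral_eq_on_sigma (phi := EFin \o phi) f10 f20 (L1D ai Xi)
  (L1D ai (f := a) (g := g \o V) gVi).
have {}E : (\int[P]_x (phi (V x) * (a x + X x))%:E =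
            \int[P]_x (phi (V x) * (a x + g (V x)))%:E)%E.
  apply: E => //; last exact/measurable_EFinP.
  move=> B mB; have mVB : measurable (V @^-1` B).
    by rewrite -[X in measurable X]setTI; exact: measurable_funPT.
  have s (f : T -> R) : L1 P f -> P.-integrable (V @^-1` B) (EFin \o f) by exact: integrableS.
  rewrite (RintegralD mVB (s _ ai) (s _ Xi)) (RintegralD mVB (s _ ai) (s (g \o V) gVi)).
  by rewrite Xg.
have pai : L1 P (fun x => phi (V x) * a x).
  apply: L1_le (L1D (L1_norm pX) (L1_norm pg)) _.
    by apply: measurable_funM; [exact: measurable_comp_mfun|exact: L1_measurable ai].
  move=> x; rewrite (ger0_norm (addr_ge0 (normr_ge0 _) (normr_ge0 _))) !normrM.
  by rewrite -mulrDr ler_wpM2l// ger0_norm// addr_ge0.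
have {E} : \int[P]_x (phi (V x) * a x + phi (V x) * X x) =
           \int[P]_x (phi (V x) * a x + phi (V x) * g (V x)).
  rewrite /Rintegral; congr fine; under eq_integral do rewrite -mulrDr.
  by rewrite E; under [in RHS]eq_integral do rewrite -mulrDr.
by rewrite !Rintegral_add// => /addrI.
Qed.

Lemma cond_exp_test P V X g phi : is_cond_exp P V X g ->
  measurable_fun [set: U] phi ->
  L1 P (fun x => phi (V x) * X x) -> L1 P (fun x => phi (V x) * g (V x)) ->
  \int[P]_x (phi (V x) * X x) = \int[P]_x (phi (V x) * g (V x)).
Proof.
move=> Xg mphi pX pg.
have [Xi mg gVi _] := Xg.
have aphi0 y : 0 <= `|phi y| + phi y by rewrite -lerBlDr sub0r ler_normr lexx orbT.
have maphi : measurable_fun [set: U] (fun y => `|phi y|) by exact: measurableT_comp.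
have l1 (f : T -> R) : measurable_fun [set: T] f -> L1 P (fun x => phi (V x) * f x) ->
    L1 P (fun x => `|phi (V x)| * f x).
  move=> mf pf; apply: L1_le pf _; last by move=> x; rewrite !normrM normr_id.
  by apply: measurable_funM => //; exact: (measurable_comp_mfun V maphi).
have apX := l1 _ (L1_measurable Xi) pX.
have apg := l1 _ (measurable_comp_mfun V mg) pg.
have split (f : T -> R) : L1 P (fun x => phi (V x) * f x) ->
    L1 P (fun x => `|phi (V x)| * f x) ->
    \int[P]_x ((`|phi (V x)| + phi (V x)) * f x) =
    \int[P]_x (`|phi (V x)| * f x) + \int[P]_x (phi (V x) * f x).
  by move=> pf apf; rewrite -Rintegral_add//; apply: Rintegral_ext => x; rewrite mulrDl.
have l2 (f : T -> R) : L1 P (fun x => phi (V x) * f x) ->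
    L1 P (fun x => `|phi (V x)| * f x) -> L1 P (fun x => (`|phi (V x)| + phi (V x)) * f x).
  by move=> pf apf; have := L1D apf pf; congr L1; apply/funext => x; rewrite mulrDl.
have := ge0_cond_exp_test Xg (measurable_funD maphi mphi) aphi0 (l2 _ pX apX) (l2 _ pg apg).
rewrite !split// (ge0_cond_exp_test Xg maphi (fun y => normr_ge0 (phi y)))//.
exact: addrI.
Qed.

Lemma cond_exp_test_bounded P V X g phi (C : R) : is_cond_exp P V X g ->
  measurable_fun [set: U] phi -> (forall y, `|phi y| <= C) ->
  \int[P]_x (phi (V x) * X x) = \int[P]_x (phi (V x) * g (V x)).
Proof.
move=> Xg mphi phiC; have [Xi mg gVi _] := Xg.
have mphiV := measurable_comp_mfun V mphi.
apply: cond_exp_test => //.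
- by apply: (L1M_bounded (C := C)) => //; exact: aeW.
- by apply: (L1M_bounded (C := C) (f := g \o V)) => //; exact: aeW.
Qed.

(** Testing on the set where the inequality fails produces a nonnegative function whose integral is
    at most 0, hence one that vanishes almost everywhere. *)
Lemma ae_le_on_sigma P V g k : measurable_fun [set: U] g -> measurable_fun [set: U] k ->
  L1 P (g \o V) -> L1 P (k \o V) ->
  (forall B, measurable B ->
     \int[P]_x (\1_B (V x) * g (V x)) <= \int[P]_x (\1_B (V x) * k (V x))) ->
  {ae P, forall x, g (V x) <= k (V x)}.
Proof.
move=> mg mk gi ki gk.
pose B := [set y | k y < g y].
have mB : measurable B.
  rewrite -[X in measurable X]setTI; exact: measurable_fun_ltr.
have mBV : measurable_fun [set: T] (fun x => \1_B (V x) : R).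
  by apply: measurable_comp_mfun; exact: measurable_indic.
have B1 y : `|\1_B y : R| <= 1 by rewrite ger0_norm// indicE; case: (_ \in _).
have Bgi : L1 P (fun x => \1_B (V x) * g (V x)).
  by apply: (L1M_bounded (C := 1) (f := g \o V)) => //; exact: aeW.
have Bki : L1 P (fun x => \1_B (V x) * k (V x)).
  by apply: (L1M_bounded (C := 1) (f := k \o V)) => //; exact: aeW.
pose h x := \1_B (V x) * g (V x) - \1_B (V x) * k (V x).
have h0 x : 0 <= h x.
  rewrite /h -mulrBr indicE; have [/set_mem|_] := boolP (V x \in B).
    by rewrite /B /= mul1r subr_ge0 => /ltW.
  by rewrite mul0r.
have hi : L1 P h by exact: L1B.
have : \int[P]_x h x <= 0 by rewrite RintegralB// subr_le0 gk.
have ih0 : 0 <= \int[P]_x h x by exact: Rintegral_ge0.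
move=> ih_le0; have /Rintegral_eq0_ae : \int[P]_x h x = 0 by apply: le_anti; rewrite ih_le0.
move=> /(_ hi h0); apply: filterS => x; rewrite /h -mulrBr indicE.
have [_|] := boolP (V x \in B); first by rewrite mul1r => /eqP; rewrite subr_eq0 => /eqP ->.
by move=> /negP + _; rewrite leNgt => kg; apply/negP => /mem_set.
Qed.

Lemma cond_exp_le P V X X' g g' (c : R) : is_cond_exp P V X g -> is_cond_exp P V X' g' ->
  {ae P, forall x, X x <= c * X' x} -> {ae P, forall x, g (V x) <= c * g' (V x)}.
Proof.
move=> Xg Xg' XX'; have [Xi mg gi _] := Xg; have [Xi' mg' gi' _] := Xg'.
apply: (@ae_le_on_sigma P V g (fun y => c * g' y)) => //.
- exact: measurable_funM.
- exact: (L1Z c (f := g' \o V)).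
- move=> B mB; have mBV : measurable_fun [set: T] (fun x => \1_B (V x) : R).
    by apply: measurable_comp_mfun; exact: measurable_indic.
  have B1 y : `|\1_B y : R| <= 1 by rewrite ger0_norm// indicE; case: (_ \in _).
  have l1 f : L1 P f -> L1 P (fun x => \1_B (V x) * f x).
    by move=> fi; apply: (L1M_bounded (C := 1)) => //; exact: aeW.
  have mB1 : measurable_fun [set: U] (\1_B : U -> R) by exact: measurable_indic.
  rewrite -(cond_exp_test_bounded Xg mB1 B1).
  rewrite [leRHS](@Rintegral_ext _ _ _ _ _ (fun x => c * (\1_B (V x) * g' (V x)))); last first.
    by move=> x; ring.
  rewrite RintegralZl//; last exact: (l1 (g' \o V)).
  rewrite -(cond_exp_test_bounded Xg' mB1 B1) -RintegralZl//; last exact: l1.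
  apply: le_Rintegral_ae; [exact: l1|by apply: L1Z; exact: l1|].
  by apply: filterS XX' => x XX'; rewrite mulrCA ler_wpM2l.
Qed.

Lemma cond_exp_cst P V (c : R) : is_cond_exp P V (fun=> c) (fun=> c).
Proof. by split => //; exact: L1_cst. Qed.

Lemma is_cond_expN P V X g : is_cond_exp P V X g ->
  is_cond_exp P V (fun x => - X x) (fun y => - g y).
Proof.
move=> [Xi mg gi Xg]; split; [exact: L1N|exact: measurable_funN|exact: (L1N (f := g \o V))|].
move=> B mB; have mVB : measurable (V @^-1` B).
  by rewrite -[X in measurable X]setTI; exact: measurable_funPT.
have s (f : T -> R) : L1 P f ->
    \int[P]_(x in V @^-1` B) - f x = - \int[P]_(x in V @^-1` B) f x.
  move=> fi; rewrite -[RHS]mulN1r -RintegralZl//; last exact: integrableS fi.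
  by apply: eq_Rintegral => x _; rewrite mulN1r.
by rewrite s// Xg// -s.
Qed.

Lemma cond_exp_norm_le P V X X' g g' (c : R) : is_cond_exp P V X g ->
  is_cond_exp P V X' g' -> {ae P, forall x, `|X x| <= c * X' x} ->
  {ae P, forall x, `|g (V x)| <= c * g' (V x)}.
Proof.
move=> Xg Xg' XX'.
have le1 := cond_exp_le Xg Xg' _; have le2 := cond_exp_le (is_cond_expN Xg) Xg' _.
have {}le1 : {ae P, forall x, g (V x) <= c * g' (V x)}.
  by apply: le1; apply: filterS XX' => x; exact: le_trans (ler_norm _).
have {}le2 : {ae P, forall x, - g (V x) <= c * g' (V x)}.
  by apply: le2; apply: filterS XX' => x; apply: le_trans; rewrite -normrN ler_norm.
by apply: filterS2 le1 le2 => x l1 l2; rewrite ler_norml l1 andbT lerNl.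
Qed.

Lemma cond_exp_bounded P V X g (C : R) : is_cond_exp P V X g ->
  (forall x, `|X x| <= C) -> {ae P, forall x, `|g (V x)| <= C}.
Proof.
move=> Xg XC.
have : {ae P, forall x, `|g (V x)| <= 1 * C}.
  apply: cond_exp_norm_le Xg (cond_exp_cst P V C) _.
  by apply: aeW => x; rewrite mul1r.
by apply: filterS => x; rewrite mul1r.
Qed.

Lemma cond_exp_eq_ae P V X g g' : is_cond_exp P V X g -> is_cond_exp P V X g' ->
  {ae P, forall x, g (V x) = g' (V x)}.
Proof.
move=> Xg Xg'.
have X1 : {ae P, forall x, X x <= 1 * X x} by apply: aeW => x; rewrite mul1r.
apply: filterS2 (cond_exp_le Xg Xg' X1) (cond_exp_le Xg' Xg X1) => x.
by rewrite !mul1r => g1 g2; apply: le_anti; rewrite g1.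
Qed.

Lemma cond_exp_ge0 P V X g : is_cond_exp P V X g -> (forall x, 0 <= X x) ->
  {ae P, forall x, 0 <= g (V x)}.
Proof.
move=> Xg X0; have := cond_exp_le (c := 1) (cond_exp_cst P V 0) Xg.
move=> /(_ _)/wrap[]; first by apply: aeW => x; rewrite mul1r.
by apply: filterS => x; rewrite mul1r.
Qed.

(* Conditional Jensen, by testing against truncations of [k ^ 2 * g]. *)
Lemma L2_cond_exp P V X g k : is_cond_exp P V X g -> measurable_fun [set: U] k ->
  L2 P (fun x => k (V x) * X x) -> L2 P (fun x => k (V x) * g (V x)).
Proof.
move=> Xg mk kX; have [Xi mg gi _] := Xg.
have mgV := measurable_comp_mfun V mg; have mkV := measurable_comp_mfun V mk.
have mkg : measurable_fun [set: U] (fun y => k y * g y) by exact: measurable_funM.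
split; first exact: (measurable_comp_mfun V mkg).
apply: L1P.
  by apply: measurable_funX; exact: (measurable_comp_mfun V mkg).
pose D n := [set y | `|k y| + `|g y| <= n%:R].
have mD n : measurable (D n).
  rewrite -[X in measurable X]setTI; apply: measurable_fun_ler => //.
  by apply: measurable_funD; exact: measurableT_comp.
pose h n y := k y * g y * \1_(D n) y.
have mh n : measurable_fun [set: U] (h n).
  by apply: measurable_funM => //; exact: measurable_indic.
have Dn n y : D n y -> `|k y| <= n%:R /\ `|g y| <= n%:R.
  move=> Dny; have := normr_ge0 (k y); have := normr_ge0 (g y).
  by move: Dny; rewrite /D /=; lra.
have hb n y : `|h n y| <= n%:R * n%:R.
  rewrite /h indicE; have [/set_mem/Dn[kn gn]|_] := boolP (y \in D n).
    by rewrite mulr1 normrM ler_pM.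
  by rewrite mulr0 normr0 mulr_ge0.
have hkb n y : `|k y * h n y| <= n%:R * (n%:R * n%:R).
  have := hb n y; rewrite /h indicE; have [/set_mem/Dn[kn gn]|_] := boolP (y \in D n).
    by move=> hn; rewrite normrM ler_pM.
  by rewrite !mulr0 normr0 !mulr_ge0.
have h2 n : L2 P (fun x => h n (V x)).
  by apply: (L2_bounded (C := n%:R * n%:R)); [exact: measurable_comp_mfun|exact: aeW].
have hh n y : h n y ^+ 2 = k y * h n y * g y.
  by rewrite /h indicE; case: (_ \in _); rewrite ?mulr1 ?mulr0 ?mul0r ?expr0n//; ring.
have test n : \int[P]_x (h n (V x) ^+ 2) = \int[P]_x (h n (V x) * (k (V x) * X x)).
  transitivity (\int[P]_x (k (V x) * h n (V x) * X x)).
    rewrite (cond_exp_test_bounded (phi := fun y => k y * h n y) Xg _ (hkb n)); last first.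
      exact: measurable_funM.
    by apply: Rintegral_ext => x; rewrite hh.
  by apply: Rintegral_ext => x; ring.
(* Young's inequality applied to [h * (k X)] returns half of the left side, which is finite by
   truncation and is absorbed; the bound no longer depends on [n]. *)
have bnd n : \int[P]_x (h n (V x) ^+ 2) <= \int[P]_x ((k (V x) * X x) ^+ 2).
  have i2 := L2_sqr (h2 n); have j2 := L2_sqr kX.
  have le2 : \int[P]_x (h n (V x) ^+ 2) <=
      2^-1 * \int[P]_x (h n (V x) ^+ 2) + 2^-1 * \int[P]_x ((k (V x) * X x) ^+ 2).
    rewrite {1}test -!RintegralZl// -Rintegral_add; [|exact: L1Z..].
    apply: le_Rintegral => //; [exact: L2M|by apply: L1D; exact: L1Z|].
    by move=> x _; have := sqr_ge0 (h n (V x) - k (V x) * X x); lra.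
  by lra.
have E : (\int[P]_x `|(k (V x) * g (V x)) ^+ 2|%:E =
    limn (fun n => \int[P]_x (h n (V x) ^+ 2)%:E))%E.
  transitivity (\int[P]_x (limn (fun n => (h n (V x) ^+ 2)%:E)))%E.
    apply: eq_integral => x _; apply/esym/cvg_lim => //.
    apply: cvg_near_cst; near=> n; rewrite /h indicE mem_set ?mulr1 ?ger0_norm ?sqr_ge0//.
    by near: n; exact: nbhs_infty_ger.
  apply: monotone_convergence => //.
  - by move=> n; apply/measurable_EFinP; apply: measurable_funX; exact: measurable_comp_mfun.
  - by move=> n x _; rewrite lee_fin sqr_ge0.
  - move=> x _ m n mn; rewrite lee_fin /h !indicE.
    have [/set_mem Dm|_] := boolP (V x \in D m).
      by rewrite mem_set//; rewrite /D /= (le_trans Dm)// ler_nat.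
    by rewrite mulr0 expr0n /= sqr_ge0.
rewrite E; apply: (@le_lt_trans _ _ (\int[P]_x ((k (V x) * X x) ^+ 2))%:E); last exact: ltry.
apply: lime_le.
  apply: ereal_nondecreasing_is_cvgn => m n mn; apply: ge0_le_integral => //.
  - by move=> x _; rewrite lee_fin sqr_ge0.
  - by apply/measurable_EFinP; apply: measurable_funX; exact: measurable_comp_mfun.
  - by apply/measurable_EFinP; apply: measurable_funX; exact: measurable_comp_mfun.
  - move=> x _; rewrite lee_fin /h !indicE.
    have [/set_mem Dm|_] := boolP (V x \in D m).
      by rewrite mem_set//; rewrite /D /= (le_trans Dm)// ler_nat.
    by rewrite mulr0 expr0n /= sqr_ge0.
by near=> n; rewrite (integralE_L1 (L2_sqr (h2 n))) lee_fin.
Unshelve. all: by end_near. Qed.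

End ConditionalExpectationTheory.

Lemma measurable_fun_inv (R : realType) d (T : measurableType d) (f : T -> R) :
  measurable_fun [set: T] f -> measurable_fun [set: T] (fun x => (f x)^-1).
Proof.
move=> mf; apply: (measurableT_comp (f := @GRing.inv R)) => //.
have mD : measurable [set~ (0 : R)] by exact: measurableC.
rewrite (_ : [set: R] = [set 0] `|` [set~ 0]); last by rewrite setUv.
apply/measurable_funU => //; split; first exact: measurable_fun_set1.
apply: open_continuous_measurable_fun.
  by apply: closed_openC; exact: closed_eq.
by move=> x; rewrite inE /= => /eqP x0; exact: inv_continuous.
Qed.

(** * The topological support of a law on the line *)

Section Support.
Context (R : realType).

Lemma law_support_closed (m : set R -> \bar R) : closed (law_support m).
Proof.
rewrite -openC; rewrite openE => a /=.
move=> /existsNP[U /not_implyP[oU /not_implyP[Ua mU]]].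
rewrite /interior nbhsE; exists U; first by split.
by move=> b Ub /(_ U oU Ub).
Qed.

Lemma measurable_law_support (m : set R -> \bar R) : measurable (law_support m).
Proof. by apply: closed_measurable; exact: law_support_closed. Qed.

(** A point outside the support has a null neighbourhood, hence lies in a null interval with
    rational endpoints. There are countably many of these, enumerated through [unpickle]. *)
Lemma law_support_full (m : {measure set R -> \bar R}) :
  {ae m, forall a, law_support m a}.
Proof.
pose G (r : rat * rat) : set R :=
  [set a | m `]ratr r.1 : R, ratr r.2[%classic = 0%E /\ a \in `]ratr r.1, ratr r.2[ ].
pose F (n : nat) : set R := if @unpickle (rat * rat)%type n is Some r then G r else set0.
have : m.-negligible (\bigcup_n F n).
  apply: negligible_bigcup => n; rewrite /F.
  case: unpickle => [[r1 r2]|]; last exact: negligible_set0.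
  have [m0|m0] := pselect (m `]ratr r1 : R, ratr r2[%classic = 0%E).
    exists `]ratr r1 : R, ratr r2[%classic; split => //; by move=> a [].
  by apply: (negligibleS _ (negligible_set0 m)) => a [].
apply: negligibleS => a /= /existsNP[U /not_implyP[oU /not_implyP[Ua mU]]].
have mU0 : m U = 0%E by apply/eqP; move/negP: mU; rewrite -leNgt measure_le0.
have /= [e /= e0 eU] := (nbhs_ballP a U).1 (open_nbhs_nbhs (conj oU Ua)).
have [|r1 r1a] := @rat_in_itvoo R (a - e) a; first by rewrite ltrBlDr ltrDl.
have [|r2 r2a] := @rat_in_itvoo R a (a + e); first by rewrite ltrDl.
exists (pickle (r1, r2)); first exact: I.
rewrite /F pickleK; split; last first.
  by move: r1a r2a; rewrite !in_itv /= => /andP[_ ->] /andP[].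
rewrite [fst _]/= [snd _]/=; apply/eqP; rewrite -measure_le0 -mU0.
apply: le_measure; rewrite ?inE//.
  exact: open_measurable.
move=> b /=; rewrite in_itv /= => /andP[r1b br2]; apply: eU; rewrite /ball /= ltr_norml.
move: r1a r2a; rewrite !in_itv /= => /andP[? ?] /andP[? ?].
by apply/andP; split; lra.
Qed.

End Support.

Lemma prod_measure_eq d1 d2 (T1 : measurableType d1) (T2 : measurableType d2) (R : realType)
    (m m' : {finite_measure set (T1 * T2)%type -> \bar R}) :
  (forall A B, measurable A -> measurable B -> m (A `*` B) = m' (A `*` B)) ->
  forall X, measurable X -> m X = m' X.
Proof.
move=> mm' X mX.
pose C : set (set (T1 * T2)%type) := [set A `*` B | A in measurable & B in measurable].
apply: (measure_unique C (fun=> setT)) => //.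
- exact: measurable_prod_measurableType.
- move=> _ _ [A1 mA1 [A2 mA2 <-]] [B1 mB1 [B2 mB2 <-]].
  exists (A1 `&` B1); first exact: measurableI.
  by exists (A2 `&` B2); [exact: measurableI|rewrite setXI].
- by move=> n; exists setT => //; exists setT => //; rewrite setXTT.
- by rewrite bigcup_const.
- by move=> _ [A mA [B mB <-]]; exact: mm'.
- by move=> n; rewrite ltey_eq fin_num_measure.
Qed.

(* [lebesgue_measure] lives on [measurableTypeR R], whose display is not that of [R] as
   a factor of a product; the sigma-algebras are the same. *)
Section LebesgueOnR.
Context (R : realType).

Definition leb : set R -> \bar R := @lebesgue_measure R.

Let leb0 : leb set0 = 0%E. Proof. exact: (measure0 (@lebesgue_measure R)). Qed.

Let leb_ge0 B : (0 <= leb B)%E. Proof. exact: (measure_ge0 (@lebesgue_measure R)). Qed.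

Let leb_sigma : semi_sigma_additive leb.
Proof. exact: (@measure_semi_sigma_additive _ _ _ (@lebesgue_measure R)). Qed.

HB.instance Definition _ := isMeasure.Build _ R R leb leb0 leb_ge0 leb_sigma.

Let leb_sigma_finite : sigma_finite [set: R] leb.
Proof.
have [F FT Foo] := sigma_finiteT (@lebesgue_measure R).
by exists F.
Qed.

HB.instance Definition _ := Measure_isSigmaFinite.Build _ R R leb leb_sigma_finite.

Lemma ge0_integral_leb (B : set R) (f : R -> \bar R) : measurable B ->
  measurable_fun [set: R] f -> (forall a, (0 <= f a)%E) ->
  (\int[@lebesgue_measure R]_(a in B) f a = \int[leb]_(a in B) f a)%E.
Proof.
move=> mB mf f0; pose id' := idfun : measurableTypeR R -> R.
have mid : measurable_fun setT id' by move=> _ C mC; rewrite setTI.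
rewrite -[LHS](@ge0_integral_pushforward _ _ _ _ _ id' mid (@lebesgue_measure R) B f)//.
exact: measurable_funTS.
Qed.

End LebesgueOnR.

(** * The joint law of (A, L), its density and the product of its marginals *)

Section Densities.
Context (R : realType) (dL dZ : nat).
Local Notation O := (obs R dL dZ).
Local Notation AL := (@cAL R dL dZ).
Local Notation leb := (@leb R).
Context (P : probability O R) (pA : R -> R) (pAL : R * dL.-tuple R -> R) (q : R -> R).
Hypothesis hpA : is_density_A P pA.
Hypothesis hpAL : is_cond_density_AL P pAL.
Hypothesis hpos : positivity P pAL.
Hypothesis hq : measurable_fun [set: R] q.
Hypothesis hN : supp_q P q `<=` (supp_A P)°.

Let pA_law B : measurable B -> law_A P B = (\int[leb]_(a in B) (pA a)%:E)%E.
Proof.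
move=> mB; have [mpA pA0 ->//] := hpA; apply: ge0_integral_leb => //.
exact/measurable_EFinP.
Qed.

Let pAL_law (B : set R) (C : set (dL.-tuple R)) : measurable B -> measurable C ->
  P (@cA R dL dZ @^-1` B `&` @cL R dL dZ @^-1` C) =
  (\int[law_L P]_(l in C) \int[leb]_(a in B) (pAL (a, l))%:E)%E.
Proof.
move=> mB mC; have [mpAL pAL0 ->//] := hpAL; apply: eq_integral => l _.
apply: ge0_integral_leb => //.
  by apply/measurable_EFinP; exact: measurableT_comp mpAL (pair2_measurable l).
by move=> a; rewrite lee_fin.
Qed.

Lemma measurable_supp_q : measurable (supp_q P q).
Proof.
rewrite (_ : supp_q P q = supp_A P `&` (q @^-1` [set~ 0])).
  apply: measurableI; first exact: measurable_law_support.
  by rewrite -[X in measurable X]setTI; apply: hq => //; exact: measurableC.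
by apply/seteqP; split => a [Sa /eqP qa]; split.
Qed.

(** The conditional density is given only through rectangles. They form a generating family stable
    under intersection, so the law of (A, L) is the measure with density [pAL] on Lebesgue times the
    law of L, and Tonelli applies. *)
Lemma ge0_integral_AL (phi : R * dL.-tuple R -> \bar R) :
  measurable_fun setT phi -> (forall al, 0 <= phi al)%E ->
  (\int[P]_o phi (AL o) = \int[law_L P]_l \int[leb]_a (phi (a, l) * (pAL (a, l))%:E))%E.
Proof.
move=> mphi phi0; have [mpAL pAL0 _] := hpAL.
have mpALe : measurable_fun setT (EFin \o pAL) by exact/measurable_EFinP.
have pALe0 al : (0 <= (EFin \o pAL) al)%E by rewrite lee_fin.
have rect A B : measurable A -> measurable B ->
    (\int[leb \x law_L P]_(x in A `*` B) (pAL x)%:E =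
     \int[law_L P]_(l in B) \int[leb]_(a in A) (pAL (a, l))%:E)%E.
  move=> mA mB; rewrite integral_mkcond fubini_tonelli2//.
  - rewrite [RHS]integral_mkcond; apply: eq_integral => l _.
    rewrite /fubini_G patchE; case: ifPn => lB.
      rewrite [RHS]integral_mkcond; apply: eq_integral => a _; rewrite !patchE.
      by rewrite in_setX lB andbT.
    by rewrite integral0_eq// => a _; rewrite patchE in_setX (negbTE lB) andbF.
  - apply/(measurable_restrict _ (measurableX mA mB) measurableT) => //.
    by rewrite setTI; apply: measurable_funTS; exact: mpALe.
  - by move=> x; apply: erestrict_ge0 => y _; exact: pALe0.
have pALi : (leb \x law_L P)%E.-integrable setT (EFin \o pAL).
  apply/integrableP; split => //.
  under eq_integral do rewrite gee0_abs//.
  rewrite -setXTT rect// -pAL_law//.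
  by rewrite !preimage_setT setIT probability_setT ltry.
pose m : {finite_measure set _ -> \bar R} :=
  @density_measure _ _ R (leb \x law_L P)%E pAL pAL0 pALi.
transitivity (\int[distribution P AL]_x phi x)%E.
  by rewrite ge0_integral_distribution.
transitivity (\int[m]_x phi x)%E.
  apply: eq_measure_integral => X mX _.
  apply: (@prod_measure_eq _ _ _ _ _ (distribution P AL) m) => // A B mA mB.
  transitivity (P (@cA R dL dZ @^-1` A `&` @cL R dL dZ @^-1` B)).
    rewrite -[LHS]/(P (AL @^-1` (A `*` B))).
    by have -> : AL @^-1` (A `*` B) = @cA R dL dZ @^-1` A `&` @cL R dL dZ @^-1` B
      by apply/seteqP; split.
  by rewrite pAL_law// -rect.
(* The density rule wants a sigma-finite reference measure; the product is exhausted by strips over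
   sets [F n] of finite Lebesgue measure. *)
have sf : sigma_finite setT (leb \x law_L P)%E.
  have [F FT Foo] := sigma_finiteT leb; exists (fun n => F n `*` setT).
    by rewrite -setXTT FT; apply/seteqP; split=> [[a l] [[n _ Fa] _]|[a l] [n _ [Fa _]]];
      [exists n|split => //; exists n].
  move=> n; have [mF Fn] := Foo n; split; first exact: measurableX.
  have L1 : law_L P setT = 1%E by exact: probability_setT.
  by rewrite product_measure1E// [X in (_ * X)%E]L1 mule1.
pose sfl := Measure_isSigmaFinite.Build _ _ _ (leb \x law_L P)%E sf.
pose lam : {sigma_finite_measure set (R * dL.-tuple R)%type -> \bar R} :=
  HB.pack (leb \x law_L P)%E sfl.
rewrite (@ge0_integral_density _ _ _ lam m pAL)//.
rewrite fubini_tonelli2//.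
- exact: emeasurable_funM.
- by move=> x; apply: mule_ge0 => //; exact: pALe0.
Qed.

Lemma measurable_delta : measurable_fun setT (delta (dL := dL) pA pAL).
Proof.
have [mpA _ _] := hpA; have [mpAL _ _] := hpAL.
apply: measurable_funM; last exact: measurable_fun_inv.
exact: measurableT_comp mpA measurable_fst.
Qed.

Lemma delta_ge0 al : 0 <= delta (dL := dL) pA pAL al.
Proof. by have [_ pA0 _] := hpA; have [_ pAL0 _] := hpAL; rewrite divr_ge0. Qed.

(* Positivity makes [delta] the density of the product of the marginals of A and L
   with respect to their joint law, above [supp_q]. *)
Lemma ge0_integral_product (phi : R * dL.-tuple R -> \bar R) :
  measurable_fun setT phi -> (forall al, 0 <= phi al)%E ->
  (forall a l, ~ supp_q P q a -> phi (a, l) = 0%E) ->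
  (\int[law_A P]_a \int[law_L P]_l phi (a, l) =
   \int[P]_o (phi (AL o) * (delta pA pAL (AL o))%:E))%E.
Proof.
move=> mphi phi0 phiN; have [mpA pA0 _] := hpA; have [mpAL pAL0 _] := hpAL.
have md := measurable_delta.
rewrite (@ge0_integral_density _ _ _ leb (law_A P) pA)//; last 2 first.
- exact: measurable_fun_fubini_tonelli_F.
- by move=> a; apply: integral_ge0 => l _.
rewrite (ge0_integral_AL (phi := fun al => phi al * (delta pA pAL al)%:E)%E); last 2 first.
- by apply: emeasurable_funM => //; exact/measurable_EFinP.
- by move=> al; apply: mule_ge0 => //; rewrite lee_fin; exact: delta_ge0.
transitivity (\int[leb]_a \int[law_L P]_l
    (phi (a, l) * (delta pA pAL (a, l))%:E * (pAL (a, l))%:E))%E; last first.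
  apply: (@fubini_tonelli _ _ _ _ _ leb (law_L P)
    (fun al => phi al * (delta pA pAL al)%:E * (pAL al)%:E)%E).
  - by do 2 (apply: emeasurable_funM => //; last exact/measurable_EFinP).
  - move=> al; apply: mule_ge0; last by rewrite lee_fin.
    by apply: mule_ge0 => //; rewrite lee_fin; exact: delta_ge0.
apply: eq_integral => a _.
have ma (f : R * dL.-tuple R -> \bar R) : measurable_fun setT f ->
    measurable_fun setT (fun l => f (a, l)).
  by move=> mf; exact: measurableT_comp mf (pair1_measurable a).
rewrite -ge0_integralZr//; [|exact: ma|by rewrite lee_fin].
have [Na|Na] := pselect (supp_q P q a); last first.
  by apply: eq_integral => l _; rewrite !phiN// !mul0e.
apply: ae_eq_integral => //.
- by apply: emeasurable_funM => //; exact: ma.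
- apply: (ma (fun al => phi al * (delta pA pAL al)%:E * (pAL al)%:E)%E).
  by do 2 (apply: emeasurable_funM => //; last exact/measurable_EFinP).
- apply: filterS (hpos (hN Na)) => l pos _.
  by rewrite -muleA -EFinM /delta divfK ?gt_eqF.
Qed.

Lemma ae_supp_A : {ae P, forall o, supp_A P (cA o)}.
Proof.
have [N [mN N0 SN]] := law_support_full (law_A P).
exists (@cA R dL dZ @^-1` N); split => //.
  by rewrite -[X in measurable X]setTI; exact: measurable_cA.
by move=> o So; exact: SN.
Qed.

Lemma ae_supp_q : {ae P, forall o, q (cA o) != 0 -> supp_q P q (cA o)}.
Proof. by apply: filterS ae_supp_A => o So qo; split. Qed.

(** The assumption concerns every [a] separately and the marginal law of L. It transfers to the
    joint law because that law has a density relative to Lebesgue times the law of L, where a set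
    with null sections is null. *)
Lemma ae_AL (Q : set (R * dL.-tuple R)) : measurable Q ->
  (forall a, supp_q P q a -> {ae law_L P, forall l, Q (a, l)}) ->
  {ae P, forall o, q (cA o) != 0 -> Q (AL o)}.
Proof.
move=> mQ aeQ; have [mpAL pAL0 _] := hpAL.
pose B := (supp_q P q `*` setT) `&` ~` Q.
have mB : measurable B.
  by apply: measurableI; [apply: measurableX => //; exact: measurable_supp_q|exact: measurableC].
have mBi : measurable_fun setT (EFin \o (\1_B : _ -> R)).
  by apply/measurable_EFinP; exact: measurable_indic.
have B0 : (\int[P]_o (\1_B (AL o))%:E = 0)%E.
  rewrite (ge0_integral_AL (phi := EFin \o \1_B))//; last by move=> al; rewrite lee_fin.
  rewrite -(@fubini_tonelli _ _ _ _ _ leb (law_L P)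
    (fun al => (EFin \o \1_B) al * (pAL al)%:E)%E); last 2 first.
  - by apply: emeasurable_funM => //; exact/measurable_EFinP.
  - by move=> al; apply: mule_ge0; rewrite lee_fin.
  apply: integral0_eq => a _; have [Na|Na] := pselect (supp_q P q a); last first.
    by apply: integral0_eq => l _ /=; rewrite indicE memNset ?mul0e// => -[[]].
  rewrite -[RHS](@integral0 _ _ _ (law_L P) setT); apply: ae_eq_integral => //.
  - have mf : measurable_fun setT (fun al => (EFin \o (\1_B : _ -> R)) al * (pAL al)%:E)%E.
      by apply: emeasurable_funM => //; exact/measurable_EFinP.
    exact: measurableT_comp mf (pair1_measurable a).
  - by apply: filterS (aeQ _ Na) => l Ql _ /=; rewrite indicE memNset ?mul0e// => -[].
have mAB : measurable (AL @^-1` B).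
  by rewrite -[X in measurable X]setTI; exact: measurable_cAL.
have PB : P (AL @^-1` B) = 0%E.
  transitivity (\int[P]_o (\1_(AL @^-1` B) o)%:E)%E; last exact: B0.
  by rewrite integral_indic// setIT.
have nBae : {ae P, forall o, ~ B (AL o)} by exists (AL @^-1` B); split => // o /contrapT.
apply: filterS2 nBae ae_supp_q => o nB Nq qo; apply: contrapT => nQ.
by apply: nB; split => //; split => //; exact: Nq.
Qed.

End Densities.

(** * Bounds and moment equations under a tilted law *)

Section TiltedLaw.
Context (R : realType) (dL dZ : nat).
Local Notation O := (obs R dL dZ).
Local Notation AL := (@cAL R dL dZ).
Local Notation L := (@cL R dL dZ).
Local Notation Y := (@cY R dL dZ).
Implicit Types (P : probability O R).

Lemma measurable_cond_exp d (U : measurableType d) P (V : {mfun O >-> U}) (X : O -> R) :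
  measurable_fun [set: U] (cond_exp P V X).
Proof.
rewrite /cond_exp; case: xgetP => [g _ [_ //]|_]; exact: measurable_cst.
Qed.

Lemma measurable_rho P w : measurable_fun setT (rho P w).
Proof. exact: measurable_cond_exp. Qed.

Lemma measurable_eta P : measurable_fun setT (eta P).
Proof. exact: measurable_cond_exp. Qed.

Lemma measurable_rho_AL P w : measurable_fun setT (fun al : R * dL.-tuple R => rho P w al.2).
Proof. exact: measurableT_comp (measurable_rho P w) measurable_snd. Qed.

Lemma measurable_kappa P w : measurable_fun setT (kappa P w).
Proof. by apply: measurable_funB; [exact: measurable_cond_exp|exact: measurable_rho_AL]. Qed.

Lemma measurable_mu P w : measurable_fun setT (mu P w).
Proof.
apply: measurable_funM; last exact: measurable_fun_inv (measurable_kappa P w).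
apply: measurable_funB; first exact: measurable_cond_exp.
by apply: measurable_funM; [exact: measurable_eta|exact: measurable_rho_AL].
Qed.

Lemma measurable_cY : measurable_fun [set: O] Y.
Proof. exact: measurable_snd. Qed.

Lemma measurable_Zpi (w : dZ.-tuple R * dL.-tuple R -> R) : measurable_fun setT w ->
  measurable_fun [set: O] (Zpi w).
Proof.
move=> mw; apply: (measurableT_comp mw); apply/measurable_fun_pair.
  by apply: (measurableT_comp measurable_snd);
     apply: (measurableT_comp measurable_fst); exact: measurable_fst.
exact: measurable_cL.
Qed.

(** All that is used about one member of a submodel at a fixed parameter. P itself is the case
    [P' = P], [g = 1], so every bound proved from the record serves both laws. *)
Record regular_tilt (q : R -> R) (w : dZ.-tuple R * dL.-tuple R -> R) (e : R)
    (h : R * dL.-tuple R -> R) P P' (g : O -> R) : Prop := RegularTilt {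
  tilt_measurable : measurable_fun [set: O] g;
  tilt_gt0 : {ae P, forall o, 0 < g o};
  tiltE : forall B, measurable B -> P' B = (\int[P]_(o in B) (g o)%:E)%E;
  tilt_L2 : L2 P g;
  tilt_Y : L1 P' Y;
  tilt_kappa : kappa_bounded_below P' w (supp_q P q) e;
  tilt_bound_measurable : measurable_fun setT h;
  tilt_bound : {ae P', forall o, cond_exp P' AL (fun o' => `|Y o'|) (AL o) <= h (AL o)} }.

Context (P P' : probability O R) (g : O -> R).
Context (pAL : R * dL.-tuple R -> R) (q : R -> R) (w : dZ.-tuple R * dL.-tuple R -> R).
Context (M e : R) (h : R * dL.-tuple R -> R).
Hypothesis hpAL : is_cond_density_AL P pAL.
Hypothesis hq : measurable_fun [set: R] q.
Hypothesis mw : measurable_fun setT w.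
Hypothesis wM : forall zl, `|w zl| <= M.
Hypothesis e_gt0 : 0 < e.
Hypothesis tilt : regular_tilt q w e h P P' g.

Let mg := tilt_measurable tilt.
Let g_gt0 := tilt_gt0 tilt.
Let Pg := tiltE tilt.
Let g2 := tilt_L2 tilt.
Let Yi := tilt_Y tilt.
Let kappae := tilt_kappa tilt.
Let mh := tilt_bound_measurable tilt.
Let Yh := tilt_bound tilt.
Let mZ := measurable_Zpi mw.

Let ae_tiltE (Q : O -> Prop) : {ae P', forall x, Q x} <-> {ae P, forall x, Q x}.
Proof. exact: ae_tilt mg g_gt0 Pg Q. Qed.

Lemma M_ge0 : 0 <= M.
Proof. by rewrite (le_trans (normr_ge0 (w point))). Qed.

Lemma L1_Zpi : L1 P' (Zpi w).
Proof. by apply: L2_L1; apply: (L2_bounded (C := M)) => //; apply: aeW => o; exact: wM. Qed.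

Lemma L1_YZpi : L1 P' (fun o => Y o * Zpi w o).
Proof.
have -> : (fun o => Y o * Zpi w o) = (fun o => Zpi w o * Y o) by apply/funext => o; rewrite mulrC.
by apply: (L1M_bounded (C := M)) => //; apply: aeW => o; exact: wM.
Qed.

Lemma rho_bounded : {ae P, forall o, `|rho P' w (L o)| <= M}.
Proof.
by apply/ae_tiltE; apply: cond_exp_bounded (cond_expP L L1_Zpi) _ => o; exact: wM.
Qed.

(** The lower bound is stated for some versions under P' and for each [a]. Equality of versions
    almost surely, [ae_AL], and the equivalence of P and P' turn it into a bound on the chosen
    [kappa P' w] under P. *)
Lemma kappa_ge : {ae P, forall o, q (cA o) != 0 -> e <= `|kappa P' w (AL o)|}.
Proof.
have [m [r [mE rE mre]]] := kappae.
have [_ mm _ _] := mE; have [_ mr _ _] := rE.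
have mQ : measurable [set al : R * dL.-tuple R | e <= `|m al - r al.2|].
  rewrite -[X in measurable X]setTI; apply: measurable_fun_ler => //.
  apply: measurableT_comp => //; apply: measurable_funB => //.
  exact: measurableT_comp mr measurable_snd.
have := ae_AL hpAL hq mQ.
move=> /(_ _)/wrap[].
  move=> a Na; have [N [mN N0 QN]] := mre a Na; exists N; split => //.
  have mLN : measurable (L @^-1` N).
    by rewrite -[X in measurable X]setTI; exact: measurable_cL.
  exact/(null_tilt mg g_gt0 Pg mLN).
move=> aeQ.
have mP := cond_exp_eq_ae mE (cond_expP AL L1_Zpi).
have rP := cond_exp_eq_ae rE (cond_expP L L1_Zpi).
have /ae_tiltE mP' := mP; have /ae_tiltE rP' := rP.
apply: filterS3 aeQ mP' rP' => o Q mo ro qo.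
by have := Q qo; rewrite /= /kappa /rho -mo -ro.
Qed.

Lemma h_ge0 : {ae P, forall o, 0 <= h (AL o)}.
Proof.
have /cond_exp_ge0 : is_cond_exp P' AL (fun o => `|Y o|) (cond_exp P' AL (fun o => `|Y o|)).
  by apply: cond_expP; exact: L1_norm.
move=> /(_ (fun o => normr_ge0 (Y o))) c0; apply/ae_tiltE.
by apply: filterS2 c0 Yh => o; exact: le_trans.
Qed.

Lemma eta_bounded : {ae P, forall o, `|eta P' (AL o)| <= h (AL o)}.
Proof.
apply/ae_tiltE.
have : {ae P', forall o, `|eta P' (AL o)| <= 1 * cond_exp P' AL (fun o => `|Y o|) (AL o)}.
  apply: cond_exp_norm_le (cond_expP AL Yi) (cond_expP AL (L1_norm Yi)) _.
  by apply: aeW => o; rewrite mul1r.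
by move=> c; apply: filterS2 c Yh => o; rewrite mul1r; exact: le_trans.
Qed.

Lemma cond_exp_YZ_bounded :
  {ae P, forall o, `|cond_exp P' AL (fun o => Y o * Zpi w o) (AL o)| <= M * h (AL o)}.
Proof.
apply/ae_tiltE.
have : {ae P', forall o, `|cond_exp P' AL (fun o => Y o * Zpi w o) (AL o)| <=
    M * cond_exp P' AL (fun o => `|Y o|) (AL o)}.
  apply: cond_exp_norm_le (cond_expP AL L1_YZpi) (cond_expP AL (L1_norm Yi)) _.
  by apply: aeW => o; rewrite normrM mulrC ler_wpM2r//; exact: wM.
move=> c; apply: filterS2 c Yh => o /le_trans + Yho; apply.
by rewrite ler_wpM2l// M_ge0.
Qed.

Lemma mu_kappa : {ae P, forall o, q (cA o) != 0 ->
  mu P' w (AL o) * kappa P' w (AL o) =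
  cond_exp P' AL (fun o => Y o * Zpi w o) (AL o) - eta P' (AL o) * rho P' w (L o)}.
Proof.
apply: filterS kappa_ge => o ke qo; rewrite /mu divfK//.
by rewrite -normr_gt0 (lt_le_trans e_gt0) ?ke.
Qed.

(** The numerator of mu' has two terms, each at most [M * h], and [kappa] is at least [e] in
    absolute value, whence the constant [2 * M / e]. *)
Lemma mu_bounded : {ae P, forall o, q (cA o) != 0 ->
  `|mu P' w (AL o)| <= 2 * M / e * h (AL o)}.
Proof.
apply: filterS2 (filterI kappa_ge mu_kappa) (filterI eta_bounded
  (filterI cond_exp_YZ_bounded (filterI rho_bounded h_ge0))).
move=> o [ke mk] [eh [ch [rM h0]]] qo.
have := mk qo; have := ke qo; set k := kappa _ _ _; set m := mu _ _ _ => kE mkE.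
rewrite mulrAC ler_pdivlMr//.
apply: (@le_trans _ _ (`|m| * `|k|)); first by rewrite ler_wpM2l.
rewrite -normrM mkE (le_trans (ler_normB _ _))// normrM.
have : `|eta P' (AL o)| * `|rho P' w (L o)| <= h (AL o) * M by rewrite ler_pM.
by move: ch; lra.
Qed.

(** Under P' the residual Z - rho' is orthogonal to functions of L. Working in L^2(P) secures
    integrability under P', since [g] is itself in L^2(P). *)
Lemma score_eq_rho (f : dL.-tuple R -> R) : measurable_fun setT f ->
  L2 P (fun o => f (L o)) ->
  \int[P]_o (g o * (f (L o) * (Zpi w o - rho P' w (L o)))) = 0.
Proof.
move=> mf f2.
have mr := measurable_comp_mfun L (measurable_rho P' w).
have fZ2 : L2 P (fun o => f (L o) * Zpi w o).
  have := L2M_bounded mZ (aeW P (fun o => wM _)) f2.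
  by congr L2; apply/funext => o; rewrite mulrC.
have fr2 : L2 P (fun o => f (L o) * rho P' w (L o)).
  have := L2M_bounded mr rho_bounded f2.
  by congr L2; apply/funext => o; rewrite mulrC.
have l1 (u : O -> R) : L2 P u -> L1 P' u.
  by move=> u2; apply/(L1_tilt mg g_gt0 Pg (L2_measurable u2)); exact: L2M.
have E := cond_exp_test (cond_expP L L1_Zpi) mf (l1 _ fZ2) (l1 _ fr2).
rewrite -(Rintegral_tilt mg g_gt0 Pg); last first.
  by have := L1B (l1 _ fZ2) (l1 _ fr2); congr L1; apply/funext => o; rewrite mulrBr.
under eq_Rintegral do rewrite mulrBr.
by rewrite RintegralB ?E ?subrr//; exact: l1.
Qed.

(** Expanding the product and conditioning on (A, L) under P' leaves
    [c - eta rho' - mu' (z - rho')], which is 0 by the definition of mu' as a quotient with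
    denominator [z - rho']. That cancellation holds where [q] is nonzero; elsewhere [phi]
    vanishes. *)
Lemma score_eq_mu (phi : R * dL.-tuple R -> R) : measurable_fun setT phi ->
  (forall a l, q a = 0 -> phi (a, l) = 0) ->
  L2 P (fun o => phi (AL o) * Y o) -> L2 P (fun o => phi (AL o) * h (AL o)) ->
  \int[P]_o (g o * (phi (AL o) * ((Y o - mu P' w (AL o)) * (Zpi w o - rho P' w (L o))))) = 0.
Proof.
move=> mphi phi0 pY ph.
have mp := measurable_comp_mfun AL mphi.
have mr := measurable_comp_mfun L (measurable_rho P' w).
have mm := measurable_comp_mfun AL (measurable_mu P' w).
have mk := measurable_comp_mfun AL (measurable_kappa P' w).
have me := measurable_comp_mfun AL (measurable_eta P').
pose c := cond_exp P' AL (fun o => Y o * Zpi w o).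
have mc : measurable_fun setT c by exact: measurable_cond_exp.
have l1 (u : O -> R) : L2 P u -> L1 P' u.
  by move=> u2; apply/(L1_tilt mg g_gt0 Pg (L2_measurable u2)); exact: L2M.
have dom (u : R * dL.-tuple R -> R) C : measurable_fun setT u ->
    {ae P, forall o, q (cA o) != 0 -> `|u (AL o)| <= C * h (AL o)} ->
    L2 P (fun o => phi (AL o) * u (AL o)).
  move=> mu_ uh; apply: (L2_le_ae (C := C)) ph _.
    by apply: measurable_funM => //; exact: measurable_comp_mfun.
  apply: filterS2 uh h_ge0 => o uh h0.
  have [q0|q0] := eqVneq (q (cA o)) 0; first by rewrite phi0// !mul0r normr0 mulr0.
  by rewrite !normrM (ger0_norm h0) mulrCA ler_wpM2l// uh.
have pZ : L2 P (fun o => phi (AL o) * Y o * Zpi w o).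
  have := L2M_bounded mZ (aeW P (fun o => wM _)) pY.
  by congr L2; apply/funext => o; rewrite mulrC.
have pYr : L2 P (fun o => phi (AL o) * Y o * rho P' w (L o)).
  have := L2M_bounded mr rho_bounded pY.
  by congr L2; apply/funext => o; rewrite mulrC.
have pm : L2 P (fun o => phi (AL o) * mu P' w (AL o)).
  by apply: (dom _ (2 * M / e)); [exact: measurable_mu|exact: mu_bounded].
have pmZ : L2 P (fun o => phi (AL o) * mu P' w (AL o) * Zpi w o).
  have := L2M_bounded mZ (aeW P (fun o => wM _)) pm.
  by congr L2; apply/funext => o; rewrite mulrC.
have pmr : L2 P (fun o => phi (AL o) * mu P' w (AL o) * rho P' w (L o)).
  have := L2M_bounded mr rho_bounded pm.
  by congr L2; apply/funext => o; rewrite mulrC.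
have pc : L2 P (fun o => phi (AL o) * c (AL o)).
  apply: (dom _ M) => //; apply: filterS cond_exp_YZ_bounded => o //.
have pe : L2 P (fun o => phi (AL o) * eta P' (AL o)).
  apply: (dom _ 1); first exact: measurable_eta.
  by apply: filterS eta_bounded => o; rewrite mul1r.
have per : L2 P (fun o => phi (AL o) * eta P' (AL o) * rho P' w (L o)).
  have := L2M_bounded mr rho_bounded pe.
  by congr L2; apply/funext => o; rewrite mulrC.
have E1 : \int[P']_o (phi (AL o) * Y o * Zpi w o) = \int[P']_o (phi (AL o) * c (AL o)).
  rewrite -(cond_exp_test (cond_expP AL L1_YZpi) mphi)//; last 2 first.
  - by have := l1 _ pZ; congr L1; apply/funext => o; rewrite mulrA.
  - exact: l1.
  by apply: Rintegral_ext => o; rewrite mulrA.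
have mpr : measurable_fun setT (fun al : R * dL.-tuple R => phi al * rho P' w al.2).
  by apply: measurable_funM => //; exact: measurable_rho_AL.
have E2 : \int[P']_o (phi (AL o) * Y o * rho P' w (L o)) =
          \int[P']_o (phi (AL o) * eta P' (AL o) * rho P' w (L o)).
  transitivity (\int[P']_o (phi (AL o) * rho P' w (AL o).2 * Y o)).
    by apply: Rintegral_ext => o; rewrite mulrAC.
  rewrite (cond_exp_test (cond_expP AL Yi) mpr).
  - by apply: Rintegral_ext => o; rewrite mulrAC.
  - by have := l1 _ pYr; congr L1; apply/funext => o; rewrite mulrAC.
  - by have := l1 _ per; congr L1; apply/funext => o; rewrite mulrAC.
have mpm : measurable_fun setT (fun al : R * dL.-tuple R => phi al * mu P' w al).
  by apply: measurable_funM => //; exact: measurable_mu.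
pose z := cond_exp P' AL (Zpi w).
have mz : measurable_fun setT z by exact: measurable_cond_exp.
have zM : {ae P, forall o, `|z (AL o)| <= M}.
  by apply/ae_tiltE; apply: cond_exp_bounded (cond_expP AL L1_Zpi) _ => o; exact: wM.
have pmz : L2 P (fun o => phi (AL o) * mu P' w (AL o) * z (AL o)).
  have := L2M_bounded (measurable_comp_mfun AL mz) zM pm.
  by congr L2; apply/funext => o; rewrite mulrC.
have E3 : \int[P']_o (phi (AL o) * mu P' w (AL o) * Zpi w o) =
          \int[P']_o (phi (AL o) * mu P' w (AL o) * z (AL o)).
  by apply: (cond_exp_test (cond_expP AL L1_Zpi) mpm); exact: l1.
have E4 : \int[P']_o (phi (AL o) * c (AL o) - phi (AL o) * eta P' (AL o) * rho P' w (L o)) =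
  \int[P']_o (phi (AL o) * mu P' w (AL o) * z (AL o) -
              phi (AL o) * mu P' w (AL o) * rho P' w (L o)).
  apply: eq_Rintegral_ae.
  - by case: (L2B pc per).
  - by case: (L2B pmz pmr).
  - apply/ae_tiltE; apply: filterS mu_kappa => o mkE.
    have [q0|q0] := eqVneq (q (cA o)) 0; first by rewrite phi0// !mul0r.
    have {}mkE := mkE q0; rewrite /kappa -/(z (AL o)) mulrBr -/(c (AL o)) in mkE.
    rewrite -[(AL o).2]/(L o) in mkE.
    transitivity (phi (AL o) * (c (AL o) - eta P' (AL o) * rho P' w (L o))); first by ring.
    by rewrite -mkE; ring.
have := E4; rewrite !RintegralB; [|by [|exact: l1]..].
rewrite -E1 -E2 -E3 => E5.
rewrite -(Rintegral_tilt mg g_gt0 Pg); last first.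
  have := L1B (L1B (l1 _ pZ) (l1 _ pYr)) (L1B (l1 _ pmZ) (l1 _ pmr)).
  by congr L1; apply/funext => o; ring.
transitivity (\int[P']_o ((phi (AL o) * Y o * Zpi w o - phi (AL o) * Y o * rho P' w (L o)) -
  (phi (AL o) * mu P' w (AL o) * Zpi w o - phi (AL o) * mu P' w (AL o) * rho P' w (L o)))).
  by apply: Rintegral_ext => o; ring.
rewrite RintegralB//; [|by apply: L1B; exact: l1|by apply: L1B; exact: l1].
by rewrite !RintegralB; [rewrite E5 subrr|by [|exact: l1]..].
Qed.

Lemma L2_muM (k : R * dL.-tuple R -> R) : measurable_fun setT k ->
  (forall a l, q a = 0 -> k (a, l) = 0) -> L2 P (fun o => k (AL o) * h (AL o)) ->
  L2 P (fun o => k (AL o) * mu P' w (AL o)).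
Proof.
move=> mk k0 kh.
apply: (L2_le_ae (C := 2 * M / e)) kh _.
  by apply: measurable_funM; [exact: (measurable_comp_mfun AL mk)
                             |exact: (measurable_comp_mfun AL (measurable_mu P' w))].
apply: filterS2 mu_bounded h_ge0 => o mb h0.
have [q0|q0] := eqVneq (q (cA o)) 0; first by rewrite k0// !mul0r normr0 mulr0.
rewrite [leLHS]normrM (normrM (k (AL o)) (h (AL o))) (ger0_norm h0) [leRHS]mulrCA.
by apply: ler_wpM2l => //; exact: mb.
Qed.

Lemma residual_bounded : {ae P, forall o, `|Zpi w o - rho P' w (L o)| <= 2 * M}.
Proof.
apply: filterS rho_bounded => o r'Mo; rewrite (le_trans (ler_normB _ _))// mulr_natl mulr2n lerD//.
exact: wM.
Qed.

End TiltedLaw.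

(** * Exact identities comparing rho and mu under two laws *)

Section TiltExpansion.
Context (R : realType) (dL dZ : nat).
Local Notation O := (obs R dL dZ).
Local Notation AL := (@cAL R dL dZ).
Local Notation L := (@cL R dL dZ).
Local Notation Y := (@cY R dL dZ).
Context (P P' : probability O R) (g : O -> R).
Context (pAL : R * dL.-tuple R -> R) (q : R -> R) (w : dZ.-tuple R * dL.-tuple R -> R).
Context (M e e' : R) (h h' : R * dL.-tuple R -> R).
Hypothesis hpAL : is_cond_density_AL P pAL.
Hypothesis hq : measurable_fun [set: R] q.
Hypothesis mw : measurable_fun setT w.
Hypothesis wM : forall zl, `|w zl| <= M.
Hypothesis e_gt0 : 0 < e.
Hypothesis e'_gt0 : 0 < e'.
Hypothesis tilt : regular_tilt q w e h P P (fun=> 1).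
Hypothesis tilt' : regular_tilt q w e' h' P P' g.

Let mZ := measurable_Zpi mw.
Let g2 : L2 P (fun o => g o - 1).
Proof. by apply: L2B; [exact: tilt_L2 tilt'|exact: L2_cst]. Qed.

Let mr := measurable_comp_mfun L (measurable_rho P w).
Let mr' := measurable_comp_mfun L (measurable_rho P' w).
Let mm := measurable_comp_mfun AL (measurable_mu P w).
Let mm' := measurable_comp_mfun AL (measurable_mu P' w).
Let rM := rho_bounded mw wM tilt.
Let rM' := rho_bounded mw wM tilt'.

Let rb := residual_bounded mw wM tilt.
Let rb' := residual_bounded mw wM tilt'.

Lemma L2_rhoB : L2 P (fun o => rho P' w (L o) - rho P w (L o)).
Proof. by apply: L2B; [exact: L2_bounded rM'|exact: L2_bounded rM]. Qed.

Lemma rhoB_bounded : {ae P, forall o, `|rho P' w (L o) - rho P w (L o)| <= 2 * M}.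
Proof.
apply: filterS2 rM rM' => o rMo r'Mo.
by rewrite (le_trans (ler_normB _ _))// mulr_natl mulr2n lerD.
Qed.

Lemma score_eq_rho_shift (f : dL.-tuple R -> R) : measurable_fun setT f ->
  L2 P (fun o => f (L o)) ->
  \int[P]_o (f (L o) * (rho P' w (L o) - rho P w (L o))) =
  \int[P]_o ((g o - 1) * (f (L o) * (Zpi w o - rho P' w (L o)))).
Proof.
move=> mf f2.
have fZ2 : L2 P (fun o => f (L o) * (Zpi w o - rho P w (L o))).
  have mZr := measurable_funB mZ mr.
  have := L2M_bounded mZr rb f2.
  by congr L2; apply/funext => o; rewrite mulrC.
have fZ2' : L2 P (fun o => f (L o) * (Zpi w o - rho P' w (L o))).
  have := L2M_bounded (measurable_funB mZ mr') rb' f2.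
  by congr L2; apply/funext => o; rewrite mulrC.
have E1 := score_eq_rho mw wM tilt mf f2.
have E2 := score_eq_rho mw wM tilt' mf f2.
have i1 := L2_L1 fZ2; have i2 := L2_L1 fZ2'.
transitivity (\int[P]_o (f (L o) * (Zpi w o - rho P w (L o)) -
                         f (L o) * (Zpi w o - rho P' w (L o)))).
  by apply: Rintegral_ext => o; ring.
rewrite RintegralB//.
have -> : \int[P]_o (f (L o) * (Zpi w o - rho P w (L o))) = 0.
  by rewrite -[RHS]E1; apply: Rintegral_ext => o; rewrite mul1r.
transitivity (\int[P]_o (g o * (f (L o) * (Zpi w o - rho P' w (L o))) -
                         f (L o) * (Zpi w o - rho P' w (L o)))).
  by rewrite RintegralB ?E2//; apply: L2M => //; exact: tilt_L2 tilt'.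
by apply: Rintegral_ext => o; ring.
Qed.

(** The difference rho' - rho serves as its own test function. Cauchy-Schwarz bounds its squared
    norm [I] by [2 M] times the norm of [g - 1] times the root of [I], and one factor is divided
    out. *)
Lemma rhoB_L2_le : \int[P]_o (rho P' w (L o) - rho P w (L o)) ^+ 2 <=
  (2 * M) ^+ 2 * \int[P]_o (g o - 1) ^+ 2.
Proof.
pose f l := rho P' w l - rho P w l.
have mf : measurable_fun setT f by apply: measurable_funB; exact: measurable_rho.
have f2 : L2 P (fun o => f (L o)) := L2_rhoB.
have Zf2 := L2M_bounded (measurable_funB mZ mr') rb' f2.
set I := \int[P]_o _; set J := \int[P]_o (g o - 1) ^+ 2.
have I0 : 0 <= I by apply: Rintegral_ge0 => o _; exact: sqr_ge0.
have J0 : 0 <= J by apply: Rintegral_ge0 => o _; exact: sqr_ge0.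
have IE : I = \int[P]_o ((g o - 1) * ((Zpi w o - rho P' w (L o)) * f (L o))).
  transitivity (\int[P]_o (f (L o) * (rho P' w (L o) - rho P w (L o)))).
    by apply: Rintegral_ext => o; rewrite expr2.
  rewrite score_eq_rho_shift//; apply: Rintegral_ext => o; ring.
have := Rintegral_cauchy_schwarz g2 Zf2; rewrite -IE -/J => CS.
have Zle : \int[P]_o ((Zpi w o - rho P' w (L o)) * f (L o)) ^+ 2 <= (2 * M) ^+ 2 * I.
  rewrite -RintegralZl//; last exact: L2_sqr f2.
  apply: le_Rintegral_ae; [exact: L2_sqr Zf2|exact: L1Z (L2_sqr f2)|].
  apply: filterS rb' => o rbo.
  rewrite exprMn ler_wpM2r ?sqr_ge0// -(real_normK (num_real (_ - _))).
  by rewrite lerXn2r ?nnegrE// (le_trans _ rbo).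
have {}CS : I ^+ 2 <= (2 * M) ^+ 2 * J * I.
  by apply: le_trans CS _; rewrite mulrAC mulrC ler_wpM2r.
have [->|I_neq0] := eqVneq I 0; first by rewrite mulr_ge0// sqr_ge0.
by move: CS; rewrite expr2 ler_pM2r// lt_def I_neq0.
Qed.

Section Identity.
Variable phi : R * dL.-tuple R -> R.
Hypothesis mphi : measurable_fun setT phi.
Hypothesis phi0 : forall a l, q a = 0 -> phi (a, l) = 0.
Hypothesis pY : L2 P (fun o => phi (AL o) * Y o).
Hypothesis ph : L2 P (fun o => phi (AL o) * h (AL o)).
Hypothesis ph' : L2 P (fun o => phi (AL o) * h' (AL o)).

Lemma L2_residual : L2 P (fun o => phi (AL o) * (Y o - mu P' w (AL o))).
Proof.
have := L2B pY (L2_muM hpAL hq mw wM e'_gt0 tilt' mphi phi0 ph').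
by congr L2; apply/funext => o; rewrite mulrBr.
Qed.

Lemma score_eq_mu_shift :
  \int[P]_o (phi (AL o) * kappa P w (AL o) * (mu P' w (AL o) - mu P w (AL o))) =
  \int[P]_o ((g o - 1) * (phi (AL o) * ((Y o - mu P' w (AL o)) * (Zpi w o - rho P' w (L o))))) +
  \int[P]_o (phi (AL o) * ((Y o - mu P' w (AL o)) * (rho P w (L o) - rho P' w (L o)))).
Proof.
have pm' := L2_muM hpAL hq mw wM e'_gt0 tilt' mphi phi0 ph'.
have pm := L2_muM hpAL hq mw wM e_gt0 tilt mphi phi0 ph.
have pr' := L2_residual.
have bnd (b : O -> R) C (u : O -> R) : measurable_fun setT b ->
    {ae P, forall o, `|b o| <= C} -> L2 P u -> L2 P (fun o => u o * b o).
  move=> mb bC u2; have := L2M_bounded mb bC u2.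
  by congr L2; apply/funext => o; rewrite mulrC.
pose z := cond_exp P AL (Zpi w).
have mz : measurable_fun setT z by exact: measurable_cond_exp.
have Zi := L1_Zpi P mw wM.
have zM : {ae P, forall o, `|z (AL o)| <= M}.
  by apply: cond_exp_bounded (cond_expP AL Zi) _ => o; exact: wM.
have ZM : {ae P, forall o, `|Zpi w o| <= M} by apply: aeW => o; exact: wM.
pose psi0 al := phi al * (mu P' w al - mu P w al).
have mpsi : measurable_fun setT psi0.
  by apply: measurable_funM => //; apply: measurable_funB; exact: measurable_mu.
have psi2 : L2 P (fun o => psi0 (AL o)).
  by have := L2B pm' pm; congr L2; apply/funext => o; rewrite /psi0 mulrBr.
(* [psi0] is a function of (A, L), so Z may stand for its conditional mean [z]; thus [kappa], which
   is [z - rho], becomes Z - rho under the integral. *)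
have E1 : \int[P]_o (psi0 (AL o) * Zpi w o) = \int[P]_o (psi0 (AL o) * z (AL o)).
  apply: (cond_exp_test (cond_expP AL Zi) mpsi); apply: L2_L1; first exact: bnd ZM psi2.
  exact: bnd (measurable_comp_mfun AL mz) zM psi2.
have pYZ : L2 P (fun o => phi (AL o) * (Y o - mu P w (AL o)) * (Zpi w o - rho P w (L o))).
  apply: (bnd _ _ _ _ rb); first exact: measurable_funB.
  by have := L2B pY pm; congr L2; apply/funext => o; rewrite mulrBr.
have E2 := score_eq_mu hpAL hq mw wM e_gt0 tilt mphi phi0 pY ph.
have E3 := score_eq_mu hpAL hq mw wM e'_gt0 tilt' mphi phi0 pY ph'.
have pYZ' : L2 P (fun o => phi (AL o) * ((Y o - mu P' w (AL o)) * (Zpi w o - rho P' w (L o)))).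
  have := bnd _ _ _ (measurable_funB mZ mr') rb' pr'.
  by congr L2; apply/funext => o; rewrite mulrA.
have pYr : L2 P (fun o => phi (AL o) * ((Y o - mu P' w (AL o)) * (rho P w (L o) - rho P' w (L o)))).
  have rr : {ae P, forall o, `|rho P w (L o) - rho P' w (L o)| <= 2 * M}.
    by apply: filterS rhoB_bounded => o; rewrite distrC.
  have := bnd _ _ _ (measurable_funB mr mr') rr pr'.
  by congr L2; apply/funext => o; rewrite mulrA.
have psiZ : L2 P (fun o => psi0 (AL o) * Zpi w o) by exact: bnd ZM psi2.
have psiz : L2 P (fun o => psi0 (AL o) * z (AL o)).
  exact: bnd (measurable_comp_mfun AL mz) zM psi2.
have psir : L2 P (fun o => psi0 (AL o) * rho P w (L o)) by exact: bnd rM psi2.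
transitivity (\int[P]_o (psi0 (AL o) * z (AL o)) - \int[P]_o (psi0 (AL o) * rho P w (L o))).
  rewrite -RintegralB//; [|exact: L2_L1..].
  have kE o : kappa P w (AL o) = z (AL o) - rho P w (L o) by [].
  by apply: Rintegral_ext => o; rewrite kE /psi0; ring.
rewrite -E1 -RintegralB//; [|exact: L2_L1..].
(* Writing mu' - mu as (Y - mu) - (Y - mu'), and Z - rho as (Z - rho') - (rho - rho') in the second
   part, exposes both moment equations. *)
transitivity (\int[P]_o (phi (AL o) * (Y o - mu P w (AL o)) * (Zpi w o - rho P w (L o)) -
  (phi (AL o) * ((Y o - mu P' w (AL o)) * (Zpi w o - rho P' w (L o))) -
   phi (AL o) * ((Y o - mu P' w (AL o)) * (rho P w (L o) - rho P' w (L o)))))).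
  by apply: Rintegral_ext => o; rewrite /psi0; ring.
rewrite RintegralB//; [|exact: L2_L1|by apply: L2_L1; exact: L2B].
have -> : \int[P]_o (phi (AL o) * (Y o - mu P w (AL o)) * (Zpi w o - rho P w (L o))) = 0.
  by rewrite -[RHS]E2; apply: Rintegral_ext => o; rewrite mul1r mulrA.
rewrite RintegralB//; [|exact: L2_L1..].
have -> : \int[P]_o ((g o - 1) *
    (phi (AL o) * ((Y o - mu P' w (AL o)) * (Zpi w o - rho P' w (L o))))) =
  \int[P]_o (g o * (phi (AL o) * ((Y o - mu P' w (AL o)) * (Zpi w o - rho P' w (L o))))) -
  \int[P]_o (phi (AL o) * ((Y o - mu P' w (AL o)) * (Zpi w o - rho P' w (L o)))).
  rewrite -RintegralB//; last exact: L2_L1; last by apply: L2M => //; exact: tilt_L2 tilt'.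
  by apply: Rintegral_ext => o; ring.
by rewrite E3; ring.
Qed.

End Identity.

End TiltExpansion.

Lemma cvg_L2_norm d (T : measurableType d) (R : realType) (mu : probability T R) (I : Type)
    (F : set_system I) {FF : ProperFilter F} (u : I -> T -> R) (f : T -> R) :
  L2cvg mu F u f -> (fun i => \int[mu]_x u i x ^+ 2) @ F --> \int[mu]_x f x ^+ 2.
Proof.
move=> uf.
have sqE (p : T -> R) : \int[mu]_x (p x * p x) = \int[mu]_x p x ^+ 2.
  by apply: Rintegral_ext => x; rewrite expr2.
rewrite -sqE; apply: cvg_near_eq (L2cvg_dot uf uf); near=> i; exact: sqE.
Unshelve. all: by end_near. Qed.

Lemma cvg_dnbhs_id (R : realType) : (fun t : R => t) @ (0 : R)^' --> (0 : R).
Proof. exact: cvg_within. Qed.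

(** * Limits of rho, mu and the weighted integral of mu along a submodel *)

Section SubmodelLimits.
Context (R : realType) (dL dZ : nat).
Local Notation O := (obs R dL dZ).
Local Notation AL := (@cAL R dL dZ).
Local Notation L := (@cL R dL dZ).
Local Notation Y := (@cY R dL dZ).
Local Notation F := ((0 : R)^').
Context (P : probability O R) (Pt : R -> probability O R) (g : R -> O -> R) (s : O -> R).
Context (pA : R -> R) (pAL : R * dL.-tuple R -> R) (q : R -> R).
Context (w : dZ.-tuple R * dL.-tuple R -> R) (M e e' : R) (h h' : R * dL.-tuple R -> R).
Hypothesis hpA : is_density_A P pA.
Hypothesis hpAL : is_cond_density_AL P pAL.
Hypothesis hq : measurable_fun [set: R] q.
Hypothesis mw : measurable_fun setT w.
Hypothesis wM : forall zl, `|w zl| <= M.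
Hypothesis e_gt0 : 0 < e.
Hypothesis e'_gt0 : 0 < e'.
Hypothesis tilt : regular_tilt q w e h P P (fun=> 1).
Hypothesis tilt' : \forall t \near F, regular_tilt q w e' h' P (Pt t) (g t).
Hypothesis score : L2cvg P F (fun t o => (g t o - 1) / t) s.

(* [k ^ 2] is the weight of [weighted_moment]; it dominates [q ^ 2] and [(delta q) ^ 2]. *)
Definition moment_weight pA' pAL' q' (al : R * dL.-tuple R) : R :=
  q' al.1 * Num.sqrt (1 + delta pA' pAL' al ^+ 2).
Local Notation k := (moment_weight pA pAL q).

Hypothesis kY : L2 P (fun o => k (AL o) * Y o).
Hypothesis kh : L2 P (fun o => k (AL o) * h (AL o)).
Hypothesis kh' : L2 P (fun o => k (AL o) * h' (AL o)).

Let mqA : measurable_fun setT (fun al : R * dL.-tuple R => q al.1).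
Proof. exact: measurableT_comp hq measurable_fst. Qed.

Lemma measurable_moment_weight : measurable_fun setT k.
Proof.
apply: measurable_funM => //.
have md := measurable_delta hpA hpAL.
have : measurable_fun setT (fun al => (1 + delta pA pAL al ^+ 2) `^ 2^-1).
  apply: (measurableT_comp (f := fun x : R => x `^ 2^-1)); first exact: measurable_powR.
  apply: measurable_funD => //.
  exact: measurable_funX.
apply: eq_measurable_fun => al _.
by rewrite powR12_sqrt// addr_ge0// sqr_ge0.
Qed.

Let mk := measurable_moment_weight.
Let mkA := measurable_comp_mfun AL mk.

Lemma moment_weight0 a l : q a = 0 -> k (a, l) = 0.
Proof. by rewrite /moment_weight /= => ->; rewrite mul0r. Qed.

Lemma sqr_moment_weight al : k al ^+ 2 = (1 + delta pA pAL al ^+ 2) * q al.1 ^+ 2.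
Proof. by rewrite exprMn sqr_sqrtr 1?mulrC// addr_ge0// sqr_ge0. Qed.

Lemma qdelta_le_moment_weight al : `|q al.1 * delta pA pAL al| <= `|k al|.
Proof.
rewrite -ler_sqr ?nnegrE// !real_normK ?num_real// sqr_moment_weight exprMn mulrC mulrDl mul1r.
by rewrite lerDr sqr_ge0.
Qed.

Lemma L2_weightM C (u : R * dL.-tuple R -> R) (X : O -> R) : measurable_fun setT u ->
  measurable_fun setT X ->
  {ae P, forall o, `|u (AL o)| <= C * `|k (AL o)|} -> L2 P (fun o => k (AL o) * X o) ->
  L2 P (fun o => u (AL o) * X o).
Proof.
move=> mu_ mX uk kX; apply: (L2_le_ae (C := C)) kX _.
  by apply: measurable_funM => //; exact: measurable_comp_mfun.
by apply: filterS uk => o uk; rewrite normrM (normrM (k (AL o))) mulrA ler_wpM2r.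
Qed.

Let mh : measurable_fun [set: O] (fun o => h (AL o)).
Proof. exact: measurable_comp_mfun (tilt_bound_measurable tilt). Qed.

Lemma cvg_tilt : L2cvg P F (fun t o => g t o - 1) (fun=> 0).
Proof.
split.
- by apply: filterS tilt' => t tt; apply: L2B; [exact: tilt_L2 tt|exact: L2_cst].
- exact: L2_cst.
- have tdd : (fun t : R => t * t * \int[P]_o ((g t o - 1) / t) ^+ 2) @ F -->
      0 * 0 * \int[P]_o s o ^+ 2.
    apply: cvgM (cvg_L2_norm score).
    by apply: cvgM; exact: cvg_dnbhs_id.
  rewrite mul0r mul0r in tdd; apply: cvg_near_eq tdd.
  have [d2 _ _] := score; near=> t => /=.
  have t0 : t != 0 by near: t; exact: nbhs_dnbhs_neq.
  have dt2 : L2 P (fun o => (g t o - 1) / t) by near: t.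
  rewrite -RintegralZl//; last exact: L2_sqr.
  by apply: Rintegral_ext => o /=; field.
Unshelve. all: by end_near. Qed.

Lemma cvg_rho : L2cvg P F (fun t o => rho (Pt t) w (L o) - rho P w (L o)) (fun=> 0).
Proof.
have [g2 _ g0] := cvg_tilt.
split.
- by apply: filterS tilt' => t tt; exact: L2_rhoB mw wM tilt tt.
- exact: L2_cst.
- apply: (cvg0_le (b := fun t => (2 * M) ^+ 2 * \int[P]_o (g t o - 1 - 0) ^+ 2)); last first.
    by rewrite -[X in _ --> X](mulr0 ((2 * M) ^+ 2)); apply: cvgMl_tmp; exact: g0.
  near=> t; rewrite ger0_norm; last by apply: Rintegral_ge0 => x _; exact: sqr_ge0.
  rewrite !Rintegral_sqr_subr0.
  have tt : regular_tilt q w e' h' P (Pt t) (g t) by near: t.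
  exact: rhoB_L2_le mw wM tilt tt.
Unshelve. all: by end_near. Qed.

Let rhoM : \forall t \near F,
  {ae P, forall o, `|rho (Pt t) w (L o) - rho P w (L o)| <= 2 * M}.
Proof. by apply: filterS tilt' => t tt; exact: rhoB_bounded mw wM tilt tt. Qed.

Let C' : R := 2 * M / e'.

Let M0 : 0 <= M. Proof. by rewrite (le_trans (normr_ge0 (w point))). Qed.

Let C'0 : 0 <= C'. Proof. by rewrite divr_ge0 ?mulr_ge0// ltW. Qed.

Let ex_tilt : exists t, regular_tilt q w e' h' P (Pt t) (g t).
Proof. by apply: (@filter_ex _ _ (Proper_dnbhs_numFieldType (0 : R))); exact: tilt'. Qed.

Let mh' : measurable_fun [set: O] (fun o => h' (AL o)).
Proof.
suff : measurable_fun setT h' by exact: measurable_comp_mfun.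
have [t tt] := ex_tilt; exact: tilt_bound_measurable tt.
Qed.

Let h'0 : {ae P, forall o, 0 <= h' (AL o)}.
Proof. have [t tt] := ex_tilt; exact: h_ge0 tt. Qed.

Lemma cvg_mu_L1 : (fun t => \int[P]_o `|k (AL o) * (mu (Pt t) w (AL o) - mu P w (AL o))|)
  @ F --> (0 : R).
Proof.
pose D t al := mu (Pt t) w al - mu P w al.
(* The quotient of [D] by its absolute value is the sign of mu' - mu, equal to 0 where [D = 0]
   because inversion sends 0 to 0. With [|k|] in front, [phi kappa D] is exactly [|k D|]. *)
pose phi t al := `|k al| * (D t al * `|D t al|^-1) * (kappa P w al)^-1.
have mD t : measurable_fun setT (D t) by apply: measurable_funB; exact: measurable_mu.
have mphi t : measurable_fun setT (phi t).
  apply: measurable_funM; last exact: measurable_fun_inv (measurable_kappa P w).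
  apply: measurable_funM; first exact: measurableT_comp.
  by apply: measurable_funM => //; apply: measurable_fun_inv; exact: measurableT_comp.
have phi0 t a l : q a = 0 -> phi t (a, l) = 0.
  by move=> q0; rewrite /phi moment_weight0// normr0 !mul0r.
have kge := kappa_ge hpAL hq mw wM tilt.
have phik t : {ae P, forall o, `|phi t (AL o)| <= e^-1 * `|k (AL o)|}.
  apply: filterS kge => o ke.
  have [q0|q0] := eqVneq (q (cA o)) 0.
    by rewrite phi0// normr0 mulr_ge0// invr_ge0 ltW.
  rewrite /phi [leLHS]normrM (normrM `|k (AL o)|) (normrM (D t (AL o))) normr_id !normfV normr_id.
  rewrite mulrC.
  have sg1 : `|D t (AL o)| / `|D t (AL o)| <= 1.
    have [->|D0] := eqVneq `|D t (AL o)| 0; first by rewrite mul0r.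
    by rewrite divff.
  rewrite ler_pM// ?mulr_ge0 ?invr_ge0//.
    by rewrite lef_pV2 ?posrE ?ke// (lt_le_trans e_gt0)// ke.
  by rewrite -[leRHS]mulr1 ler_wpM2l.
have pX t X : measurable_fun setT X -> L2 P (fun o => k (AL o) * X o) ->
    L2 P (fun o => phi t (AL o) * X o).
  by move=> mX; apply: L2_weightM (phik t).
have alg (a d n x : R) : n != 0 -> x != 0 -> d * d = n * n -> a * n = a * (d / n) / x * x * d.
  move=> n0 x0 dd; transitivity (a * (d * d) / n); first by rewrite dd; field.
  by field; rewrite n0 x0.
have E t : regular_tilt q w e' h' P (Pt t) (g t) ->
    \int[P]_o `|k (AL o) * D t (AL o)| =
    \int[P]_o ((g t o - 1) * (phi t (AL o) * ((Y o - mu (Pt t) w (AL o)) *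
      (Zpi w o - rho (Pt t) w (L o))))) +
    \int[P]_o ((rho (Pt t) w (L o) - rho P w (L o)) *
      (- (phi t (AL o) * (Y o - mu (Pt t) w (AL o))))).
  move=> tt.
  have -> : \int[P]_o ((rho (Pt t) w (L o) - rho P w (L o)) *
      (- (phi t (AL o) * (Y o - mu (Pt t) w (AL o))))) =
    \int[P]_o (phi t (AL o) * ((Y o - mu (Pt t) w (AL o)) * (rho P w (L o) - rho (Pt t) w (L o)))).
    by apply: Rintegral_ext => o; ring.
  rewrite -(score_eq_mu_shift hpAL hq mw wM e_gt0 e'_gt0 tilt tt (mphi t) (phi0 t)
    (pX t _ (@measurable_cY R dL dZ) kY) (pX t _ mh kh) (pX t _ mh' kh')).
  apply: eq_Rintegral_ae.
  - apply: measurableT_comp => //; apply: measurable_funM => //.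
    exact: measurable_comp_mfun (mD t).
  - apply: measurable_funM; last exact: measurable_comp_mfun (mD t).
    apply: measurable_funM; first exact: measurable_comp_mfun (mphi t).
    exact: measurable_comp_mfun (measurable_kappa P w).
  - apply: filterS kge => o ke; have [q0|q0] := eqVneq (q (cA o)) 0.
      by rewrite phi0// moment_weight0// !mul0r normr0.
    have k0 : kappa P w (AL o) != 0 by rewrite -normr_gt0 (lt_le_trans e_gt0)// ke.
    rewrite -/(D t (AL o)) /phi (normrM (k (AL o))); have [->|D0] := eqVneq (D t (AL o)) 0.
      by rewrite normr0 !mulr0.
    have nD0 : `|D t (AL o)| != 0 by rewrite normr_eq0.
    have DD : D t (AL o) * D t (AL o) = `|D t (AL o)| * `|D t (AL o)|.
      by rewrite -!expr2 real_normK ?num_real.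
    exact: alg.
(* A square-integrable bound on [phi (Y - mu')] independent of [t]: [phi] is at most [|k| / e], and
   mu' at most [C' * h'], where [C'] is the constant of [mu_bounded] for the tilted laws. *)
pose H o := e^-1 * (`|k (AL o) * Y o| + C' * `|k (AL o) * h' (AL o)|).
have H2 : L2 P H by apply: L2Z; apply: L2D; [exact: L2_norm|apply: L2Z; exact: L2_norm].
have resH t : regular_tilt q w e' h' P (Pt t) (g t) ->
    {ae P, forall o, `|phi t (AL o) * (Y o - mu (Pt t) w (AL o))| <= H o}.
  move=> tt; have mub := mu_bounded hpAL hq mw wM e'_gt0 tt.
  apply: filterS3 (phik t) mub h'0 => o pk mb h0.
  have [q0|q0] := eqVneq (q (cA o)) 0.
    rewrite phi0// mul0r normr0 /H moment_weight0// !mul0r normr0.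
    by rewrite mulr0 addr0 mulr0.
  rewrite [leLHS]normrM /H (normrM (k (AL o)) (Y o)) (normrM (k (AL o)) (h' (AL o))) (ger0_norm h0).
  apply: le_trans (ler_wpM2r (normr_ge0 _) pk) _.
  rewrite -[leLHS]mulrA; apply: ler_wpM2l; first by rewrite invr_ge0 ltW.
  rewrite [X in _ <= _ + X]mulrCA -[leRHS]mulrDr; apply: ler_wpM2l => //.
  by rewrite (le_trans (ler_normB _ _))// lerD2l mb.
have mres t : measurable_fun setT (fun o => phi t (AL o) * (Y o - mu (Pt t) w (AL o))).
  apply: measurable_funM; first exact: measurable_comp_mfun (mphi t).
  apply: measurable_funB; first exact: measurable_cY.
  exact: measurable_comp_mfun (measurable_mu (Pt t) w).
rewrite -[X in _ --> X]addr0.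
apply: (@cvg_near_eq _ _ F _ _ (fun t =>
    \int[P]_o ((g t o - 1) * (phi t (AL o) * ((Y o - mu (Pt t) w (AL o)) *
      (Zpi w o - rho (Pt t) w (L o))))) +
    \int[P]_o ((rho (Pt t) w (L o) - rho P w (L o)) *
      (- (phi t (AL o) * (Y o - mu (Pt t) w (AL o))))))).
  by apply: filterS tilt' => t tt; rewrite -E.
apply: cvgD.
- apply: (L2cvg0_dot_dominated (H := fun o => 2 * M * H o)); first exact: L2Z.
    exact: cvg_tilt.
  apply: filterS tilt' => t tt; split.
    have := measurable_funM (mres t) (measurable_funB (measurable_Zpi mw)
      (measurable_comp_mfun L (measurable_rho (Pt t) w))).
    by congr measurable_fun; apply/funext => o; rewrite /= mulrA.
  apply: filterS2 (resH _ tt) (residual_bounded mw wM tt) => o rH rb.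
  by rewrite mulrA normrM mulrC ler_pM.
- apply: (L2cvg0_dot_dominated H2); first exact: cvg_rho.
  apply: filterS tilt' => t tt; split; first exact: measurable_funN.
  by apply: filterS (resH _ tt) => o; rewrite normrN.
Qed.

Lemma cvg_mu : L2cvg P F (fun t o => k (AL o) * (mu (Pt t) w (AL o) - mu P w (AL o))) (fun=> 0).
Proof.
have mub := mu_bounded hpAL hq mw wM e_gt0 tilt.
apply: (L2cvg0_dominated (H := fun o => C' * `|k (AL o) * h' (AL o)| +
    2 * M / e * `|k (AL o) * h (AL o)|)).
- by apply: L2D; apply: L2Z; exact: L2_norm.
- apply: filterS tilt' => t tt; split.
    apply: measurable_funM => //; apply: measurable_funB.
      exact: measurable_comp_mfun (measurable_mu (Pt t) w).
    exact: measurable_comp_mfun (measurable_mu P w).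
  have mub' := mu_bounded hpAL hq mw wM e'_gt0 tt.
  apply: filterS2 (filterI mub mub') (filterI h'0 (h_ge0 tilt)) => o [mb mb'] [h'o ho].
  have [q0|q0] := eqVneq (q (cA o)) 0.
    by rewrite moment_weight0// !mul0r normr0 !mulr0 addr0.
  rewrite [leLHS]normrM (normrM (k (AL o)) (h' (AL o))) (normrM (k (AL o)) (h (AL o))).
  rewrite (ger0_norm h'o) (ger0_norm ho) [X in _ <= X + _]mulrCA [X in _ <= _ + X]mulrCA.
  rewrite -[leRHS]mulrDr; apply: ler_wpM2l => //.
  by rewrite (le_trans (ler_normB _ _))// lerD ?mb ?mb'.
- exact: cvg_mu_L1.
Qed.

Local Notation W := (fun al => q al.1 * delta pA pAL al / kappa P w al).

Lemma measurable_eif_weight : measurable_fun setT W.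
Proof.
apply: measurable_funM; last exact: measurable_fun_inv (measurable_kappa P w).
by apply: measurable_funM => //; exact: measurable_delta hpA hpAL.
Qed.

Let mW := measurable_eif_weight.

Lemma eif_weight0 a l : q a = 0 -> W (a, l) = 0.
Proof. by move=> /= ->; rewrite !mul0r. Qed.

Lemma eif_weight_le : {ae P, forall o, `|W (AL o)| <= e^-1 * `|k (AL o)|}.
Proof.
apply: filterS (kappa_ge hpAL hq mw wM tilt) => o ke.
have [q0|q0] := eqVneq (q (cA o)) 0.
  by rewrite /= q0 !mul0r normr0 mulr_ge0// invr_ge0 ltW.
rewrite [leLHS]normrM mulrC normfV; apply: ler_pM => //.
- by rewrite lef_pV2 ?posrE ?ke// (lt_le_trans e_gt0)// ke.
- exact: qdelta_le_moment_weight.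
Qed.

Lemma L2_eif_weightM X : measurable_fun setT X -> L2 P (fun o => k (AL o) * X o) ->
  L2 P (fun o => W (AL o) * X o).
Proof. by move=> mX; apply: L2_weightM eif_weight_le. Qed.

Lemma L2_eif_residual : L2 P (fun o => W (AL o) * (Y o - mu P w (AL o))).
Proof.
exact: (L2_residual hpAL hq mw wM e_gt0 tilt mW eif_weight0
  (L2_eif_weightM (@measurable_cY R dL dZ) kY) (L2_eif_weightM mh kh)).
Qed.

Lemma cvg_eif_weight_mu :
  L2cvg P F (fun t o => W (AL o) * (mu (Pt t) w (AL o) - mu P w (AL o))) (fun=> 0).
Proof.
(* [W] is a bounded multiple of [k], so convergence passes from one weight to the other. Where
   [k = 0] the product [q delta] is 0 as well, so the default value of the inverse does no harm. *)
pose b al := W al * (k al)^-1.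
have mb : measurable_fun setT b.
  by apply: measurable_funM => //; exact: measurable_fun_inv.
have be : {ae P, forall o, `|b (AL o)| <= e^-1}.
  apply: filterS eif_weight_le => o We; rewrite [leLHS]normrM normfV.
  have [->|k0] := eqVneq `|k (AL o)| 0; first by rewrite invr0 mulr0 invr_ge0 ltW.
  by rewrite ler_pdivrMr// lt_def k0 /=.
have bk : L2cvg P F (fun t o => b (AL o) * (k (AL o) * (mu (Pt t) w (AL o) - mu P w (AL o))))
    (fun=> 0).
  apply: L2cvg0_bounded cvg_mu; near=> t; split; last exact: be.
  exact: measurable_comp_mfun mb.
have WE o : W (AL o) = b (AL o) * k (AL o).
  rewrite /b; have [k0|k0] := eqVneq (k (AL o)) 0; last by rewrite divfK.
  have := qdelta_le_moment_weight (AL o); rewrite k0 normr0 normr_le0 => /eqP qd.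
  by rewrite mulr0 /= in qd *; rewrite qd mul0r.
move: bk; congr (L2cvg P F); apply/funext => t; apply/funext => o.
by rewrite WE mulrA.
Unshelve. all: by end_near. Qed.

Section Limit.
(** [K] plays the conditional mean of [W (Y - mu)] given L, kept abstract until [eif_K] supplies it.
    Bounded tests suffice because the function tested is rho' - rho. *)
Variable K : dL.-tuple R -> R.
Hypothesis mK : measurable_fun setT K.
Hypothesis K2 : L2 P (fun o => K (L o)).
Hypothesis KE : forall (f : dL.-tuple R -> R) (C : R), measurable_fun setT f ->
  {ae P, forall o, `|f (L o)| <= C} ->
  \int[P]_o (W (AL o) * (Y o - mu P w (AL o)) * f (L o)) = \int[P]_o (K (L o) * f (L o)).

Let cvg_rho_vanishing (u : O -> R) : L2 P u ->
  L2cvg P F (fun t o => (rho (Pt t) w (L o) - rho P w (L o)) * u o) (fun=> 0).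
Proof. by move=> u2; apply: L2cvg0M_vanishing cvg_rho => //; exact: rhoM. Qed.

Let rhoN (u : R -> O -> R) : L2cvg P F u (fun=> 0) -> L2cvg P F (fun t o => - u t o) (fun=> 0).
Proof.
move=> u0; have : L2cvg P F (fun t o => -1 * u t o) (fun=> 0).
  apply: (@L2cvg0_bounded _ _ _ P _ F _ 1 (fun _ _ => -1)) u0.
  by near=> t; split => //; apply: aeW => o; rewrite normrN normr1.
by congr L2cvg; apply/funext => t; apply/funext => o; rewrite mulN1r.
Unshelve. all: by end_near. Qed.

Let Zr_bounded : \forall t \near F, measurable_fun setT (fun o => Zpi w o - rho (Pt t) w (L o)) /\
  {ae P, forall o, `|Zpi w o - rho (Pt t) w (L o)| <= 2 * M}.
Proof.
apply: filterS tilt' => t tt; split; last exact: residual_bounded mw wM tt.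
apply: measurable_funB; first exact: measurable_Zpi.
exact: measurable_comp_mfun (measurable_rho (Pt t) w).
Qed.

Let Zr_P : {ae P, forall o, `|Zpi w o - rho P w (L o)| <= 2 * M}.
Proof. exact: residual_bounded mw wM tilt. Qed.

Let mZr_P : measurable_fun setT (fun o => Zpi w o - rho P w (L o)).
Proof.
apply: measurable_funB; first exact: measurable_Zpi.
exact: measurable_comp_mfun (measurable_rho P w).
Qed.

Let L2_Zr u : L2 P u -> L2 P (fun o => u o * (Zpi w o - rho P w (L o))).
Proof.
move=> u2; have := L2M_bounded mZr_P Zr_P u2.
by congr L2; apply/funext => o; rewrite mulrC.
Qed.

(** The error has two parts: Z - rho', which is bounded, times the vanishing [W (mu' - mu)]; and
    rho' - rho, which is bounded and vanishing, times the fixed L^2 function [W (Y - mu)]. *)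
Let cvg_score_mu : L2cvg P F
  (fun t o => W (AL o) * ((Y o - mu (Pt t) w (AL o)) * (Zpi w o - rho (Pt t) w (L o))))
  (fun o => W (AL o) * (Y o - mu P w (AL o)) * (Zpi w o - rho P w (L o))).
Proof.
apply: L2cvg_sub0; first exact: L2_Zr L2_eif_residual.
pose proof (rhoN (L2cvg0_bounded Zr_bounded cvg_eif_weight_mu)) as c1.
pose proof (rhoN (cvg_rho_vanishing L2_eif_residual)) as c2.
pose proof (L2cvgD c1 c2) as c3.
move: c3; have -> : (fun _ : O => 0 + 0) = (fun=> 0 : R) by apply/funext => o; rewrite addr0.
by congr L2cvg; apply/funext => t; apply/funext => o; ring.
Qed.

Let cvg_score_rho : L2cvg P F (fun t o => K (L o) * (Zpi w o - rho (Pt t) w (L o)))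
  (fun o => K (L o) * (Zpi w o - rho P w (L o))).
Proof.
apply: L2cvg_sub0; first exact: L2_Zr.
have := rhoN (cvg_rho_vanishing K2).
by congr L2cvg; apply/funext => t; apply/funext => o; ring.
Qed.

(** Dividing by [t] leaves a null sequence times a bounded one: [W (mu' - mu)] tends to 0 in L^2,
    while [rhoB_L2_le] bounds the norm of [(rho' - rho) / t] by that of the difference quotient of
    [g], which converges. *)
Let cvg_quadratic : (fun t => \int[P]_o ((W (AL o) * (mu (Pt t) w (AL o) - mu P w (AL o))) *
  ((rho (Pt t) w (L o) - rho P w (L o)) / t))) @ F --> (0 : R).
Proof.
have [W2 _ W0] := cvg_eif_weight_mu; have [d2 _ _] := score.
apply: cvg_sqr0.
pose I t := \int[P]_o (W (AL o) * (mu (Pt t) w (AL o) - mu P w (AL o)) - 0) ^+ 2.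
pose J t := \int[P]_o ((g t o - 1) / t) ^+ 2.
apply: (cvg0_le (b := fun t => I t * ((2 * M) ^+ 2 * J t))); last first.
  rewrite -[X in _ --> X](mul0r ((2 * M) ^+ 2 * \int[P]_o s o ^+ 2)).
  apply: cvgM; first exact: W0.
  apply: cvgMl_tmp; exact: cvg_L2_norm score.
near=> t; have t0 : t != 0 by near: t; exact: nbhs_dnbhs_neq.
have tt : regular_tilt q w e' h' P (Pt t) (g t) by near: t.
have Wt2 : L2 P (fun o => W (AL o) * (mu (Pt t) w (AL o) - mu P w (AL o))) by near: t.
have r2 : L2 P (fun o => (rho (Pt t) w (L o) - rho P w (L o)) / t).
  have := L2Z t^-1 (L2_rhoB mw wM tilt tt).
  by congr L2; apply/funext => o; rewrite mulrC.
rewrite ger0_norm ?sqr_ge0//; apply: le_trans (Rintegral_cauchy_schwarz Wt2 r2) _.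
rewrite /I Rintegral_sqr_subr0; apply: ler_wpM2l.
  by apply: Rintegral_ge0 => o _; exact: sqr_ge0.
have sc (u : O -> R) : L2 P u -> \int[P]_o (u o / t) ^+ 2 = t ^- 2 * \int[P]_o u o ^+ 2.
  move=> u2; rewrite -RintegralZl//; last exact: L2_sqr.
  by apply: Rintegral_ext => o; rewrite exprMn exprVn mulrC.
rewrite /J !sc; last 2 first.
- by apply: L2B; [exact: tilt_L2 tt|exact: L2_cst].
- exact: L2_rhoB mw wM tilt tt.
rewrite mulrCA; apply: ler_wpM2l; first by rewrite invr_ge0 sqr_ge0.
exact: rhoB_L2_le mw wM tilt tt.
Unshelve. all: by end_near. Qed.

(** The shift identity with [phi = W] gives a term in [g - 1] and one in rho - rho'. In the latter,
    mu' is replaced by mu up to [cvg_quadratic]; then [KE] substitutes [K] for [W (Y - mu)], and the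
    identity for rho turns the result into a second term in [g - 1]. Both converge as inner products
    with the score. *)
Lemma cvg_mu_quotient :
  (fun t => t^-1 * \int[P]_o (q (cA o) * delta pA pAL (AL o) *
                              (mu (Pt t) w (AL o) - mu P w (AL o)))) @ F -->
  \int[P]_o (s o * (W (AL o) * (Y o - mu P w (AL o)) * (Zpi w o - rho P w (L o)))) -
  \int[P]_o (s o * (K (L o) * (Zpi w o - rho P w (L o)))).
Proof.
rewrite -[X in _ --> X]addr0.
apply: (@cvg_near_eq _ _ F _ _ (fun t =>
  \int[P]_o (((g t o - 1) / t) *
     (W (AL o) * ((Y o - mu (Pt t) w (AL o)) * (Zpi w o - rho (Pt t) w (L o))))) -
  \int[P]_o (((g t o - 1) / t) * (K (L o) * (Zpi w o - rho (Pt t) w (L o)))) +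
  \int[P]_o ((W (AL o) * (mu (Pt t) w (AL o) - mu P w (AL o))) *
     ((rho (Pt t) w (L o) - rho P w (L o)) / t)))); last first.
  apply: cvgD; last exact: cvg_quadratic.
  apply: cvgB; [exact: L2cvg_dot score cvg_score_mu|exact: L2cvg_dot score cvg_score_rho].
have [d2 _ _] := score; have [W2 _ _] := cvg_eif_weight_mu; have [S2 _ _] := cvg_score_mu.
near=> t; have t0 : t != 0 by near: t; exact: nbhs_dnbhs_neq.
have tt : regular_tilt q w e' h' P (Pt t) (g t) by near: t.
have Wt2 : L2 P (fun o => W (AL o) * (mu (Pt t) w (AL o) - mu P w (AL o))) by near: t.
have r2 := L2_rhoB mw wM tilt tt.
have WY := L2_eif_weightM (@measurable_cY R dL dZ) kY.
have Wh := L2_eif_weightM mh kh; have Wh' := L2_eif_weightM mh' kh'.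
have shift := score_eq_mu_shift hpAL hq mw wM e_gt0 e'_gt0 tilt tt mW eif_weight0 WY Wh Wh'.
have mf : measurable_fun setT (fun l => rho (Pt t) w l - rho P w l).
  by apply: measurable_funB; exact: measurable_rho.
have Kf := KE mf (rhoB_bounded mw wM tilt tt).
have Ks := score_eq_rho_shift mw wM tilt tt mK K2.
have dt2 : L2 P (fun o => g t o - 1) by apply: L2B; [exact: tilt_L2 tt|exact: L2_cst].
have St2 : L2 P (fun o => W (AL o) * ((Y o - mu (Pt t) w (AL o)) * (Zpi w o - rho (Pt t) w (L o)))).
  by near: t.
have Kt2 : L2 P (fun o => K (L o) * (Zpi w o - rho (Pt t) w (L o))).
  have [mZ bZ] : measurable_fun setT (fun o => Zpi w o - rho (Pt t) w (L o)) /\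
      {ae P, forall o, `|Zpi w o - rho (Pt t) w (L o)| <= 2 * M} by near: t.
  by have := L2M_bounded mZ bZ K2; congr L2; apply/funext => o; rewrite mulrC.
have pull (u v : O -> R) : L2 P u -> L2 P v ->
    \int[P]_o ((u o / t) * v o) = t^-1 * \int[P]_o (u o * v o).
  move=> u2 v2; rewrite -RintegralZl//; last exact: L2M.
  by apply: Rintegral_ext => o; ring.
rewrite (pull _ _ dt2 St2) (pull _ _ dt2 Kt2).
have -> : \int[P]_o ((W (AL o) * (mu (Pt t) w (AL o) - mu P w (AL o))) *
     ((rho (Pt t) w (L o) - rho P w (L o)) / t)) =
  t^-1 * \int[P]_o ((rho (Pt t) w (L o) - rho P w (L o)) *
     (W (AL o) * (mu (Pt t) w (AL o) - mu P w (AL o)))).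
  by rewrite -pull//; apply: Rintegral_ext => o; rewrite mulrC.
rewrite -Ks -Kf -mulrBr -mulrDr; congr (_ * _).
transitivity (\int[P]_o (W (AL o) * kappa P w (AL o) *
  (mu (Pt t) w (AL o) - mu P w (AL o)))); last first.
  apply: eq_Rintegral_ae.
  - apply: measurable_funM; last first.
      by apply: (measurable_comp_mfun AL (g := fun al => mu (Pt t) w al - mu P w al));
         apply: measurable_funB; exact: measurable_mu.
    apply: measurable_funM; first exact: measurable_comp_mfun mW.
    exact: measurable_comp_mfun (measurable_kappa P w).
  - apply: measurable_funM; last first.
      by apply: (measurable_comp_mfun AL (g := fun al => mu (Pt t) w al - mu P w al));
         apply: measurable_funB; exact: measurable_mu.
    by apply: (measurable_comp_mfun AL (g := fun al => q al.1 * delta pA pAL al));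
       apply: measurable_funM => //; exact: measurable_delta hpA hpAL.
  - apply: filterS (kappa_ge hpAL hq mw wM tilt) => o ke.
    have [q0|q0] := eqVneq (q (cA o)) 0; first by rewrite /= q0 !mul0r.
    have k0 : kappa P w (AL o) != 0 by rewrite -normr_gt0 (lt_le_trans e_gt0)// ke.
    by rewrite divfK.
rewrite shift; set I1 := \int[P]_o ((g t o - 1) * _).
have i1 : L1 P (fun o => W (AL o) * (Y o - mu P w (AL o)) * (rho (Pt t) w (L o) - rho P w (L o))).
  exact: L2M L2_eif_residual r2.
have i2 := L2M r2 Wt2.
rewrite -addrA; congr (_ + _); rewrite -mulN1r -RintegralZl// -Rintegral_add//; last exact: L1Z.
by apply: Rintegral_ext => o; ring.
Unshelve. all: by end_near. Qed.

End Limit.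

End SubmodelLimits.

(** * Product spaces, exchange of factors and tilts of product laws *)

Section ProductSpace.
Context (R : realType).

Section TwoFactors.
Context d1 d2 (T1 : measurableType d1) (T2 : measurableType d2).
Variables (P1 : probability T1 R) (P2 : probability T2 R).
Implicit Types f : T1 * T2 -> R.
Local Notation PP := ((P1 \x P2)%E : probability (T1 * T2)%type R).

Lemma measurable_section1 f x : measurable_fun setT f -> measurable_fun setT (fun y => f (x, y)).
Proof. by move=> mf; exact: measurableT_comp mf (pair1_measurable x). Qed.

Lemma measurable_section2 f y : measurable_fun setT f -> measurable_fun setT (fun x => f (x, y)).
Proof. by move=> mf; exact: measurableT_comp mf (pair2_measurable y). Qed.

(** The extended integral is a difference of two Tonelli-measurable integrals, and [fine] is
    measurable; this also covers sections that are not integrable. *)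
Lemma measurable_partial_integral f : measurable_fun setT f ->
  measurable_fun setT (fun x => \int[P2]_y f (x, y)).
Proof.
move=> mf; apply: (measurableT_comp (f := fine)) => //.
have mfe : measurable_fun setT (EFin \o f) by exact/measurable_EFinP.
have -> : (fun x => \int[P2]_y (f (x, y))%:E)%E = (fun x =>
    fubini_F P2 (EFin \o f)^\+ x - fubini_F P2 (EFin \o f)^\- x)%E.
  apply/funext => x; rewrite integralE /fubini_F.
  by congr (_ - _)%E; apply: eq_integral => y _; rewrite ?funeposE ?funenegE.
apply: emeasurable_funB.
- by apply: measurable_fun_fubini_tonelli_F => //; exact: measurable_funepos.
- by apply: measurable_fun_fubini_tonelli_F => //; exact: measurable_funeneg.
Qed.

Lemma ae_L1_section f : L1 PP f -> {ae P1, forall x, L1 P2 (fun y => f (x, y))}.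
Proof. exact: ae_integrable1. Qed.

Lemma fubini_Rintegral f : L1 PP f -> \int[PP]_z f z = \int[P1]_x \int[P2]_y f (x, y).
Proof.
move=> fi; have mf := L1_measurable fi.
rewrite /Rintegral; congr fine.
rewrite -(integral12_prod_meas1 fi); apply: ae_eq_integral => //.
- exact: measurable_fubini_F fi.
- apply/measurable_EFinP; exact: (measurable_partial_integral mf).
- apply: filterS (ae_L1_section fi) => x fxi _.
  by rewrite /fubini_F (integralE_L1 fxi).
Qed.

Lemma L1_partial_integral f : L1 PP f -> L1 P1 (fun x => \int[P2]_y f (x, y)).
Proof.
move=> fi; have mf := L1_measurable fi.
have /integrableP[_ Foo] := integrable_fubini_F fi.
apply: L1P; first exact: measurable_partial_integral.
apply: le_lt_trans Foo; apply: ae_ge0_le_integral => //.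
- apply/measurable_EFinP; apply: measurableT_comp => //.
  exact: (measurable_partial_integral mf).
- by apply: measurableT_comp => //; exact: measurable_fubini_F fi.
- apply: filterS (ae_L1_section fi) => x fxi _.
  by rewrite /fubini_F (integralE_L1 fxi).
Qed.

(** Cauchy-Schwarz against the constant 1 on each section bounds the squared partial integral by the
    partial integral of the square. *)
Lemma L2_partial_integral f : L2 PP f -> L2 P1 (fun x => \int[P2]_y f (x, y)).
Proof.
move=> f2; have mf := L2_measurable f2; split; first exact: measurable_partial_integral.
have f2i := L2_sqr f2.
apply: L1_le_ae (L1_partial_integral f2i) _.
  by apply: measurable_funX; exact: measurable_partial_integral.
apply: filterS (ae_L1_section f2i) => x fx2.
have fxL2 : L2 P2 (fun y => f (x, y)) by split => //; exact: measurable_section1.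
have := Rintegral_cauchy_schwarz fxL2 (L2_cst P2 1).
rewrite (@Rintegral_ext _ _ _ _ _ (fun y => f (x, y))); last by move=> y; rewrite mulr1.
have -> : \int[P2]_y ((1 : R) ^+ 2) = 1.
  by rewrite expr1n Rintegral_prob_cst.
rewrite mulr1 => CS; rewrite ger0_norm ?sqr_ge0//; apply: le_trans CS _.
exact: ler_norm.
Qed.

Lemma L1_tensor (u : T1 -> R) (v : T2 -> R) : L1 P1 u -> L1 P2 v ->
  L1 PP (fun z => u z.1 * v z.2).
Proof.
move=> ui vi; have mu_ := L1_measurable ui; have mv := L1_measurable vi.
have m1 : measurable_fun setT (fun z : T1 * T2 => u z.1).
  exact: measurableT_comp mu_ measurable_fst.
have m2 : measurable_fun setT (fun z : T1 * T2 => v z.2).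
  exact: measurableT_comp mv measurable_snd.
apply: L1P; first exact: measurable_funM.
rewrite fubini_tonelli1//=; last first.
  by apply/measurable_EFinP; apply: measurableT_comp => //; exact: measurable_funM.
rewrite (_ : (fun x => _) = fun x => (`|u x|%:E * (\int[P2]_y `|v y|)%:E)%E); last first.
  apply/funext => x; rewrite /fubini_F /=.
  under eq_integral do rewrite normrM EFinM.
  rewrite ge0_integralZl//; last by apply/measurable_EFinP; exact: measurableT_comp.
  by rewrite (integralE_L1 (L1_norm vi)).
rewrite ge0_integralZr//.
- by rewrite (integralE_L1 (L1_norm ui)) -EFinM ltry.
- by apply/measurable_EFinP; exact: measurableT_comp.
- by rewrite lee_fin; exact: Rintegral_ge0.
Qed.

Lemma Rintegral_tensor (u : T1 -> R) (v : T2 -> R) : L1 P1 u -> L1 P2 v ->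
  \int[PP]_z (u z.1 * v z.2) = \int[P1]_x u x * \int[P2]_y v y.
Proof.
move=> ui vi; rewrite (fubini_Rintegral (L1_tensor ui vi)) -RintegralZr//.
by apply: Rintegral_ext => x /=; rewrite RintegralZl.
Qed.

Lemma L2_tensor (u : T1 -> R) (v : T2 -> R) : L2 P1 u -> L2 P2 v ->
  L2 PP (fun z => u z.1 * v z.2).
Proof.
move=> [mu_ ui] [mv vi]; split.
  by apply: measurable_funM; [exact: measurableT_comp mu_ measurable_fst
                             |exact: measurableT_comp mv measurable_snd].
by have := L1_tensor ui vi; congr L1; apply/funext => z; rewrite exprMn.
Qed.

Lemma Rintegral_sqr_tensor (u : T1 -> R) (v : T2 -> R) : L2 P1 u -> L2 P2 v ->
  \int[PP]_z (u z.1 * v z.2) ^+ 2 = \int[P1]_x u x ^+ 2 * \int[P2]_y v y ^+ 2.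
Proof.
move=> u2 v2; rewrite -(Rintegral_tensor (L2_sqr u2) (L2_sqr v2)).
by apply: Rintegral_ext => z; rewrite exprMn.
Qed.

End TwoFactors.

Section Square.
Context d (T : measurableType d) (P : probability T R).
Implicit Types f : T * T -> R.
Local Notation PP := ((P \x P)%E : probability (T * T)%type R).

Lemma ge0_integral_swap (f : T * T -> \bar R) : measurable_fun setT f ->
  (forall z, (0 <= f z)%E) -> (\int[PP]_z f (z.2, z.1) = \int[PP]_z f z)%E.
Proof.
move=> mf f0; rewrite [RHS]fubini_tonelli2// fubini_tonelli1//.
apply: measurableT_comp => //; apply/measurable_fun_pair => //=.
Qed.

Lemma measurable_swap f : measurable_fun setT f -> measurable_fun setT (fun z => f (z.2, z.1)).
Proof. by move=> mf; apply: measurableT_comp => //; apply/measurable_fun_pair. Qed.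

Lemma L1_swap f : L1 PP f -> L1 PP (fun z => f (z.2, z.1)).
Proof.
move=> fi; have mf := L1_measurable fi; apply: L1P; first exact: measurable_swap.
rewrite (ge0_integral_swap (f := fun z => `|f z|%:E)) ?L1_ltoo//.
by apply/measurable_EFinP; exact: measurableT_comp.
Qed.

Lemma L2_swap f : L2 PP f -> L2 PP (fun z => f (z.2, z.1)).
Proof.
by move=> [mf fi]; split; [exact: measurable_swap|exact: (L1_swap (f := fun z => f z ^+ 2))].
Qed.

Lemma Rintegral_swap f : L1 PP f -> \int[PP]_z f (z.2, z.1) = \int[PP]_z f z.
Proof.
move=> fi; have mf := L1_measurable fi; have fsi := L1_swap fi.
have E (h : T * T -> R) : measurable_fun setT h -> (forall z, 0 <= h z) ->
    \int[PP]_z h (z.2, z.1) = \int[PP]_z h z.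
  move=> mh h0; rewrite /Rintegral (ge0_integral_swap (f := fun z => (h z)%:E))//.
  exact/measurable_EFinP.
have mn : measurable_fun setT (fun z => `|f z|) by exact: measurableT_comp.
have s1 := Rintegral_add (L1_norm fi) fi.
have s2 := Rintegral_add (L1_norm fsi) fsi.
have h0 z : 0 <= `|f z| + f z by rewrite -lerBlDr sub0r ler_normr lexx orbT.
move: s2; rewrite (E _ (measurable_funD mn mf) h0) (E _ mn (fun z => normr_ge0 _)) s1.
by move/addrI.
Qed.

End Square.

Section TensorTilt.
Context d (T : measurableType d) (P P' : probability T R) (g : T -> R).
Hypothesis mg : measurable_fun setT g.
Hypothesis g_gt0 : {ae P, forall x, 0 < g x}.
Hypothesis Pg : forall B, measurable B -> P' B = (\int[P]_(x in B) (g x)%:E)%E.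
Local Notation PP := ((P \x P)%E : probability (T * T)%type R).

Lemma ae_prod_fst (Q : T -> Prop) : {ae P, forall x, Q x} -> {ae PP, forall z, Q z.1}.
Proof.
move=> [N [mN N0 NQ]]; exists (N `*` setT); split; first exact: measurableX.
- by rewrite [LHS]product_measure1E// [X in (X * _)%E]N0 mul0e.
- by move=> z nQ; split => //; exact: NQ.
Qed.

Lemma ae_prod_snd (Q : T -> Prop) : {ae P, forall x, Q x} -> {ae PP, forall z, Q z.2}.
Proof.
move=> [N [mN N0 NQ]]; exists (setT `*` N); split; first exact: measurableX.
- by rewrite [LHS]product_measure1E// [X in (_ * X)%E]N0 mule0.
- by move=> z nQ; split => //; exact: NQ.
Qed.

Lemma measurable_tensor : measurable_fun setT (fun z : T * T => g z.1 * g z.2).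
Proof.
by apply: measurable_funM; [exact: measurableT_comp mg measurable_fst
                           |exact: measurableT_comp mg measurable_snd].
Qed.

Lemma tensor_gt0 : {ae PP, forall z, 0 < g z.1 * g z.2}.
Proof.
by apply: filterS2 (ae_prod_fst g_gt0) (ae_prod_snd g_gt0) => z g1 g2; exact: mulr_gt0.
Qed.

(** Two independent draws from P' form a tilt of P x P, so the one-law change of measure applies
    verbatim on the product. The density is obtained by tilting one factor at a time under
    Tonelli. *)
Lemma tensor_tiltE B : measurable B ->
  (P' \x P')%E B = (\int[PP]_(z in B) (g z.1 * g z.2)%:E)%E.
Proof.
move=> mB; pose G x := Num.max (g x) 0.
have mG : measurable_fun setT G by exact: measurable_maxr.
have G0 x : 0 <= G x by rewrite /G le_max lexx orbT.
have GE : {ae P, forall x, G x = g x}.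
  by apply: filterS g_gt0 => x gx; apply/max_idPl; exact: ltW.
have PG (phi : T -> \bar R) : measurable_fun setT phi -> (forall x, 0 <= phi x)%E ->
    (\int[P']_x phi x = \int[P]_x (phi x * (G x)%:E))%E.
  move=> mphi phi0; rewrite (ge0_integral_tilt mg g_gt0 Pg)//.
  apply: ae_eq_integral => //.
  - by apply: emeasurable_funM => //; exact/measurable_EFinP.
  - by apply: emeasurable_funM => //; exact/measurable_EFinP.
  - by apply: filterS GE => x -> _.
have mBi : measurable_fun setT (fun z : T * T => (\1_B z : R)%:E).
  by apply/measurable_EFinP; exact: measurable_indic.
have B0 (z : T * T) : (0 <= (\1_B z : R)%:E)%E by rewrite lee_fin.
have mGG : measurable_fun setT (fun z : T * T => (G z.1 * G z.2)%:E).
  apply/measurable_EFinP; apply: measurable_funM.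
    exact: measurableT_comp mG measurable_fst.
  exact: measurableT_comp mG measurable_snd.
transitivity (\int[(P' \x P')%E]_z (\1_B z : R)%:E)%E.
  by rewrite integral_indic// setIT.
rewrite fubini_tonelli1// PG; last 2 first.
- exact: measurable_fun_fubini_tonelli_F.
- by move=> x; exact: integral_ge0.
transitivity (\int[PP]_z ((\1_B z)%:E * (G z.1 * G z.2)%:E))%E.
  rewrite fubini_tonelli1//; last 2 first.
  - exact: emeasurable_funM.
  - by move=> z; apply: mule_ge0 => //; rewrite lee_fin mulr_ge0.
  apply: eq_integral => x _; rewrite /fubini_F /=.
  have mBx : measurable_fun setT (fun y => (\1_B (x, y) : R)%:E).
    exact: measurableT_comp mBi (pair1_measurable x).
  rewrite PG// -ge0_integralZr//.
  - by apply: eq_integral => y _; rewrite -muleA -EFinM [G y * _]mulrC.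
  - by apply: emeasurable_funM => //; exact/measurable_EFinP.
  - by move=> y _; apply: mule_ge0; rewrite lee_fin.
  - by rewrite lee_fin.
rewrite [RHS]integral_mkcond; apply: ae_eq_integral => //.
- exact: emeasurable_funM.
- apply/(measurable_restrict _ mB measurableT) => //; rewrite setTI.
  by apply: measurable_funTS; apply/measurable_EFinP; exact: measurable_tensor.
- apply: filterS2 (ae_prod_fst GE) (ae_prod_snd GE) => z G1 G2 _.
  by rewrite patchE indicE; case: (z \in B); rewrite ?mul1e ?mul0e// G1 G2.
Qed.

End TensorTilt.

End ProductSpace.

Lemma Rintegral_distribution d d' (T : measurableType d) (U : measurableType d') (R : realType)
    (P : probability T R) (V : {mfun T >-> U}) (f : U -> R) : measurable_fun setT f ->
  \int[distribution P V]_y f y = \int[P]_x f (V x).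
Proof.
move=> mf; rewrite /Rintegral; congr fine.
have mfe : measurable_fun setT (EFin \o f) by exact/measurable_EFinP.
rewrite [LHS]integralE [RHS]integralE !ge0_integral_distribution//.
- by congr (_ - _)%E; apply: eq_integral => x _; rewrite /= ?funeposE ?funenegE.
- exact: measurable_funeneg.
- exact: measurable_funepos.
Qed.

(** * The parameter as an integral over two independent observations *)

Section ProductLaw.
Context (R : realType) (dL dZ : nat).
Local Notation O := (obs R dL dZ).
Local Notation AL := (@cAL R dL dZ).
Local Notation L := (@cL R dL dZ).
Local Notation A := (@cA R dL dZ).
Local Notation Y := (@cY R dL dZ).
Context (P : probability O R).
Context (pA : R -> R) (pAL : R * dL.-tuple R -> R) (q : R -> R).
Hypothesis hpA : is_density_A P pA.
Hypothesis hpAL : is_cond_density_AL P pAL.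
Hypothesis hpos : positivity P pAL.
Hypothesis hq : measurable_fun [set: R] q.
Hypothesis hN : supp_q P q `<=` (supp_A P)°.
Local Notation N := (supp_q P q).
Local Notation k := (moment_weight pA pAL q).
Local Notation PP := ((P \x P)%E : probability (O * O)%type R).

(** Under P x P the treatment of one observation is independent of the covariates of the other, so
    this pair has the product of the two marginals as its law. *)
Definition cross (z : O * O) : R * dL.-tuple R := (A z.1, L z.2).

Lemma measurable_cross : measurable_fun setT cross.
Proof.
apply/measurable_fun_pair.
  exact: measurableT_comp (@measurable_cA R dL dZ) measurable_fst.
exact: measurableT_comp (@measurable_cL R dL dZ) measurable_snd.
Qed.

Lemma measurable_comp_cross (u : R * dL.-tuple R -> R) : measurable_fun setT u ->
  measurable_fun setT (fun z => u (cross z)).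
Proof. by move=> mu_; exact: measurableT_comp mu_ measurable_cross. Qed.

(* The integrand of [psi] for [u = mu]: restricting to the support of A amounts to restricting
   to [N] because of the factor [q], and off [N] the quotient [mu] is not controlled. *)
Definition cut (u : R * dL.-tuple R -> R) (al : R * dL.-tuple R) : R :=
  \1_N al.1 * q al.1 * u al.

Lemma cutB u v al : cut (fun al => u al - v al) al = cut u al - cut v al.
Proof. by rewrite /cut mulrBr. Qed.

Lemma measurable_cut u : measurable_fun setT u -> measurable_fun setT (cut u).
Proof.
move=> mu_; apply: measurable_funM => //; apply: measurable_funM.
  apply: (measurableT_comp (f := \1_N : R -> R)) measurable_fst.
  by apply: measurable_indic; exact: measurable_supp_q.
exact: measurableT_comp hq measurable_fst.
Qed.

Lemma cut_off u a l : ~ N a -> cut u (a, l) = 0.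
Proof. by move=> nNa; rewrite /cut /= indicE memNset// !mul0r. Qed.

Lemma cut_in u a l : N a -> cut u (a, l) = q a * u (a, l).
Proof. by move=> Na; rewrite /cut /= indicE mem_set// mul1r. Qed.

Lemma cut_ae u : {ae P, forall o, cut u (AL o) = q (A o) * u (AL o)}.
Proof.
apply: filterS (ae_supp_q P q) => o Nq.
have [q0|/Nq Na] := eqVneq (q (A o)) 0; first by rewrite /cut /= q0 mulr0 !mul0r.
exact: cut_in.
Qed.

Lemma ge0_integral_cross (phi : R * dL.-tuple R -> \bar R) :
  measurable_fun setT phi -> (forall al, 0 <= phi al)%E ->
  (forall a l, ~ N a -> phi (a, l) = 0%E) ->
  (\int[PP]_z phi (cross z) = \int[P]_o (phi (AL o) * (delta pA pAL (AL o))%:E))%E.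
Proof.
move=> mphi phi0 phiN.
rewrite -(ge0_integral_product hpA hpAL hpos hN)// fubini_tonelli1//; last first.
  exact: measurableT_comp mphi measurable_cross.
transitivity (\int[P]_o \int[law_L P]_l phi (A o, l))%E.
  apply: eq_integral => o _; rewrite /fubini_F /cross /=.
  rewrite ge0_integral_distribution//.
  exact: measurableT_comp mphi (pair1_measurable _).
rewrite (@ge0_integral_distribution _ _ _ _ _ P A (fun a => \int[law_L P]_l phi (a, l))%E)//.
- exact: (measurable_fun_fubini_tonelli_F (m2 := law_L P)).
- by move=> a; exact: integral_ge0.
Qed.

Lemma delta_le_sqr (al : R * dL.-tuple R) : delta pA pAL al <= 1 + delta pA pAL al ^+ 2.
Proof. by have := sqr_ge0 (delta pA pAL al - 1); have := sqr_ge0 (delta pA pAL al); nra. Qed.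

(** The product law weights [q ^ 2 * u ^ 2] by delta, and [delta <= 1 + delta ^ 2]. Norms on the
    product space are therefore bounded by norms with weight [k] under P, which carries convergence
    of mu' over. *)
Lemma L2_cut u : measurable_fun setT u -> L2 P (fun o => k (AL o) * u (AL o)) ->
  L2 PP (fun z => cut u (cross z)) /\
  \int[PP]_z cut u (cross z) ^+ 2 <= \int[P]_o (k (AL o) * u (AL o)) ^+ 2.
Proof.
move=> mu_ ku; have mc := measurable_cut mu_.
have mcc := measurable_comp_cross mc.
have le_E : (\int[PP]_z (cut u (cross z) ^+ 2)%:E <= \int[P]_o ((k (AL o) * u (AL o)) ^+ 2)%:E)%E.
  rewrite (ge0_integral_cross (phi := fun al => (cut u al ^+ 2)%:E)).
  - apply: ae_ge0_le_integral => //.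
    + move=> o _; apply: mule_ge0; first by rewrite lee_fin sqr_ge0.
      by rewrite lee_fin; exact: (delta_ge0 hpA hpAL).
    + apply: emeasurable_funM; apply/measurable_EFinP.
        by apply: measurable_funX; exact: measurable_comp_mfun.
      exact: measurable_comp_mfun (measurable_delta hpA hpAL).
    + by move=> o _; rewrite lee_fin sqr_ge0.
    + by apply/measurable_EFinP; apply: measurable_funX; exact: L2_measurable ku.
    + apply: filterS (cut_ae u) => o cE _; rewrite cE -EFinM lee_fin.
      rewrite exprMn [leRHS]exprMn sqr_moment_weight mulrAC ler_wpM2r ?sqr_ge0//.
      by rewrite mulrC ler_wpM2r ?sqr_ge0// delta_le_sqr.
  - by apply/measurable_EFinP; exact: measurable_funX.
  - by move=> al; rewrite lee_fin sqr_ge0.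
  - by move=> a l Na; rewrite cut_off// expr0n.
have ku2 := L2_sqr ku.
have c2 : L1 PP (fun z => cut u (cross z) ^+ 2).
  apply: L1P; first exact: measurable_funX.
  under eq_integral do rewrite ger0_norm ?sqr_ge0//.
  by apply: le_lt_trans le_E _; rewrite (integralE_L1 ku2) ltry.
split; first by split.
by rewrite -lee_fin -(integralE_L1 c2) -(integralE_L1 ku2).
Qed.

Lemma Rintegral_cut u : measurable_fun setT u -> L2 P (fun o => k (AL o) * u (AL o)) ->
  \int[PP]_z cut u (cross z) = \int[P]_o (q (A o) * delta pA pAL (AL o) * u (AL o)).
Proof.
move=> mu_ ku; have mc := measurable_cut mu_; have [c2 _] := L2_cut mu_ ku.
have md := measurable_delta hpA hpAL.
have ci := L2_L1 c2.
have E (h : R * dL.-tuple R -> R) : measurable_fun setT h -> (forall al, 0 <= h al) ->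
    (forall a l, ~ N a -> h (a, l) = 0) ->
    \int[PP]_z h (cross z) = \int[P]_o (h (AL o) * delta pA pAL (AL o)).
  move=> mh h0 hN'; rewrite /Rintegral (ge0_integral_cross (phi := EFin \o h))//.
  - exact/measurable_EFinP.
  - by move=> a l Na /=; rewrite hN'.
have h0 al : 0 <= `|cut u al| + cut u al by rewrite -lerBlDr sub0r ler_normr lexx orbT.
have mn : measurable_fun setT (fun al => `|cut u al|) by exact: measurableT_comp.
have qdu2 : L2 P (fun o => q (A o) * delta pA pAL (AL o) * u (AL o)).
  apply: (L2_le_ae (C := 1)) ku _.
    apply: measurable_funM; last exact: measurable_comp_mfun.
    apply: measurable_funM; last exact: measurable_comp_mfun.
    exact: measurableT_comp hq (@measurable_cA R dL dZ).
  apply: aeW => o; rewrite mul1r [leLHS]normrM [leRHS]normrM ler_wpM2r//.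
  exact: qdelta_le_moment_weight.
have cdE : {ae P, forall o, q (A o) * delta pA pAL (AL o) * u (AL o) =
    cut u (AL o) * delta pA pAL (AL o)}.
  by apply: filterS (cut_ae u) => o ->; ring.
have mcd : measurable_fun setT (fun o => cut u (AL o) * delta pA pAL (AL o)).
  by apply: measurable_funM; exact: measurable_comp_mfun.
have cd2 : L2 P (fun o => cut u (AL o) * delta pA pAL (AL o)).
  apply: (L2_le_ae (C := 1) mcd qdu2).
  by apply: filterS cdE => o ->; rewrite mul1r.
have cdi := L2_L1 cd2.
have acdE o : `|cut u (AL o) * delta pA pAL (AL o)| = `|cut u (AL o)| * delta pA pAL (AL o).
  by rewrite normrM (ger0_norm (delta_ge0 hpA hpAL _)).
have s1 := Rintegral_add (L1_norm ci) ci.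
have s2 := Rintegral_add (L1_norm cdi) cdi.
rewrite (eq_Rintegral_ae (L2_measurable qdu2) mcd cdE).
move: s1; rewrite (E _ (measurable_funD mn mc) h0); last first.
  by move=> a l Na; rewrite /= cut_off// normr0 addr0.
rewrite (E _ mn (fun al => normr_ge0 _)); last by move=> a l Na; rewrite cut_off// normr0.
under [X in X = _ -> _]eq_Rintegral do rewrite mulrDl.
under [X in X = _ -> _]eq_Rintegral do rewrite -acdE.
rewrite s2; under [X in _ = X + _ -> _]eq_Rintegral do rewrite -acdE.
by move=> /addrI.
Qed.

(** The densities describe P alone; this form of [psi] refers only to P', so it applies to every
    [Pt t]. The treatment support stays that of P, as in the definition of the parameter. *)
Lemma psiE (P' : probability O R) w :
  L1 ((P' \x P')%E : probability (O * O)%type R) (fun z => cut (mu P' w) (cross z)) ->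
  psi (supp_A P) q w P' = \int[(P' \x P')%E]_z cut (mu P' w) (cross z).
Proof.
move=> ci; have mm := measurable_mu P' w.
have mc := measurable_cut mm.
have mF : measurable_fun setT (fun a => \int[law_L P']_l mu P' w (a, l)).
  exact: measurable_partial_integral mm.
have mS := measurable_law_support (law_A P).
rewrite /psi Rintegral_mkcond.
have mG : measurable_fun setT
    ((fun a => (\int[law_L P']_l mu P' w (a, l)) * q a) \_ (supp_A P)).
  apply/(measurable_restrict _ mS measurableT) => //; rewrite setTI.
  by apply: measurable_funTS; exact: measurable_funM.
rewrite Rintegral_distribution// (fubini_Rintegral ci).
apply: eq_Rintegral_ae.
- exact: measurable_comp_mfun mG.
- exact: measurable_partial_integral (measurable_comp_cross mc).
- apply: filterS (ae_L1_section ci) => o ci_o.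
  have [Na|Na] := pselect (N (A o)); last first.
    rewrite (@Rintegral_ext _ _ _ _ _ (fun=> 0)) ?Rintegral_prob_cst; last first.
      by move=> o'; rewrite /cross /= cut_off.
    rewrite patchE; case: ifPn => // /set_mem So.
    by have [->|q0] := eqVneq (q (A o)) 0; rewrite ?mulr0//; case: Na; split.
  rewrite patchE mem_set; last by case: Na.
  have q0 : q (A o) != 0 by case: Na.
  rewrite Rintegral_distribution; last exact: measurable_section1.
  rewrite mulrC -RintegralZl//.
    by apply: Rintegral_ext => o'; rewrite /cross /= cut_in.
  have := L1Z (q (A o))^-1 ci_o; congr L1; apply/funext => o'.
  by rewrite /cross /= cut_in// mulKf.
Qed.

End ProductLaw.

(** * The four terms of the influence function: moments, means and inner products *)

Section EifPieces.
Context (R : realType) (dL dZ : nat).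
Local Notation O := (obs R dL dZ).
Local Notation AL := (@cAL R dL dZ).
Local Notation L := (@cL R dL dZ).
Local Notation A := (@cA R dL dZ).
Local Notation Y := (@cY R dL dZ).
Context (P : probability O R).
Context (pA : R -> R) (pAL : R * dL.-tuple R -> R) (q : R -> R).
Context (w : dZ.-tuple R * dL.-tuple R -> R) (M e : R) (h : R * dL.-tuple R -> R).
Hypothesis hpA : is_density_A P pA.
Hypothesis hpAL : is_cond_density_AL P pAL.
Hypothesis hpos : positivity P pAL.
Hypothesis hq : measurable_fun [set: R] q.
Hypothesis hN : supp_q P q `<=` (supp_A P)°.
Hypothesis mw : measurable_fun setT w.
Hypothesis wM : forall zl, `|w zl| <= M.
Hypothesis e_gt0 : 0 < e.
Hypothesis tilt : regular_tilt q w e h P P (fun=> 1).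
Local Notation N := (supp_q P q).
Local Notation k := (moment_weight pA pAL q).
Local Notation PP := ((P \x P)%E : probability (O * O)%type R).
Local Notation cut := (cut P q).
Hypothesis kY : L2 P (fun o => k (AL o) * Y o).
Hypothesis kh : L2 P (fun o => k (AL o) * h (AL o)).

Let mk : measurable_fun setT k := measurable_moment_weight hpA hpAL hq.
Let k0 a l : q a = 0 -> k (a, l) = 0 := @moment_weight0 R dL pA pAL q a l.

Lemma partial_cut_snd (u : R * dL.-tuple R -> R) : measurable_fun setT u ->
  L1 PP (fun z => cut u (cross z)) ->
  {ae P, forall o, q (A o) * \int[law_L P]_l u (A o, l) = \int[P]_o' cut u (cross (o, o'))}.
Proof.
move=> mu_ ci; apply: filterS2 (ae_L1_section ci) (ae_supp_q P q) => o ci_o Nq.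
have [q0|q0] := eqVneq (q (A o)) 0.
  rewrite q0 mul0r (@Rintegral_ext _ _ _ _ _ (fun=> 0)) ?Rintegral_prob_cst// => o'.
  by rewrite /cross cut_off// => -[_]; rewrite q0 eqxx.
have Na := Nq q0.
rewrite Rintegral_distribution; last exact: measurable_section1.
rewrite -RintegralZl//.
  by apply: Rintegral_ext => o'; rewrite /cross /= cut_in.
have := L1Z (q (A o))^-1 ci_o; congr L1; apply/funext => o'.
by rewrite /cross /= cut_in// mulKf.
Qed.

(** Here [q a] stays inside the integral, so the identity holds for every [l], whereas
    [partial_cut_snd] pulls it out and holds almost everywhere. *)
Lemma partial_cut_fst (u : R * dL.-tuple R -> R) l : measurable_fun setT u ->
  \int[law_A P]_(a in supp_A P) (u (a, l) * q a) = \int[P]_o cut u (A o, l).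
Proof.
move=> mu_; rewrite Rintegral_mkcond.
rewrite -(Rintegral_distribution P A (f := fun a => cut u (a, l))); last first.
  by apply: measurable_section2; exact: measurable_cut.
apply: Rintegral_ext => a; rewrite patchE; case: ifPn => [/set_mem Sa|/negP nSa].
  have [q0|q0] := eqVneq (q a) 0; last by rewrite cut_in 1?mulrC.
  by rewrite q0 mulr0 cut_off// => -[_]; rewrite q0 eqxx.
by rewrite cut_off// => -[Sa _]; apply: nSa; exact: mem_set.
Qed.

Lemma L2_k_mu : L2 P (fun o => k (AL o) * mu P w (AL o)).
Proof. exact (L2_muM hpAL hq mw wM e_gt0 tilt mk k0 kh). Qed.

Lemma L2_k_eta : L2 P (fun o => k (AL o) * eta P (AL o)).
Proof.
apply: (L2_le_ae (C := 1)) kh _.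
  by apply: measurable_funM; [exact: (measurable_comp_mfun AL mk)
                             |exact: (measurable_comp_mfun AL (measurable_eta P))].
apply: filterS2 (eta_bounded tilt) (h_ge0 tilt) => o eh h0.
by rewrite mul1r (normrM (k _)) (normrM (k _) (h _)) (ger0_norm h0) ler_wpM2l.
Qed.

(** Minus the derivative of mu in the value of rho when the conditional means given (A, L) are
    frozen. It is also the conditional mean of [(Y - mu) / kappa] given (A, L). *)
Definition residual_slope (al : R * dL.-tuple R) : R :=
  (eta P al - mu P w al) / kappa P w al.

Lemma measurable_residual_slope : measurable_fun setT residual_slope.
Proof.
apply: measurable_funM; last exact: measurable_fun_inv (measurable_kappa P w).
by apply: measurable_funB; [exact: measurable_eta|exact: measurable_mu].
Qed.

Let mv := measurable_residual_slope.

Lemma L2_k_slope : L2 P (fun o => k (AL o) * residual_slope (AL o)).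
Proof.
have k2 := L2B L2_k_eta L2_k_mu.
apply: (L2_le_ae (C := e^-1)) k2 _.
  by apply: measurable_funM; [exact: (measurable_comp_mfun AL mk)
                             |exact: (measurable_comp_mfun AL mv)].
apply: filterS (kappa_ge hpAL hq mw wM tilt) => o ke.
have [q0|q0] := eqVneq (q (A o)) 0.
  by rewrite k0// !mul0r subrr normr0 mulr0.
rewrite -mulrBr (normrM (k _)) (normrM (k _) (_ - _)) /residual_slope (normrM (_ - _)) normfV.
rewrite [leRHS]mulrCA ler_wpM2l// mulrC ler_wpM2r//.
by rewrite lef_pV2 ?posrE ?ke// (lt_le_trans e_gt0)// ke.
Qed.

Definition eif_K (l : dL.-tuple R) : R :=
  \int[law_A P]_(a in supp_A P) (residual_slope (a, l) * q a).

Lemma eif_KE l : eif_K l = \int[P]_o cut residual_slope (A o, l).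
Proof. exact: partial_cut_fst. Qed.

Lemma measurable_partial_cut (u : R * dL.-tuple R -> R) : measurable_fun setT u ->
  measurable_fun setT (fun l => \int[P]_o cut u (A o, l)).
Proof.
move=> mu_; have mc := measurable_cut P hq mu_.
apply: (@measurable_partial_integral R _ _ (dL.-tuple R) O P (fun z => cut u (A z.2, z.1))).
apply: measurableT_comp => //; apply/measurable_fun_pair => //.
exact: measurableT_comp (@measurable_cA R dL dZ) measurable_snd.
Qed.

Lemma measurable_eif_K : measurable_fun setT eif_K.
Proof.
rewrite (_ : eif_K = fun l => \int[P]_o cut residual_slope (A o, l)).
  exact: measurable_partial_cut.
by apply/funext => l; exact: eif_KE.
Qed.

Lemma L2_partial_cut (u : R * dL.-tuple R -> R) : measurable_fun setT u ->
  L2 P (fun o => k (AL o) * u (AL o)) ->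
  L2 P (fun o => \int[P]_o' cut u (A o', L o)).
Proof.
move=> mu_ ku; have [c2 _] := L2_cut hpA hpAL hpos hq hN mu_ ku.
exact: (L2_partial_integral (L2_swap c2)).
Qed.

Lemma L2_eif_K : L2 P (fun o => eif_K (L o)).
Proof.
have := L2_partial_cut mv L2_k_slope.
by congr L2; apply/funext => o; rewrite eif_KE.
Qed.

Local Notation W := (fun al => q al.1 * delta pA pAL al / kappa P w al).

Let mW : measurable_fun setT W := measurable_eif_weight w hpA hpAL hq.

(** Conditioning on (A, L) replaces Y by [eta]; the factor delta then turns the joint law of (A, L)
    into the product of its marginals, and Fubini integrates the treatment out. *)
Lemma eif_K_test (f : dL.-tuple R -> R) (C : R) : measurable_fun setT f ->
  {ae P, forall o, `|f (L o)| <= C} ->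
  \int[P]_o (W (AL o) * (Y o - mu P w (AL o)) * f (L o)) = \int[P]_o (eif_K (L o) * f (L o)).
Proof.
move=> mf fC; have mfL := measurable_comp_mfun L mf.
have W0 a l : q a = 0 -> W (a, l) = 0 by move=> /= ->; rewrite !mul0r.
have L2W X : measurable_fun setT X -> L2 P (fun o => k (AL o) * X o) ->
    L2 P (fun o => W (AL o) * X o).
  exact: (L2_eif_weightM hpA hpAL hq mw wM e_gt0 tilt).
have meta := measurable_comp_mfun AL (measurable_eta P).
have mmu := measurable_comp_mfun AL (measurable_mu P w).
have WY := L2W _ (@measurable_cY R dL dZ) kY.
have We := L2W _ meta L2_k_eta.
have Wm := L2W _ mmu L2_k_mu.
have Mf (u : O -> R) : L2 P u -> L2 P (fun o => u o * f (L o)).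
  move=> u2; have := L2M_bounded mfL fC u2.
  by congr L2; apply/funext => o; rewrite mulrC.
have mWf : measurable_fun setT (fun al : R * dL.-tuple R => W al * f al.2).
  by apply: measurable_funM => //; exact: measurableT_comp mf measurable_snd.
have WYf : L2 P (fun o => W (AL o) * f (L o) * Y o).
  by have := Mf _ WY; congr L2; apply/funext => o; ring.
have Wef : L2 P (fun o => W (AL o) * f (L o) * eta P (AL o)).
  by have := Mf _ We; congr L2; apply/funext => o; ring.
have Wmf : L2 P (fun o => W (AL o) * f (L o) * mu P w (AL o)).
  by have := Mf _ Wm; congr L2; apply/funext => o; ring.
have E1 : \int[P]_o (W (AL o) * f (L o) * Y o) = \int[P]_o (W (AL o) * f (L o) * eta P (AL o)).
  exact: (cond_exp_test (cond_expP AL (tilt_Y tilt)) mWf (L2_L1 WYf) (L2_L1 Wef)).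
transitivity (\int[P]_o (W (AL o) * f (L o) * Y o - W (AL o) * f (L o) * mu P w (AL o))).
  by apply: Rintegral_ext => o; ring.
rewrite RintegralB ?E1 -?RintegralB//; [|exact: L2_L1..].
pose v (al : R * dL.-tuple R) := residual_slope al * f al.2.
have mvf : measurable_fun setT v.
  by apply: measurable_funM => //; exact: measurableT_comp mf measurable_snd.
have kv : L2 P (fun o => k (AL o) * v (AL o)).
  by have := Mf _ L2_k_slope; congr L2; apply/funext => o; rewrite /v mulrA.
have [c2 _] := L2_cut hpA hpAL hpos hq hN mvf kv.
transitivity (\int[PP]_z cut v (cross z)).
  rewrite (Rintegral_cut hpA hpAL hpos hq hN mvf kv).
  by apply: Rintegral_ext => o; rewrite /v /residual_slope /=; ring.
rewrite -(Rintegral_swap (L2_L1 c2)) (fubini_Rintegral (L1_swap (L2_L1 c2))).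
apply: eq_Rintegral_ae.
- exact (measurable_partial_integral P (L2_measurable (L2_swap c2))).
- by apply: measurable_funM => //; exact: measurable_comp_mfun measurable_eif_K.
- have [s2 _] := L2_cut hpA hpAL hpos hq hN mv L2_k_slope.
  apply: filterS (ae_L1_section (L1_swap (L2_L1 s2))) => o si.
  rewrite eif_KE -RintegralZr//.
  by apply: Rintegral_ext => o'; rewrite /cross /cut /v /=; ring.
Qed.

(** The identity is almost sure because its third term needs an integrable section and a treatment
    value in the support. *)
Lemma eifE : {ae P, forall o, eif P pA pAL q w o =
  W (AL o) * (Y o - mu P w (AL o)) * (Zpi w o - rho P w (L o)) -
  eif_K (L o) * (Zpi w o - rho P w (L o)) +
  \int[P]_o' cut (mu P w) (cross (o, o')) + \int[P]_o' cut (mu P w) (cross (o', o)) -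
  2 * psi (supp_A P) q w P}.
Proof.
have mm := measurable_mu P w.
have [c2 _] := L2_cut hpA hpAL hpos hq hN mm L2_k_mu.
apply: filterS (partial_cut_snd mm (L2_L1 c2)) => o Fo.
rewrite /eif -Fo /cross -(partial_cut_fst _ mm) -/(eif_K (cL o)).
by ring.
Qed.

Lemma measurable_eif : measurable_fun setT (eif P pA pAL q w).
Proof.
have mm := measurable_mu P w.
have mZr : measurable_fun setT (fun o => Zpi w o - rho P w (L o)).
  by apply: measurable_funB; [exact: measurable_Zpi|
    exact: (measurable_comp_mfun L (measurable_rho P w))].
apply: measurable_funB => //.
apply: measurable_funD; [apply: measurable_funD; [apply: measurable_funB|]|].
- apply: measurable_funM; last exact: measurableT_comp hq (@measurable_cA R dL dZ).
  apply: measurable_funM.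
    by apply: measurable_funM => //; exact: (measurable_comp_mfun AL (measurable_delta hpA hpAL)).
  apply: measurable_funM.
    by apply: measurable_funB; [exact: measurable_cY|exact: (measurable_comp_mfun AL mm)].
  exact: (measurable_comp_mfun AL (measurable_fun_inv (measurable_kappa P w))).
- by apply: measurable_funM => //; exact: (measurable_comp_mfun L measurable_eif_K).
- apply: measurable_funM; first exact: measurableT_comp hq (@measurable_cA R dL dZ).
  apply: (measurable_comp_mfun A (g := fun a => \int[law_L P]_l mu P w (a, l))).
  exact: measurable_partial_integral mm.
- rewrite (_ : (fun o => _) = fun o => \int[P]_o' cut (mu P w) (A o', L o)).
    exact: (measurable_comp_mfun L (measurable_partial_cut mm)).
  by apply/funext => o; exact: partial_cut_fst.
Qed.

Let Zr : measurable_fun setT (fun o => Zpi w o - rho P w (L o)).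
Proof.
by apply: measurable_funB; [exact: measurable_Zpi|
    exact: (measurable_comp_mfun L (measurable_rho P w))].
Qed.

Let L2_Zr u : L2 P u -> L2 P (fun o => u o * (Zpi w o - rho P w (L o))).
Proof.
move=> u2; have := L2M_bounded Zr (residual_bounded mw wM tilt) u2.
by congr L2; apply/funext => o; rewrite mulrC.
Qed.

Lemma L2_eif_term1 : L2 P (fun o => W (AL o) * (Y o - mu P w (AL o)) * (Zpi w o - rho P w (L o))).
Proof. by apply: L2_Zr; exact: (L2_eif_residual hpA hpAL hq mw wM e_gt0 tilt kY kh). Qed.

Lemma L2_eif_term2 : L2 P (fun o => eif_K (L o) * (Zpi w o - rho P w (L o))).
Proof. exact: L2_Zr L2_eif_K. Qed.

Let c2 : L2 PP (fun z => cut (mu P w) (cross z)).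
Proof. by have [] := L2_cut hpA hpAL hpos hq hN (measurable_mu P w) L2_k_mu. Qed.

Lemma L2_eif_term3 : L2 P (fun o => \int[P]_o' cut (mu P w) (cross (o, o'))).
Proof. exact: L2_partial_integral c2. Qed.

Lemma L2_eif_term4 : L2 P (fun o => \int[P]_o' cut (mu P w) (cross (o', o))).
Proof. exact: (L2_partial_integral (L2_swap c2)). Qed.

Let L2_eif_sum : L2 P (fun o =>
  W (AL o) * (Y o - mu P w (AL o)) * (Zpi w o - rho P w (L o)) -
  eif_K (L o) * (Zpi w o - rho P w (L o)) +
  \int[P]_o' cut (mu P w) (cross (o, o')) + \int[P]_o' cut (mu P w) (cross (o', o)) -
  2 * psi (supp_A P) q w P).
Proof.
apply: L2B; last exact: L2_cst.
apply: L2D; last exact: L2_eif_term4.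
apply: L2D; last exact: L2_eif_term3.
by apply: L2B; [exact: L2_eif_term1|exact: L2_eif_term2].
Qed.

Lemma L2_eif : L2 P (eif P pA pAL q w).
Proof.
apply: (L2_le_ae (C := 1) measurable_eif L2_eif_sum).
by apply: filterS eifE => o ->; rewrite mul1r.
Qed.

(** The right side is shaped like the limit of the difference quotient: the last two terms return to
    P x P, and the factors [1] match the tensors of the score. The constant disappears because [s]
    has mean 0. *)
Lemma eif_inner (s : O -> R) : L2 P s -> \int[P]_o s o = 0 ->
  \int[P]_o (eif P pA pAL q w o * s o) =
  (\int[P]_o (s o * (W (AL o) * (Y o - mu P w (AL o)) * (Zpi w o - rho P w (L o)))) -
   \int[P]_o (s o * (eif_K (L o) * (Zpi w o - rho P w (L o))))) +
  \int[PP]_z (cut (mu P w) (cross z) * (s z.1 * 1)) +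
  \int[PP]_z (cut (mu P w) (cross z) * (1 * s z.2)).
Proof.
move=> s2 s0.
have t3 : \int[PP]_z (cut (mu P w) (cross z) * (s z.1 * 1)) =
    \int[P]_o (s o * \int[P]_o' cut (mu P w) (cross (o, o'))).
  have i := L2M c2 (L2_tensor s2 (L2_cst P 1)).
  rewrite (fubini_Rintegral i); apply: eq_Rintegral_ae.
  - exact: measurable_partial_integral (L1_measurable i).
  - exact: L1_measurable (L2M s2 L2_eif_term3).
  - apply: filterS (ae_L1_section (L2_L1 c2)) => o ci.
    by rewrite -RintegralZl//; apply: Rintegral_ext => o' /=; ring.
have t4 : \int[PP]_z (cut (mu P w) (cross z) * (1 * s z.2)) =
    \int[P]_o (s o * \int[P]_o' cut (mu P w) (cross (o', o))).
  have i := L2M c2 (L2_tensor (L2_cst P 1) s2).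
  rewrite -(Rintegral_swap i) (fubini_Rintegral (L1_swap i)); apply: eq_Rintegral_ae.
  - exact: measurable_partial_integral (L1_measurable (L1_swap i)).
  - exact: L1_measurable (L2M s2 L2_eif_term4).
  - apply: filterS (ae_L1_section (L1_swap (L2_L1 c2))) => o ci.
    by rewrite -RintegralZl//; apply: Rintegral_ext => o' /=; ring.
have j1 := L2M s2 L2_eif_term1; have j2 := L2M s2 L2_eif_term2.
have j3 := L2M s2 L2_eif_term3; have j4 := L2M s2 L2_eif_term4.
have j5 := L1Z (2 * psi (supp_A P) q w P) (L2_L1 s2).
rewrite t3 t4; transitivity (\int[P]_o (
   s o * (W (AL o) * (Y o - mu P w (AL o)) * (Zpi w o - rho P w (L o))) -
   s o * (eif_K (L o) * (Zpi w o - rho P w (L o))) +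
   s o * \int[P]_o' cut (mu P w) (cross (o, o')) +
   s o * \int[P]_o' cut (mu P w) (cross (o', o)) -
   2 * psi (supp_A P) q w P * s o)).
  apply: eq_Rintegral_ae.
  - exact: L1_measurable (L2M L2_eif s2).
  - by apply: L1_measurable (L1B (L1D (L1D (L1B j1 j2) j3) j4) j5).
  - by apply: filterS eifE => o ->; ring.
rewrite RintegralB//; last exact: L1D (L1D (L1B j1 j2) j3) j4.
rewrite Rintegral_add//; last exact: L1D (L1B j1 j2) j3.
rewrite Rintegral_add//; last exact: L1B.
by rewrite RintegralB// RintegralZl ?s0 ?mulr0 ?subr0//; exact: L2_L1.
Qed.

(** The residual terms vanish by the moment equations at P. The other two terms each integrate to
    [psi], which accounts for the coefficient 2 in front of it. *)
Lemma eif_mean0 : \int[P]_o eif P pA pAL q w o = 0.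
Proof.
have W0 a l : q a = 0 -> W (a, l) = 0 by move=> /= ->; rewrite !mul0r.
have mm := measurable_mu P w.
have L2W X : measurable_fun setT X -> L2 P (fun o => k (AL o) * X o) ->
    L2 P (fun o => W (AL o) * X o).
  exact: (L2_eif_weightM hpA hpAL hq mw wM e_gt0 tilt).
have Wh := L2W _ (measurable_comp_mfun AL (tilt_bound_measurable tilt)) kh.
have WY := L2W _ (@measurable_cY R dL dZ) kY.
have t1 : \int[P]_o (W (AL o) * (Y o - mu P w (AL o)) * (Zpi w o - rho P w (L o))) = 0.
  rewrite -[RHS](score_eq_mu hpAL hq mw wM e_gt0 tilt mW W0 WY Wh).
  by apply: Rintegral_ext => o; rewrite mul1r mulrA.
have t2 : \int[P]_o (eif_K (L o) * (Zpi w o - rho P w (L o))) = 0.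
  rewrite -[RHS](score_eq_rho mw wM tilt measurable_eif_K L2_eif_K).
  by apply: Rintegral_ext => o; rewrite mul1r.
have pE : psi (supp_A P) q w P = \int[PP]_z cut (mu P w) (cross z).
  exact: (psiE hq (L2_L1 c2)).
have t3 : \int[P]_o \int[P]_o' cut (mu P w) (cross (o, o')) = psi (supp_A P) q w P.
  by rewrite pE (fubini_Rintegral (L2_L1 c2)).
have t4 : \int[P]_o \int[P]_o' cut (mu P w) (cross (o', o)) = psi (supp_A P) q w P.
  by rewrite pE -(Rintegral_swap (L2_L1 c2)) (fubini_Rintegral (L1_swap (L2_L1 c2))).
rewrite (eq_Rintegral_ae measurable_eif (L2_measurable L2_eif_sum) eifE).
have j1 := L2_L1 L2_eif_term1; have j2 := L2_L1 L2_eif_term2.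
have j3 := L2_L1 L2_eif_term3; have j4 := L2_L1 L2_eif_term4.
rewrite RintegralB//; [|exact: L1D (L1D (L1B j1 j2) j3) j4|exact: L1_cst].
rewrite Rintegral_add//; last exact: L1D (L1B j1 j2) j3.
rewrite Rintegral_add//; last exact: L1B.
by rewrite RintegralB// t1 t2 t3 t4 Rintegral_prob_cst; ring.
Qed.

End EifPieces.

(** * L^2 limits of tensors on the product space *)

Section TensorLimits.
Context d (T : measurableType d) (R : realType) (P : probability T R).
Context (I : Type) (F : set_system I) {FF : ProperFilter F}.
Local Notation PP := ((P \x P)%E : probability (T * T)%type R).

Lemma L2cvg_tensor_fst (u : I -> T -> R) (f : T -> R) : L2cvg P F u f ->
  L2cvg PP F (fun i z => u i z.1 * 1) (fun z => f z.1 * 1).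
Proof.
move=> [u2 f2 uf]; split.
- by apply: filterS u2 => i ui2; exact: L2_tensor ui2 (L2_cst P 1).
- exact: L2_tensor f2 (L2_cst P 1).
- apply: cvg_near_eq uf; near=> i.
  have ui2 : L2 P (u i) by near: i.
  have := Rintegral_sqr_tensor (L2B ui2 f2) (L2_cst P 1).
  rewrite expr1n Rintegral_prob_cst mulr1 => <-.
  by apply: Rintegral_ext => z; rewrite mulrBl.
Unshelve. all: by end_near. Qed.

Lemma L2cvg_tensor_snd (u : I -> T -> R) (f : T -> R) : L2cvg P F u f ->
  L2cvg PP F (fun i z => 1 * u i z.2) (fun z => 1 * f z.2).
Proof.
move=> [u2 f2 uf]; split.
- by apply: filterS u2 => i ui2; exact: L2_tensor (L2_cst P 1) ui2.
- exact: L2_tensor (L2_cst P 1) f2.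
- apply: cvg_near_eq uf; near=> i.
  have ui2 : L2 P (u i) by near: i.
  have := Rintegral_sqr_tensor (L2_cst P 1) (L2B ui2 f2).
  rewrite expr1n Rintegral_prob_cst mul1r => <-.
  by apply: Rintegral_ext => z; rewrite mulrBr.
Unshelve. all: by end_near. Qed.

(** Meant for [c t = t]: it disposes of the second-order term in the expansion of the product
    density [g(o) g(o')]. *)
Lemma L2cvg_tensor_vanishing (c : I -> R) (u : I -> T -> R) (f : T -> R) :
  c @ F --> (0 : R) -> L2cvg P F u f ->
  L2cvg PP F (fun i z => c i * (u i z.1 * u i z.2)) (fun=> 0).
Proof.
move=> c0 uf; have [u2 f2 _] := uf; split.
- by apply: filterS u2 => i ui2; apply: L2Z; exact: L2_tensor.
- exact: L2_cst.
- have lim : (fun i => c i * c i * (\int[P]_x u i x ^+ 2 * \int[P]_x u i x ^+ 2)) @ F -->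
      0 * 0 * (\int[P]_x f x ^+ 2 * \int[P]_x f x ^+ 2).
    apply: cvgM; first by apply: cvgM.
    by apply: cvgM; exact: cvg_L2_norm.
  rewrite mul0r mul0r in lim; apply: cvg_near_eq lim; near=> i.
  have ui2 : L2 P (u i) by near: i.
  rewrite Rintegral_sqr_subr0 -(Rintegral_sqr_tensor ui2 ui2) -RintegralZl//.
    by apply: Rintegral_ext => z; ring.
  exact: L2_sqr (L2_tensor ui2 ui2).
Unshelve. all: by end_near. Qed.

End TensorLimits.

(** * The pathwise derivative of the parameter *)

Section PathwiseDerivative.
Context (R : realType) (dL dZ : nat).
Local Notation O := (obs R dL dZ).
Local Notation AL := (@cAL R dL dZ).
Local Notation L := (@cL R dL dZ).
Local Notation A := (@cA R dL dZ).
Local Notation Y := (@cY R dL dZ).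
Local Notation F := ((0 : R)^').
Context (P : probability O R) (Pt : R -> probability O R) (g : R -> O -> R) (s : O -> R).
Context (pA : R -> R) (pAL : R * dL.-tuple R -> R) (q : R -> R).
Context (w : dZ.-tuple R * dL.-tuple R -> R) (M e e' : R) (h h' : R * dL.-tuple R -> R).
Hypothesis hpA : is_density_A P pA.
Hypothesis hpAL : is_cond_density_AL P pAL.
Hypothesis hpos : positivity P pAL.
Hypothesis hq : measurable_fun [set: R] q.
Hypothesis hN : supp_q P q `<=` (supp_A P)°.
Hypothesis mw : measurable_fun setT w.
Hypothesis wM : forall zl, `|w zl| <= M.
Hypothesis e_gt0 : 0 < e.
Hypothesis e'_gt0 : 0 < e'.
Hypothesis tilt : regular_tilt q w e h P P (fun=> 1).
Hypothesis tilt' : \forall t \near F, regular_tilt q w e' h' P (Pt t) (g t).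
Hypothesis score : L2cvg P F (fun t o => (g t o - 1) / t) s.
Local Notation k := (moment_weight pA pAL q).
Local Notation PP := ((P \x P)%E : probability (O * O)%type R).
Local Notation cut := (cut P q).
Hypothesis kY : L2 P (fun o => k (AL o) * Y o).
Hypothesis kh : L2 P (fun o => k (AL o) * h (AL o)).
Hypothesis kh' : L2 P (fun o => k (AL o) * h' (AL o)).

Let mk : measurable_fun setT k := measurable_moment_weight hpA hpAL hq.
Let k0 a l : q a = 0 -> k (a, l) = 0 := @moment_weight0 R dL pA pAL q a l.
Let mm P' : measurable_fun setT (mu P' w) := measurable_mu P' w.

(** Each [g t] integrates to 1, so the difference quotients have mean 0, and the mean passes to the
    L^2 limit. *)
Lemma score_mean0 : \int[P]_o s o = 0.
Proof.
have : (fun t => \int[P]_o ((g t o - 1) / t * 1)) @ F --> \int[P]_o (s o * 1).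
  exact: L2cvg_dot score (L2cvg_cst (L2_cst P 1)).
rewrite (@Rintegral_ext _ _ _ _ _ s); last by move=> o; rewrite mulr1.
move=> lim; apply/esym; apply: (@cvg_unique _ _ _ _ _ _ _ lim) => //.
apply: (@cvg_near_eq _ _ F _ _ (fun=> 0)); last exact: cvg_cst.
apply: filterS tilt' => t tt.
have gi := L2_L1 (tilt_L2 tt).
have g1 : \int[P]_o g t o = 1.
  have := tiltE tt measurableT; rewrite probability_setT => E.
  by rewrite /Rintegral -E.
apply/esym; transitivity (t^-1 * \int[P]_o (g t o - 1)).
  rewrite -RintegralZl//; last by apply: L1B => //; exact: L1_cst.
  by apply: Rintegral_ext => o; ring.
by rewrite RintegralB//; [rewrite g1 Rintegral_prob_cst subrr mulr0|exact: L1_cst].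
Qed.

Let cvg_km := cvg_mu hpA hpAL hq mw wM e_gt0 e'_gt0 tilt tilt' score kY kh kh'.

(** [cut] is linear in its argument, so the norm bound of [L2_cut] applied to mu' - mu transfers
    [cvg_mu] to the product space. *)
Lemma cvg_cut_mu : L2cvg PP F (fun t z => cut (mu (Pt t) w) (cross z))
  (fun z => cut (mu P w) (cross z)).
Proof.
have [km2 _ km0] := cvg_km.
have kmu := L2_k_mu hpA hpAL hq mw wM e_gt0 tilt kh.
have [cP _] := L2_cut hpA hpAL hpos hq hN (mm P) kmu.
have mB t : measurable_fun setT (fun al => mu (Pt t) w al - mu P w al).
  by apply: measurable_funB; exact: measurable_mu.
have cE t z : cut (mu (Pt t) w) (cross z) - cut (mu P w) (cross z) =
    cut (fun al => mu (Pt t) w al - mu P w al) (cross z) by rewrite cutB.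
apply: L2cvg_sub0 => //; split; last 2 first.
- exact: L2_cst.
- apply: cvg0_le km0; near=> t.
  have kt : L2 P (fun o => k (AL o) * (mu (Pt t) w (AL o) - mu P w (AL o))) by near: t.
  have [c2 cle] := L2_cut hpA hpAL hpos hq hN (mB t) kt.
  rewrite ger0_norm; last by apply: Rintegral_ge0 => z _; exact: sqr_ge0.
  rewrite !Rintegral_sqr_subr0; apply: le_trans cle.
  by under eq_Rintegral do rewrite cE.
- near=> t.
  have kt : L2 P (fun o => k (AL o) * (mu (Pt t) w (AL o) - mu P w (AL o))) by near: t.
  have [c2 _] := L2_cut hpA hpAL hpos hq hN (mB t) kt.
  by move: c2; congr L2; apply/funext => z; rewrite cE.
Unshelve. all: by end_near. Qed.

Lemma cvg_psi_quotient :
  (fun t => t^-1 * (psi (supp_A P) q w (Pt t) - psi (supp_A P) q w P)) @ F -->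
  \int[P]_o (eif P pA pAL q w o * s o).
Proof.
have [_ s2 _] := score.
rewrite (eif_inner hpA hpAL hpos hq hN mw wM e_gt0 tilt kY kh s2 score_mean0).
have [km2 _ _] := cvg_km; have [d2 _ _] := score; have [c2 cP _] := cvg_cut_mu.
have mB t : measurable_fun setT (fun al => mu (Pt t) w al - mu P w al).
  by apply: measurable_funB; exact: measurable_mu.
pose dt t o := (g t o - 1) / t.
rewrite -[X in _ --> X]addr0.
(* With [g = 1 + t * dt], the product density minus 1, divided by [t], is
   [dt z.1 + dt z.2 + t * (dt z.1 * dt z.2)]. These three terms multiply [cut] of mu', and the
   change of mu under P x P gives the remaining term. *)
apply: (@cvg_near_eq _ _ F _ _ (fun t =>
   t^-1 * \int[P]_o (q (A o) * delta pA pAL (AL o) * (mu (Pt t) w (AL o) - mu P w (AL o))) +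
   \int[PP]_z (cut (mu (Pt t) w) (cross z) * (dt t z.1 * 1)) +
   \int[PP]_z (cut (mu (Pt t) w) (cross z) * (1 * dt t z.2)) +
   \int[PP]_z (cut (mu (Pt t) w) (cross z) * (t * (dt t z.1 * dt t z.2))))); last first.
  apply: cvgD; [apply: cvgD; [apply: cvgD|]|].
  - exact: (cvg_mu_quotient hpA hpAL hq mw wM e_gt0 e'_gt0 tilt tilt' score kY kh kh'
      (measurable_eif_K P w hq) (L2_eif_K hpA hpAL hpos hq hN mw wM e_gt0 tilt kh)
      (eif_K_test hpA hpAL hpos hq hN mw wM e_gt0 tilt kY kh)).
  - exact: L2cvg_dot cvg_cut_mu (L2cvg_tensor_fst score).
  - exact: L2cvg_dot cvg_cut_mu (L2cvg_tensor_snd score).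
  - have := L2cvg_dot cvg_cut_mu (L2cvg_tensor_vanishing (@cvg_dnbhs_id R) score).
    rewrite (@Rintegral_ext _ _ _ PP (fun z => cut (mu P w) (cross z) * 0) (fun=> 0)).
      rewrite Rintegral_prob_cst => lim; exact: lim.
    by move=> z; rewrite mulr0.
near=> t; have t0 : t != 0 by near: t; exact: nbhs_dnbhs_neq.
have tt : regular_tilt q w e' h' P (Pt t) (g t) by near: t.
have kt : L2 P (fun o => k (AL o) * (mu (Pt t) w (AL o) - mu P w (AL o))) by near: t.
have ct2 : L2 PP (fun z => cut (mu (Pt t) w) (cross z)) by near: t.
have dt2 : L2 P (dt t) by near: t.
have mct := measurable_comp_cross (measurable_cut P hq (mm (Pt t))).
have gg2 := L2_tensor (tilt_L2 tt) (tilt_L2 tt).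
have mg := tilt_measurable tt; have g0 := tilt_gt0 tt; have Pg := tiltE tt.
have i0 := L2M gg2 ct2.
pose PPt : probability (O * O)%type R := (Pt t \x Pt t)%E.
pose gg z := g t z.1 * g t z.2.
have mT : measurable_fun setT gg := measurable_tensor mg.
have gT : {ae PP, forall z, 0 < gg z} := tensor_gt0 g0.
have PgT B : measurable B -> PPt B = (\int[PP]_(z in B) (gg z)%:E)%E.
  exact: tensor_tiltE mg g0 Pg B.
have ci : L1 PPt (fun z => cut (mu (Pt t) w) (cross z)).
  suff [_] : L1 PPt (fun z => cut (mu (Pt t) w) (cross z)) <->
      L1 PP (fun z => gg z * cut (mu (Pt t) w) (cross z)) by apply.
  refine (@L1_tilt _ _ _ PP PPt gg mT _ _ _ _); first exact: gT; last exact: mct.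
  exact: PgT.
rewrite (psiE hq ci) (psiE hq (L2_L1 cP)).
have E : \int[PPt]_z cut (mu (Pt t) w) (cross z) = \int[PP]_z (gg z * cut (mu (Pt t) w) (cross z)).
  by refine (@Rintegral_tilt _ _ _ PP PPt gg mT _ _ _ ci); [exact: gT|exact: PgT].
rewrite E.
rewrite -(Rintegral_cut hpA hpAL hpos hq hN (mB t) kt).
have j1 := L2M ct2 (L2_tensor dt2 (L2_cst P 1)).
have j2 := L2M ct2 (L2_tensor (L2_cst P 1) dt2).
have j3 := L2M ct2 (L2Z t (L2_tensor dt2 dt2)).
have j0 := L1B (L2_L1 ct2) (L2_L1 cP).
rewrite (@Rintegral_ext _ _ _ _ (fun z => cut (fun al => mu (Pt t) w al - mu P w al) (cross z))
  (fun z => cut (mu (Pt t) w) (cross z) - cut (mu P w) (cross z))); last by move=> z; rewrite cutB.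
rewrite -RintegralB//; last exact: L2_L1.
rewrite -!RintegralZl//; last by apply: L1B => //; exact: L2_L1.
rewrite -!Rintegral_add//; [|by do ?[apply: L1D => //]; exact: L1Z..].
apply: Rintegral_ext => z; rewrite /gg /dt.
move: (cut _ _) (cut _ _) (g t z.1) (g t z.2) => ct cP' g1 g2.
by field.
Unshelve. all: by end_near. Qed.

End PathwiseDerivative.

(** * Invariance under equality of laws on measurable sets *)

Section EqualMeasures.
Context d d' (T : measurableType d) (U : measurableType d') (R : realType).
Context (P P' : probability T R).
Hypothesis PP' : forall B, measurable B -> P B = P' B.

Lemma eq_prob_integral D (f : T -> \bar R) : (\int[P]_(x in D) f x = \int[P']_(x in D) f x)%E.
Proof. by apply: eq_measure_integral => B mB _; exact: PP'. Qed.

Lemma eq_prob_Rintegral D (f : T -> R) : \int[P]_(x in D) f x = \int[P']_(x in D) f x.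
Proof. by rewrite /Rintegral eq_prob_integral. Qed.

(** Both laws have the same set of versions, and [xget] depends only on that set, so even the
    arbitrary choices coincide. *)
Lemma eq_prob_cond_exp (V : {mfun T >-> U}) X : cond_exp P V X = cond_exp P' V X.
Proof.
have iE (f : T -> \bar R) : P.-integrable setT f = P'.-integrable setT f.
  by apply/idP/idP => /integrableP[mf fi]; apply/integrableP; split => //;
    [rewrite -eq_prob_integral|rewrite eq_prob_integral].
rewrite /cond_exp; congr xget; apply/funext => g; apply/propext; rewrite /mkset /is_cond_exp !iE.
by split=> -[Xi mg gi E]; split => // B mB;
  [rewrite -!eq_prob_Rintegral|rewrite !eq_prob_Rintegral]; exact: E.
Qed.

Lemma eq_prob_distribution (V : {mfun T >-> U}) B : measurable B ->
  distribution P V B = distribution P' V B.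
Proof. by move=> mB; apply: PP'; rewrite -[X in measurable X]setTI; exact: measurable_funPT. Qed.

End EqualMeasures.

(** A submodel identifies [Pt 0] with P only on measurable sets, while the difference quotient
    subtracts the parameter at [Pt 0]; this bridges the two. *)
Lemma eq_prob_psi (R : realType) (dL dZ : nat) (P P' : probability (obs R dL dZ) R) S q w :
  (forall B, measurable B -> P B = P' B) -> psi S q w P = psi S q w P'.
Proof.
move=> PP'; have muE al : mu P w al = mu P' w al.
  by rewrite /mu /kappa /eta /rho !(eq_prob_cond_exp PP').
rewrite /psi /law_A (eq_prob_Rintegral (eq_prob_distribution PP' _)).
rewrite /Rintegral; congr fine; apply: eq_integral => a _; congr (_ * _)%:E.
rewrite -/(Rintegral _ _ _) -/(Rintegral _ _ _) /law_L.
rewrite (eq_prob_Rintegral (eq_prob_distribution PP' _)).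
by apply: Rintegral_ext => l; exact: muE.
Qed.

(** * Scores as L^2 limits, and approximation by bounded scores *)

Section ScoreLimits.
Context d (T : measurableType d) (R : realType) (P : probability T R).
Local Notation F := ((0 : R)^').

(** Convergence to 0 in the extended reals makes the remainder eventually of finite square integral;
    adding [s] puts the difference quotient, and then [g t], in L^2. *)
Lemma submodel_score (Pt : R -> probability T R) g s : is_submodel P Pt g s ->
  L2cvg P F (fun t o => (g t o - 1) / t) s /\ \forall t \near F, L2 P (g t).
Proof.
move=> [_ near_g ms si /fine_cvgP[fin lim]].
have s2 : L2 P s by [].
have {}near_g : \forall t \near F, measurable_fun setT (g t).
  by apply: nbhs_dnbhs; apply: filterS near_g => t [].
have r2 : \forall t \near F, L2 P (fun o => (g t o - 1) / t).
  near=> t; have mg : measurable_fun setT (g t) by near: t.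
  have mr : measurable_fun setT (fun o => (g t o - 1) / t).
    by apply: measurable_funM => //; exact: measurable_funB.
  have mrs : measurable_fun setT (fun o => (g t o - 1) / t - s o) by exact: measurable_funB.
  have D2 : L2 P (fun o => (g t o - 1) / t - s o).
    split => //; apply: L1P; first exact: measurable_funX.
    rewrite (eq_integral (fun o => (((g t o - 1) / t - s o) ^+ 2)%:E)).
      by rewrite ltey_eq; apply/orP; left; near: t.
    by move=> o _; rewrite ger0_norm// sqr_ge0.
  by have := L2D D2 s2; congr L2; apply/funext => o; rewrite subrK.
split; first by split.
near=> t; have t0 : t != 0 by near: t; exact: nbhs_dnbhs_neq.
have rt : L2 P (fun o => (g t o - 1) / t) by near: t.
have := L2D (L2Z t rt) (L2_cst P 1); congr L2; apply/funext => o.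
by rewrite mulrC divfK// subrK.
Unshelve. all: by end_near. Qed.

(** Remove the part [u] of [f] lying where [f ^ 2 > n], then add its mean [c] to recentre. The
    squared error is the variance of [u], at most the tail of [f ^ 2], and the bound is
    [sqrt n + |c|]. *)
Lemma bounded_approx (f : T -> R) (e : R) : L2 P f -> \int[P]_x f x = 0 -> 0 < e ->
  exists (s : T -> R) (C : R), [/\ measurable_fun setT s, forall x, `|s x| <= C, \int[P]_x s x = 0 &
    \int[P]_x (f x - s x) ^+ 2 < e].
Proof.
move=> f2 f0 e0; have mf := L2_measurable f2; have fi := L2_sqr f2.
have /cvgrPdist_lt/(_ e e0)[n _ /(_ n (leqnn n))] := L1_tail fi (fun x => sqr_ge0 _).
set H := [set y | _]; rewrite sub0r normrN ger0_norm => [He|]; last first.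
  by apply: Rintegral_ge0 => x _; rewrite mulr_ge0 ?sqr_ge0// indicE.
have mH : measurable H.
  rewrite -[X in measurable X]setTI; apply: measurable_fun_ltr => //.
  exact: measurable_funX.
have m1 : measurable_fun setT (\1_H : T -> R) by exact: measurable_indic.
pose u x := \1_H x * f x.
have u2 : L2 P u.
  apply: (L2M_bounded (C := 1)) => //; apply: aeW => x.
  by rewrite ger0_norm indicE//; case: (_ \in _).
pose c := \int[P]_x u x.
have ui := L2_L1 u2.
exists (fun x => f x - u x + c), (Num.sqrt n%:R + `|c|); split.
- apply: measurable_funD => //; apply: measurable_funB => //; exact: L2_measurable u2.
- move=> x; rewrite (le_trans (ler_normD _ _))// lerD2r /u indicE.
  have [xH|xH] := boolP (x \in H); first by rewrite mul1r subrr normr0 sqrtr_ge0.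
  rewrite mul0r subr0 -sqrtr_sqr ler_wsqrtr// leNgt.
  by apply/negP => nf; move/negP: xH; apply; rewrite inE.
- rewrite (@Rintegral_ext _ _ _ P (fun x => f x - u x + c) (fun x => (f x + - u x) + c))//.
  rewrite !Rintegral_add//; [|exact: L2_L1|exact: L1N|exact: L1B (L2_L1 f2) ui|exact: L1_cst].
  rewrite Rintegral_prob_cst f0 add0r.
  rewrite (@Rintegral_ext _ _ _ P (fun x => - u x) (fun x => -1 * u x)).
    by rewrite RintegralZl// mulN1r addNr.
  by move=> x; rewrite mulN1r.
- apply: le_lt_trans He.
  rewrite (@Rintegral_ext _ _ _ P _ (fun x => (u x ^+ 2 + (- 2 * c) * u x) + c ^+ 2)); last first.
    by move=> x; ring.
  rewrite !Rintegral_add//; [|exact: L2_sqr|exact: L1Z|by apply: L1D; [exact: L2_sqr|exact: L1Z]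
    |exact: L1_cst].
  rewrite RintegralZl// Rintegral_prob_cst -/c.
  rewrite [leRHS](@Rintegral_ext _ _ _ P _ (fun x => u x ^+ 2)).
    by have := sqr_ge0 c; nra.
  move=> x; rewrite /u indicE exprMn mulrC; congr (_ * _).
  by case: (_ \in _); rewrite ?expr1n ?expr0n.
Qed.

Lemma exists_density_prob (f : T -> R) : (forall x, 0 <= f x) -> L1 P f -> \int[P]_x f x = 1 ->
  exists P' : probability T R, forall B, measurable B -> P' B = (\int[P]_(x in B) (f x)%:E)%E.
Proof.
move=> f0 fi f1.
pose nu : {measure set T -> \bar R} := density_measure f0 fi.
have nu1 : nu setT = 1%E by rewrite /nu /= /density_measure (integralE_L1 fi) f1.
pose P' : probability T R := HB.pack (density_measure f0 fi)
  (Measure_isProbability.Build _ _ _ (density_measure f0 fi) nu1).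
by exists P'.
Qed.

End ScoreLimits.

(** * Conditional expectations under a tilt with density between 1/2 and 3/2 *)

Section BoundedTilt.
Context d d' (T : measurableType d) (U : measurableType d') (R : realType).
Context (P P' : probability T R) (s : T -> R) (C t : R).
Hypothesis ms : measurable_fun [set: T] s.
Hypothesis sC : forall x, `|s x| <= C.
Hypothesis tC : `|t| * C <= 2^-1.
Hypothesis P'E : forall B, measurable B -> P' B = (\int[P]_(x in B) (1 + t * s x)%:E)%E.
Implicit Types (V : {mfun T >-> U}) (X : T -> R).

Let g x := 1 + t * s x.

Let ts x : `|t * s x| <= 2^-1.
Proof. by rewrite normrM (le_trans _ tC)// ler_wpM2l. Qed.

Lemma bounded_tilt_ge x : 2^-1 <= 1 + t * s x.
Proof. by have := ts x; rewrite ler_norml => /andP[? _]; lra. Qed.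

Lemma bounded_tilt_le x : 1 + t * s x <= 3 / 2.
Proof. by have := ts x; rewrite ler_norml => /andP[_ ?]; lra. Qed.

Lemma measurable_bounded_tilt : measurable_fun setT (fun x => 1 + t * s x).
Proof. by apply: measurable_funD => //; exact: measurable_funM. Qed.

Let mg : measurable_fun setT g := measurable_bounded_tilt.

Lemma bounded_tilt_gt0 : {ae P, forall x, 0 < 1 + t * s x}.
Proof. by apply: aeW => x; have := bounded_tilt_ge x; lra. Qed.

Let g0 := bounded_tilt_gt0.

Lemma L1_bounded_tilt X : L1 P' X <-> L1 P X.
Proof.
split=> Xi; have mX := L1_measurable Xi.
- have gX := (L1_tilt mg g0 P'E mX).1 Xi.
  apply: (L1_le mX (L1Z 2 gX)) => x; rewrite mulrA normrM ler_peMl// ger0_norm.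
    by have := bounded_tilt_ge x; rewrite /g; lra.
  by have := bounded_tilt_ge x; rewrite /g; lra.
- apply/(L1_tilt mg g0 P'E mX); apply: (L1M_bounded (C := 3 / 2)) => //.
  apply: aeW => x; rewrite ger0_norm ?bounded_tilt_le//.
  by have := bounded_tilt_ge x; rewrite /g; lra.
Qed.

Let test_tilt V X g' B : is_cond_exp P' V X g' -> measurable B ->
  \int[P]_x (g x * (\1_B (V x) * X x)) = \int[P]_x (g x * (\1_B (V x) * g' (V x))).
Proof.
move=> Xg' mB; have [Xi mg' gi' _] := Xg'.
have mBU : measurable_fun setT (\1_B : U -> R) by exact: measurable_indic.
have B1 (y : U) : `|(\1_B y : R)| <= 1 by rewrite indicE; case: (_ \in _); rewrite ?normr1 ?normr0.
have mBV := measurable_comp_mfun V mBU.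
have BL f : L1 P' f -> L1 P' (fun x => \1_B (V x) * f x).
  by move=> fi; apply: (L1M_bounded (C := 1)) => //; exact: aeW.
rewrite -(Rintegral_tilt mg g0 P'E (BL _ Xi)).
rewrite -(Rintegral_tilt mg g0 P'E (BL (fun x => g' (V x)) gi')).
exact: cond_exp_test_bounded Xg' mBU B1.
Qed.

(** The factor 3 is the ratio of the upper bound 3/2 to the lower bound 1/2 of the density: one is
    used to leave P' and the other to enter it. *)
Lemma bounded_tilt_cond_exp_le V X y y' : (forall x, 0 <= X x) ->
  is_cond_exp P V X y -> is_cond_exp P' V X y' -> {ae P', forall x, y' (V x) <= 3 * y (V x)}.
Proof.
move=> X0 Xy Xy'; have [Xi my yi _] := Xy; have [Xi' my' yi' _] := Xy'.
apply/(ae_tilt mg g0 P'E).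
have yi'P := (L1_bounded_tilt (y' \o V)).1 yi'.
apply: (@ae_le_on_sigma _ _ _ _ _ P V y' (fun u => 3 * y u)) => //.
- exact: measurable_funM.
- exact: (L1Z 3 (f := y \o V)).
- move=> B mB.
  have mBU : measurable_fun setT (\1_B : U -> R) by exact: measurable_indic.
  have B0 (u : U) : 0 <= (\1_B u : R) by rewrite indicE.
  have B1 (u : U) : `|(\1_B u : R)| <= 1 by rewrite ger0_norm// indicE; case: (_ \in _).
  have mBV := measurable_comp_mfun V mBU.
  have BL f : L1 P f -> L1 P (fun x => \1_B (V x) * f x).
    by move=> fi; apply: (L1M_bounded (C := 1)) => //; exact: aeW.
  have gL f : L1 P f -> L1 P (fun x => g x * f x).
    move=> fi; apply: (L1M_bounded (C := 3 / 2)) => //; apply: aeW => x.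
    by rewrite ger0_norm ?bounded_tilt_le//; have := bounded_tilt_ge x; rewrite /g; lra.
  apply: (@le_trans _ _ (2 * \int[P]_x (g x * (\1_B (V x) * y' (V x))))).
    rewrite -RintegralZl//; last exact/gL/(BL (fun x => y' (V x))).
    apply: le_Rintegral_ae.
    + exact: (BL (fun x => y' (V x))).
    + exact/L1Z/gL/(BL (fun x => y' (V x))).
    + have := (ae_tilt mg g0 P'E _).1 (cond_exp_ge0 Xy' X0).
      apply: filterS => x y'0; rewrite mulrA ler_peMl ?mulr_ge0//.
      by have := bounded_tilt_ge x; rewrite /g; lra.
  rewrite -(test_tilt Xy' mB) -RintegralZl//; last exact/gL/BL.
  apply: (@le_trans _ _ (3 * \int[P]_x (\1_B (V x) * X x))).
    rewrite -RintegralZl//; last exact: BL.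
    apply: le_Rintegral => //; [exact/L1Z/gL/BL|exact/L1Z/BL|].
    move=> x _; rewrite mulrA ler_wpM2r ?mulr_ge0//.
    by have := bounded_tilt_le x; rewrite /g; lra.
  rewrite (cond_exp_test_bounded Xy mBU B1) -RintegralZl//; last exact: (BL (fun x => y (V x))).
  by apply: le_Rintegral => // [||x _];
    [apply: L1Z; exact: (BL (fun x => y (V x)))
    |have := L1Z 3 (BL _ yi); congr L1; apply/funext => x; rewrite /=; ring
    |rewrite mulrCA].
Qed.

Let close V X M m m' : (forall x, `|X x| <= M) ->
  is_cond_exp P V X m -> is_cond_exp P' V X m' ->
  {ae P, forall x, m (V x) <= m' (V x) + 2 * M * (`|t| * C)}.
Proof.
move=> XM Xm Xm'; have [Xi mm mi _] := Xm; have [Xi' mm' mi' _] := Xm'.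
have mi'P := (L1_bounded_tilt (m' \o V)).1 mi'.
pose b := 2 * M * (`|t| * C).
apply: (@ae_le_on_sigma _ _ _ _ _ P V m (fun u => m' u + b)) => //.
- exact: measurable_funD.
- by apply: (L1D (f := m' \o V)) => //; exact: L1_cst.
- move=> B mB.
  have mBU : measurable_fun setT (\1_B : U -> R) by exact: measurable_indic.
  have B0 (u : U) : 0 <= (\1_B u : R) by rewrite indicE.
  have B1 (u : U) : `|(\1_B u : R)| <= 1 by rewrite ger0_norm// indicE; case: (_ \in _).
  have mBV := measurable_comp_mfun V mBU.
  have BL f : L1 P f -> L1 P (fun x => \1_B (V x) * f x).
    by move=> fi; apply: (L1M_bounded (C := 1)) => //; exact: aeW.
  have gL f : L1 P f -> L1 P (fun x => g x * f x).
    move=> fi; apply: (L1M_bounded (C := 3 / 2)) => //; apply: aeW => x.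
    by rewrite ger0_norm ?bounded_tilt_le//; have := bounded_tilt_ge x; rewrite /g; lra.
  have BX := BL _ Xi; have Bm' := BL (fun x => m' (V x)) mi'P.
  have Bb := BL _ (L1_cst P b).
  rewrite -(cond_exp_test_bounded Xm mBU B1).
  rewrite (@Rintegral_ext _ _ _ P (fun x => \1_B (V x) * (m' (V x) + b))
    (fun x => \1_B (V x) * m' (V x) + \1_B (V x) * b)); last by move=> x; rewrite mulrDr.
  rewrite Rintegral_add// -lerBlDl.
  (* Under P' the residual [X - m'] integrates to 0 over events of [V], so under P only the factor
     [1 - g], of size at most [|t| C], remains; the residual is bounded by [2 M]. *)
  have E : \int[P]_x (\1_B (V x) * X x) - \int[P]_x (\1_B (V x) * m' (V x)) =
      \int[P]_x ((1 - g x) * (\1_B (V x) * (X x - m' (V x)))).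
    rewrite (@Rintegral_ext _ _ _ P (fun x => (1 - g x) * (\1_B (V x) * (X x - m' (V x))))
      (fun x => (\1_B (V x) * X x - \1_B (V x) * m' (V x)) -
        (g x * (\1_B (V x) * X x) - g x * (\1_B (V x) * m' (V x))))); last by move=> x; ring.
    rewrite RintegralB//; [|exact: L1B|by apply: L1B; exact: gL].
    rewrite RintegralB//.
    rewrite [X in _ = _ - X]RintegralB//; [|exact: gL|exact: gL].
    by rewrite (test_tilt Xm' mB) subrr subr0.
  rewrite E; apply: le_Rintegral_ae => //.
  + have BXm : L1 P (fun x => \1_B (V x) * (X x - m' (V x))).
      by have := L1B BX Bm'; congr L1; apply/funext => x; rewrite mulrBr.
    have := L1B BXm (gL _ BXm); congr L1; apply/funext => x; ring.
  + have := (ae_tilt mg g0 P'E _).1 (cond_exp_bounded Xm' XM).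
    apply: filterS => x m'M; rewrite mulrCA ler_wpM2l//.
    rewrite (le_trans (ler_norm _))// /b mulrC normrM ler_pM//.
      by rewrite (le_trans (ler_normB _ _))// mulr2n mulrDl !mul1r lerD.
    by rewrite /g opprD addrA subrr sub0r normrN normrM ler_wpM2l.
Qed.

Lemma bounded_tilt_cond_exp_close V X M m m' : (forall x, `|X x| <= M) ->
  is_cond_exp P V X m -> is_cond_exp P' V X m' ->
  {ae P, forall x, `|m' (V x) - m (V x)| <= 2 * M * (`|t| * C)}.
Proof.
move=> XM Xm Xm'; have := close XM Xm Xm'.
have NXM x : `|- X x| <= M by rewrite normrN.
apply: filterS2 (close NXM (is_cond_expN Xm) (is_cond_expN Xm')) => x; set b := 2 * M * _.
by move=> u1 u2; rewrite ler_norml; lra.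
Qed.

End BoundedTilt.

Lemma is_cond_exp_ae d d' (T : measurableType d) (U : measurableType d') (R : realType)
    (P : probability T R) (V : {mfun T >-> U}) (X : T -> R) (g g' : U -> R) :
  is_cond_exp P V X g -> measurable_fun setT g' -> {ae P, forall x, g' (V x) = g (V x)} ->
  is_cond_exp P V X g'.
Proof.
move=> [Xi mg gi E] mg' gg'; have mgV := measurable_comp_mfun V mg'.
split => //.
  apply: (@L1_le_ae _ _ _ P (g' \o V) (g \o V)) => //.
  by apply: filterS gg' => x /= ->.
move=> B mB; rewrite E//; rewrite /Rintegral; congr fine; apply: ae_eq_integral => //.
- by rewrite -[X in measurable X]setTI; exact: measurable_funPT.
- by apply/measurable_EFinP; apply: measurable_funTS; exact: measurable_comp_mfun.
- by apply/measurable_EFinP; exact: measurable_funTS.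
- by apply: filterS gg' => x -> _.
Qed.

(** * The influence function and its membership in the tangent space *)

Section EfficientInfluenceFunction.
Context (R : realType) (dL dZ : nat).
Local Notation O := (obs R dL dZ).
Local Notation AL := (@cAL R dL dZ).
Local Notation L := (@cL R dL dZ).
Local Notation Y := (@cY R dL dZ).
Local Notation F := ((0 : R)^').
Context (P : probability O R).
Context (pA : R -> R) (pAL : R * dL.-tuple R -> R) (q : R -> R).
Context (w : dZ.-tuple R * dL.-tuple R -> R).
Hypothesis hpA : is_density_A P pA.
Hypothesis hpAL : is_cond_density_AL P pAL.
Hypothesis hpos : positivity P pAL.
Hypothesis hq : measurable_fun [set: R] q.
Hypothesis hY : P.-integrable [set: O] (EFin \o Y).
Hypothesis hmom : (weighted_moment P pA pAL q Y < +oo)%E.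
Hypothesis hw : urwf P w (supp_q P q).
Local Notation k := (moment_weight pA pAL q).
Local Notation absY := (fun o : O => `|Y o|).
Local Notation h := (cond_exp P AL absY).

Let mk : measurable_fun setT k := measurable_moment_weight hpA hpAL hq.
Let mkAL := measurable_comp_mfun AL mk.

Let weightE (f : O -> R) o : (1 + delta pA pAL (AL o) ^+ 2) * q (cA o) ^+ 2 * (1 + f o ^+ 2) =
  k (AL o) ^+ 2 + (k (AL o) * f o) ^+ 2.
Proof. by rewrite -(sqr_moment_weight pA pAL q (AL o)) mulrDr mulr1 -exprMn. Qed.

Lemma L2_weighted_moment (f : O -> R) : measurable_fun setT f ->
  (weighted_moment P pA pAL q f < +oo)%E ->
  L2 P (fun o => k (AL o)) /\ L2 P (fun o => k (AL o) * f o).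
Proof.
move=> mf fin; have mkf := measurable_funM mkAL mf.
have G : L1 P (fun o => k (AL o) ^+ 2 + (k (AL o) * f o) ^+ 2).
  apply: L1P; first by apply: measurable_funD; exact: measurable_funX.
  apply: le_lt_trans fin; rewrite le_eqVlt; apply/orP; left; apply/eqP.
  by apply: eq_integral => o _; rewrite weightE ger0_norm// addr_ge0// sqr_ge0.
by split; split => //; apply: L1_le G _; try exact: measurable_funX; move=> o;
   rewrite !ger0_norm ?addr_ge0 ?sqr_ge0// (lerDl, lerDr) sqr_ge0.
Qed.

Lemma weighted_moment_ltoo (f : O -> R) : L2 P (fun o => k (AL o)) ->
  L2 P (fun o => k (AL o) * f o) -> (weighted_moment P pA pAL q f < +oo)%E.
Proof.
move=> k2 kf2; have G := L1D (L2_sqr k2) (L2_sqr kf2).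
rewrite /weighted_moment (eq_integral (fun o => (k (AL o) ^+ 2 + (k (AL o) * f o) ^+ 2)%:E)).
  by rewrite (integralE_L1 G) ltry.
by move=> o _; rewrite weightE.
Qed.

Let k2 : L2 P (fun o => k (AL o)) := (L2_weighted_moment (@measurable_cY R dL dZ) hmom).1.
Let kY : L2 P (fun o => k (AL o) * Y o) :=
  (L2_weighted_moment (@measurable_cY R dL dZ) hmom).2.

Let absYh : is_cond_exp P AL absY h.
Proof. by apply: cond_expP; exact: L1_norm. Qed.

Let mh : measurable_fun setT h. Proof. by have [] := absYh. Qed.

(** The moment condition concerns Y; conditional Jensen passes it to the conditional mean of [|Y|],
    which is the dominating function at P itself. *)
Let kh : L2 P (fun o => k (AL o) * h (AL o)).
Proof.
apply: (L2_cond_exp absYh mk); apply: (L2_le_ae (C := 1)) kY _.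
  apply: measurable_funM => //; apply: measurableT_comp => //; exact: measurable_cY.
by apply: aeW => o; rewrite !normrM normr_id mul1r.
Qed.

Let hN : supp_q P q `<=` (supp_A P)°. Proof. by case: hw. Qed.
Let mw : measurable_fun setT w. Proof. by case: hw. Qed.

Lemma regular_tilt_refl e : kappa_bounded_below P w (supp_q P q) e ->
  regular_tilt q w e h P P (fun=> 1).
Proof.
move=> He; split => //.
- exact: aeW.
- by move=> B mB; rewrite integral_cst// mul1e.
- exact: (L2_cst P 1).
- exact: aeW.
Qed.

Lemma near_regular_tilt Pt g s : is_submodel P Pt g s -> regular_submodel P pA pAL q w Pt ->
  exists e' h', [/\ 0 < e', L2 P (fun o => k (AL o) * h' (AL o)) &
    \forall t \near F, regular_tilt q w e' h' P (Pt t) (g t)].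
Proof.
move=> sub [[e' e'0 He'] HY [h' [mh' mom' Hh']]].
have [_ g2] := submodel_score sub; have [_ Hg _ _ _] := sub.
have [_ kh'] := L2_weighted_moment (measurable_comp_mfun AL mh') mom'.
exists e', h'; split => //; near=> t.
have [mg g0 PgE] : [/\ measurable_fun setT (g t), {ae P, forall o, 0 < g t o} &
  forall B, measurable B -> Pt t B = (\int[P]_(o in B) (g t o)%:E)%E].
  by near: t; exact: nbhs_dnbhs.
split => //; near: t; try exact: nbhs_dnbhs; exact: g2.
Unshelve. all: by end_near. Qed.

Lemma eif_derivative Pt g s : is_submodel P Pt g s -> regular_submodel P pA pAL q w Pt ->
  is_derive (0 : R) (1 : R) (fun t : R => psi (supp_A P) q w (Pt t) : R)
    (\int[P]_o (eif P pA pAL q w o * s o)).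
Proof.
move=> sub reg; have [_ _ [M wM] [e e0 He]] := hw.
have [e' [h' [e'0 kh' tilt']]] := near_regular_tilt sub reg.
have [score _] := submodel_score sub.
have lim := cvg_psi_quotient hpA hpAL hpos hq hN mw wM e0 e'0 (regular_tilt_refl He) tilt'
  score kY kh kh'.
have P0 : psi (supp_A P) q w (Pt 0) = psi (supp_A P) q w P.
  by have [P0 _ _ _ _] := sub; exact: eq_prob_psi.
have lim' : (fun t : R => t^-1 *: ((fun t : R => psi (supp_A P) q w (Pt t) : R) (t *: (1 : R) + 0) -
    psi (supp_A P) q w (Pt 0))) @ F --> \int[P]_o (eif P pA pAL q w o * s o).
  by apply: cvg_near_eq lim; near=> t; rewrite P0 addr0 /GRing.scale /= mulr1.
apply: DeriveDef; first by apply/cvg_ex; exists (\int[P]_o (eif P pA pAL q w o * s o)).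
exact: cvg_lim.
Unshelve. all: by end_near. Qed.

Lemma eif_influence_function : is_influence_function P (regular_submodel P pA pAL q w)
  (psi (supp_A P) q w) (eif P pA pAL q w).
Proof.
have [_ _ [M wM] [e e0 He]] := hw; have tilt := regular_tilt_refl He.
have [meif eif2] := L2_eif hpA hpAL hpos hq hN mw wM e0 tilt kY kh.
split => //; first exact: (eif_mean0 hpA hpAL hpos hq hN mw wM e0 tilt kY kh).
exact: eif_derivative.
Qed.

(** * Linear submodels with a bounded score are regular *)

Section BoundedScore.
Context (s : O -> R) (C : R).
Hypothesis ms : measurable_fun [set: O] s.
Hypothesis sC : forall o, `|s o| <= C.
Hypothesis s0 : \int[P]_o s o = 0.

Let near_small (b : R) : 0 < b -> \forall t \near (0 : R), `|t| * C < b.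
Proof.
move=> b0; have C0 : 0 <= C := le_trans (normr_ge0 _) (sC point).
near=> t; have : `|t| < b / (C + 1).
  by near: t; apply: (@nbhs0_lt _ R^o); rewrite divr_gt0// ltr_wpDl.
rewrite ltr_pdivlMr; last by rewrite ltr_wpDl.
by apply: le_lt_trans; rewrite ler_wpM2l// lerDl.
Unshelve. all: by end_near. Qed.

Let si : L1 P s.
Proof. by apply: L2_L1; apply: (L2_bounded (C := C)) => //; exact: aeW. Qed.

Lemma exists_bounded_tilt : exists Pt : R -> probability O R, forall t, `|t| * C <= 2^-1 ->
  forall B, measurable B -> Pt t B = (\int[P]_(o in B) (1 + t * s o)%:E)%E.
Proof.
suff /choice[Pt PtE] : forall t, exists P' : probability O R, `|t| * C <= 2^-1 ->
    forall B, measurable B -> P' B = (\int[P]_(o in B) (1 + t * s o)%:E)%E by exists Pt.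
(* For larger [t] the density might be negative. P is then a placeholder, since only parameters near
   0 matter. *)
move=> t; have [tC|_] := boolP (`|t| * C <= 2^-1); last by exists P.
suff [P' P'E] : exists P' : probability O R,
    forall B, measurable B -> P' B = (\int[P]_(o in B) (1 + t * s o)%:E)%E by exists P'.
apply: exists_density_prob.
- by move=> o; have := bounded_tilt_ge sC tC o; lra.
- by apply: L1D; [exact: L1_cst|exact: L1Z].
- rewrite Rintegral_add//; [|exact: L1_cst|exact: L1Z].
  by rewrite Rintegral_prob_cst RintegralZl// s0 mulr0 addr0.
Qed.

Context (Pt : R -> probability O R).
Hypothesis PtE : forall t, `|t| * C <= 2^-1 ->
  forall B, measurable B -> Pt t B = (\int[P]_(o in B) (1 + t * s o)%:E)%E.

Let near_half : \forall t \near (0 : R), `|t| * C <= 2^-1.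
Proof.
have half_gt0 : (0 : R) < 2^-1 by rewrite invr_gt0.
by apply: filterS (near_small half_gt0) => t /ltW.
Qed.

Lemma bounded_tilt_submodel : is_submodel P Pt (fun t o => 1 + t * s o) s.
Proof.
split => //.
- move=> B mB; rewrite PtE ?normr0 ?mul0r ?invr_ge0//.
  under eq_integral do rewrite mul0r addr0.
  by rewrite integral_cst// mul1e.
- apply: filterS near_half => t tC; split; [exact: measurable_bounded_tilt|
    exact: bounded_tilt_gt0 sC tC|exact: PtE].
- by apply: L2_sqr; apply: (L2_bounded (C := C)) => //; exact: aeW.
(* For [t != 0] the difference quotient of [1 + t s] equals [s] exactly, so the remainder is
   identically 0. *)
- have lim : (fun=> 0%:E : \bar R) @ F --> (0%:E : \bar R) by exact: cvg_cst.
  apply: cvg_trans lim; apply: near_eq_cvg; near=> t.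
  have t0 : t != 0 by near: t; exact: nbhs_dnbhs_neq.
  apply/esym; rewrite (eq_integral (fun=> 0%E)) ?integral0// => o _.
  by rewrite addrAC subrr add0r mulrC mulKf// subrr expr0n.
Unshelve. all: by end_near. Qed.

Lemma bounded_tilt_kappa e : 0 < e -> kappa_bounded_below P w (supp_q P q) e ->
  \forall t \near (0 : R), kappa_bounded_below (Pt t) w (supp_q P q) (e / 2).
Proof.
move=> e0 [m [r [Zm Zr mr]]]; have [_ _ [M wM] _] := hw.
have M0 : 0 <= M := le_trans (normr_ge0 _) (wM point).
have Zi : L1 P (Zpi w) by exact: L1_Zpi mw wM.
near=> t; have tC : `|t| * C <= 2^-1 by near: t; exact: near_half.
have tE := PtE tC.
have mg : measurable_fun setT (fun o => 1 + t * s o) by exact: measurable_bounded_tilt.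
have g0 := bounded_tilt_gt0 P sC tC.
pose c := 2 * M * (`|t| * C).
have ce : c <= e / 4.
  (* Each of the two conditional means moves by at most [c], which this choice keeps below [e / 4];
     together they cost at most half of [e]. The summand 1 keeps the divisor positive when
     [M = 0]. *)
  have : `|t| * C <= e / (8 * (M + 1)).
    by apply/ltW; near: t; apply: near_small; rewrite divr_gt0// mulr_gt0// ltr_wpDl.
  rewrite ler_pdivlMr ?mulr_gt0 ?ltr_wpDl// /c => H.
  have C0 : 0 <= C := le_trans (normr_ge0 _) (sC point).
  have := mulr_ge0 (normr_ge0 t) C0; nra.
have c0 : 0 <= c.
  have C0 : 0 <= C := le_trans (normr_ge0 _) (sC point).
  by rewrite /c !mulr_ge0.
(* The version required by [kappa_bounded_below] must be close to [m] at every single [a];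
   truncating the a.e. small correction makes it so everywhere. *)
pose clip (x : R) := Num.max (- c) (Num.min x c).
have clip_le x : `|clip x| <= c.
  rewrite /clip ler_norml le_max lexx /= ge_max ge_min lexx orbT andbT.
  by rewrite ge0_cp.
have clip_id x : `|x| <= c -> clip x = x.
  by rewrite ler_norml => /andP[cx xc]; rewrite /clip (min_idPl xc) (max_idPr cx).
have Zti : L1 (Pt t) (Zpi w) by exact: L1_Zpi mw wM.
have shift d (U : measurableType d) (V : {mfun O >-> U}) (f : U -> R) :
    is_cond_exp P V (Zpi w) f -> exists f', is_cond_exp (Pt t) V (Zpi w) f' /\
      forall u, `|f' u - f u| <= c.
  move=> Zf; have Zft := cond_expP V Zti; set ft := cond_exp _ _ _ in Zft.
  have [_ mf _ _] := Zf; have [_ mft _ _] := Zft.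
  exists (fun u => f u + clip (ft u - f u)); split => [|u]; last by rewrite addrAC subrr add0r.
  apply: (is_cond_exp_ae Zft).
    apply: measurable_funD => //; apply: measurable_maxr => //; apply: measurable_minr => //.
    exact: measurable_funB.
  apply/(ae_tilt mg g0 tE).
  have ZM o : `|Zpi w o| <= M by exact: wM.
  apply: filterS (bounded_tilt_cond_exp_close ms sC tC tE ZM Zf Zft) => x.
  by move=> /clip_id ->; rewrite addrC subrK.
have [m' [Zm' m'm]] := shift _ _ _ _ Zm; have [r' [Zr' r'r]] := shift _ _ _ _ Zr.
exists m', r'; split => // a Na; have [N [mN N0 NQ]] := mr a Na.
exists N; split => //.
  apply/(null_tilt mg g0 tE) => //.
  by rewrite -[X in measurable X]setTI; exact: measurable_funPT.
move=> l nl; apply: NQ => el; apply: nl => /=.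
have := m'm (a, l); have := r'r l; move: el => /=.
rewrite !ler_norml ler_normr => el /andP[r1 r2] /andP[m1 m2]; rewrite ler_normr.
by case/orP: el => el; apply/orP; [left|right]; lra.
Unshelve. all: by end_near. Qed.

Lemma bounded_tilt_regular : regular_submodel P pA pAL q w Pt.
Proof.
have [_ _ _ [e e0 He]] := hw; split.
- by exists (e / 2); [rewrite divr_gt0|exact: bounded_tilt_kappa].
- by apply: filterS near_half => t tC; apply/(L1_bounded_tilt ms sC tC (PtE tC)).
- exists (fun al => 3 * h al); split; first exact: measurable_funM.
    apply: weighted_moment_ltoo => //.
    by have := L2Z 3 kh; congr L2; apply/funext => o /=; rewrite mulrCA.
  apply: filterS near_half => t tC; have tE := PtE tC.
  apply: (bounded_tilt_cond_exp_le ms sC tC tE _ absYh) => //.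
  by apply: cond_expP; apply: L1_norm; apply/(L1_bounded_tilt ms sC tC tE).
Qed.

End BoundedScore.

(** A bounded mean-zero approximation of [phi] is itself the score of a regular linear submodel, so
    a one-term combination is enough. This also shows that the regularity conditions leave the
    tangent space as large as possible. *)
Lemma mean0_in_tangent_space phi : L2 P phi -> \int[P]_o phi o = 0 ->
  in_tangent_space P (regular_submodel P pA pAL q w) phi.
Proof.
move=> phi2 phi0 e e0; have [s [C [ms sC s0 close]]] := bounded_approx phi2 phi0 e0.
have [Pt PtE] := exists_bounded_tilt ms sC s0.
have s2 : L2 P s by apply: (L2_bounded (C := C)) => //; exact: aeW.
exists 1%N, (fun=> 1), (fun=> s); split.
  move=> _; exists Pt, (fun t o => 1 + t * s o); split.
    exact: bounded_tilt_submodel PtE.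
  exact: bounded_tilt_regular PtE.
under eq_integral do rewrite big_ord1 mul1r.
by rewrite (integralE_L1 (L2_sqr (L2B phi2 s2))) lte_fin.
Qed.

End EfficientInfluenceFunction.

Theorem theorem3p2 (R : realType) (dL dZ : nat)
  (P : probability (obs R dL dZ) R)
  (pA : R -> R) (pAL : R * dL.-tuple R -> R)
  (q : R -> R) (w : dZ.-tuple R * dL.-tuple R -> R)
  (hpA : is_density_A P pA) (hpAL : is_cond_density_AL P pAL)
  (hpos : positivity P pAL)
  (hq : measurable_fun [set: R] q)
  (hY : P.-integrable [set: obs R dL dZ] (EFin \o @cY R dL dZ))
  (hmom : (weighted_moment P pA pAL q (@cY R dL dZ) < +oo)%E)
  (hw : urwf P w (supp_q P q)) :
  is_efficient_influence_function P (regular_submodel P pA pAL q w)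
    (psi (supp_A P) q w) (eif P pA pAL q w).
Proof.
have inf := eif_influence_function hpA hpAL hpos hq hY hmom hw; split => //.
have [meif eif2 eif0 _] := inf.
by apply: (mean0_in_tangent_space hpA hpAL hq hY hmom hw) => //; split.
Qed.
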